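(* Let $\xi_1,\xi_2,\ldots$ be i.i.d. random elements with law $P$ in a measurable space $(\mathcal X,\mathcal A)$, and let $\mathcal F$ be a collection of square-integrable measurable functions $f:\mathcal X\to\mathbb R$. Let $$\tilde{\mathbb Z}_{(n,k^* )}(x,f)=\frac1{\sqrt n}\sum_{i\in J_{[nx]}\setminus J_{k^*_{[nx]}}}\big(f(\xi_i)-Pf\big),\qquad (x,f)\in[0,1]\times\mathcal F,$$ be the deleting-item sequential empirical process, where for each $m$ the set $J_{k^*_m}$ is an arbitrary set of $k^*_m$ different elements of $J_m=\{1,\ldots,m\}$. If $\lim_{n\to\infty}k^*_n/n=0$, then the marginals of the sequence of processes $\{\tilde{\mathbb Z}_{(n,k^* )}(x,f):(x,f)\in[0,1]\times\mathcal F\}$ converge in distribution to the marginals of a Gaussian process $\mathbb Z$ (known as the Kiefer–Müller process) with zero mean and covariance $$\operatorname{cov}(\mathbb Z(s,f),\mathbb Z(t,g))=(s\wedge t)\,(Pfg-Pf\,Pg).$$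
   Context: $Pf=\int_{\mathcal X}f\,dP$, square-integrability is with respect to $P$, $[x]$ is the largest integer $\le x$, and $s\wedge t=\min\{s,t\}$. ''Marginals'' are the finite-dimensional distributions of the process indexed by $[0,1]\times\mathcal F$. The deletion number $k^*=k^*_m$ is either a constant $k$ or a function $k(m)$ of $m$, with $0\le k^*_m<m$ (for those small $m$ for which this is impossible, nothing is deleted; an empty sum is $0$). *)

(* Defs.v *)
From HB Require Import structures.
From mathcomp Require Import all_boot all_order all_algebra finmap.
From mathcomp Require Import all_classical all_reals all_analysis.

Set Implicit Arguments.
Unset Strict Implicit.
Unset Printing Implicit Defensive.

Import Order.TTheory GRing.Theory Num.Theory.
Import numFieldNormedType.Exports.

Local Open Scope classical_set_scope.
Local Open Scope ring_scope.

(* Laws are compared on measurable sets only: a library measure is a function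
   on all sets, whose values on non-measurable ones carry no information. *)
Definition has_law d d' (T : measurableType d) (T' : measurableType d')
    (R : realType) (Pr : probability T R) (X : T -> T')
    (mu : set T' -> \bar R) : Prop :=
  forall A : set T', measurable A -> Pr (X @^-1` A) = mu A.

Definition mutually_independent d d' (T : measurableType d)
    (T' : measurableType d') (R : realType) (Pr : probability T R)
    (xi : nat -> T -> T') : Prop :=
  forall (J : {fset nat}) (A : nat -> set T'),
    (forall i, measurable (A i)) ->
    Pr (\bigcap_(i in [set` J]) (xi i @^-1` A i)) =
    (\prod_(i <- J) Pr (xi i @^-1` A i))%E.

(* The degenerate case is separate because [normal_prob m 0] is the uniform law
   on [0, 1], not the point mass at m. *)
Definition gaussian_measure (R : realType) (m s : R) (A : set R) : \bar R :=
  if s == 0 then \d_m A else normal_prob m s A.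

Definition gaussian_variable d (T : measurableType d) (R : realType)
    (Q : probability T R) (X : T -> R) : Prop :=
  exists m s : R, has_law Q X (gaussian_measure m s).

(* A process is Gaussian when its finite-dimensional distributions are
   multivariate normal, i.e. all their linear combinations are univariate
   normal, point masses included.  The values of Z outside of the index set D
   are irrelevant. *)
Definition gaussian_process d (T : measurableType d) (R : realType)
    (Q : probability T R) (I : Type) (D : set I) (Z : I -> {RV Q >-> R}) : Prop :=
  forall (p : nat) (t : 'I_p -> I) (a : 'I_p -> R), (forall j, D (t j)) ->
    gaussian_variable Q (fun w => \sum_(j < p) a j * Z (t j) w).

Definition cvg_in_distribution d d' (T : measurableType d)
    (T' : measurableType d') (R : realType) (Pr : probability T R)
    (Q : probability T' R) (p : nat) (Y : nat -> T -> 'rV[R]_p)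
    (Z : T' -> 'rV[R]_p) : Prop :=
  forall h : 'rV[R]_p -> R, continuous h ->
    (exists M : R, forall v, `|h v| <= M) ->
    ('E_Pr[h \o Y n] @[n --> \oo] --> 'E_Q[h \o Z])%E.

Definition marginals_cvg d d' (T : measurableType d) (T' : measurableType d')
    (R : realType) (Pr : probability T R) (Q : probability T' R)
    (I : Type) (D : set I) (Y : nat -> I -> T -> R) (Z : I -> T' -> R) : Prop :=
  forall (p : nat) (t : 'I_p -> I), (forall j, D (t j)) ->
    cvg_in_distribution Pr Q (fun n w => \row_(j < p) Y n (t j) w)
                             (fun w => \row_(j < p) Z (t j) w).

(* Indices are shifted by one: xi i is the (i+1)-st observation, so that J_m is
   'I_m and the deleted items form a subset of 'I_m.  Nothing is deleted for the
   m with m <= k m. *)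
Definition deletion_sets (k : nat -> nat) (del : forall m : nat, {set 'I_m}) :
    Prop :=
  forall m, #|del m| = if (k m < m)%N then k m else 0%N.

(* [Num.truncn] is the floor here, since the process is only considered for
   x >= 0. *)
Definition deleted_sequential_process d (T : Type) (X : measurableType d)
    (R : realType) (P : probability X R) (xi : nat -> T -> X)
    (del : forall m : nat, {set 'I_m}) (n : nat) (xf : R * (X -> R)) (w : T) : R :=
  (Num.sqrt n%:R)^-1 *
  \sum_(i < Num.truncn (n%:R * xf.1) | i \notin del (Num.truncn (n%:R * xf.1)))
    (xf.2 (xi i w) - \int[P]_y xf.2 y).

(* Main.v *)
(**
The limit process lives on a Loeb space.  Given an ultrafilter U on nat finer
than \oo, the sets of sequences w such that w n is in A n for U-almost all n
form an algebra on which lim_U Pr (A n) is a content; saturation makes it countably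
additive, and Z i w is the standard part lim_U (Y n i (w n)) of the n-th process
evaluated at w n.  Tightness makes the standard part finite almost surely, and
characteristic functions of Z are U-limits of those of Y n, so the existence of
a Gaussian process with the required covariance needs no extension theorem.

A linear combination of marginals of Y n is a sum of independent centered
variables n^(-1/2) Phi_(B n i) (xi i), where B n i is the set of marginals that
keep the i-th observation.  Since there are only finitely many Phi, the second
order expansion of the characteristic function is uniform, and the product of
the characteristic functions telescopes against that of a normal law.

Convergence of characteristic functions and tightness give convergence in
distribution because a bounded continuous function on a cube is uniformly close
to a Bernstein polynomial in the variables (1 + sin (y j / c)) / 2, which is a
trigonometric polynomial with the same bound on the whole space.  The same
argument identifies one-dimensional laws from their characteristic functions;
the characteristic function F of a centered normal law of variance s^2 solves
F' = - s^2 t F.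
*)

Require Import Defs.
From HB Require Import structures.
From mathcomp Require Import all_boot all_order all_algebra finmap.
From mathcomp Require Import all_classical all_reals all_analysis.
From mathcomp Require Import measurable_realfun ring lra.

Set Implicit Arguments.
Unset Strict Implicit.
Unset Printing Implicit Defensive.

Import Order.TTheory GRing.Theory Num.Theory.
Import numFieldNormedType.Exports.

Local Open Scope classical_set_scope.
Local Open Scope ring_scope.

(** The deletion sets attached to different [m] are unrelated to each other, so the process at two
    times does not differ by a sum over fresh observations. Regrouping a linear combination of
    marginals by observation rather than by time restores independence; its variance then depends
    only on how many observations two marginals keep in common, which is the smaller of the two
    sample sizes up to the two deletion numbers.

    Characteristic functions stay real: the integrals of [cos (th + y)] for all phases [th] carry
    both the cosine part ([th = 0]) and the sine part ([th = - (pi / 2)]), and these functions span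
    an algebra.

    The index set is arbitrary, and an ultralimit produces all coordinates of the limit on one space
    at once. That the covariance kernel is nonnegative needs no separate argument either:
    [expR (- (v / 2))] is the mean of a cosine, hence at most 1. Mean and covariance of [Z] are read
    off from the characteristic functions afterwards, by the same second order expansion at zero
    that drives the central limit theorem. *)

Section real_integrable.
Context d (T : measurableType d) (R : realType) (mu : {measure set T -> \bar R}).
Implicit Types f g : T -> R.

Lemma integrableRD f g :
  mu.-integrable setT (EFin \o f) -> mu.-integrable setT (EFin \o g) ->
  mu.-integrable setT (EFin \o (fun x => f x + g x)).
Proof.
move=> fi gi; rewrite (_ : _ \o _ = (EFin \o f) \+ (EFin \o g))%E.
  exact: integrableD.
by apply/funext.
Qed.

Lemma integrableRZ f (c : R) : mu.-integrable setT (EFin \o f) ->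
  mu.-integrable setT (EFin \o (fun x => c * f x)).
Proof.
move=> fi; rewrite (_ : _ \o _ = (fun x => c%:E * (EFin \o f) x))%E.
  exact: integrableZl.
by apply/funext.
Qed.

Lemma integrableRB f g :
  mu.-integrable setT (EFin \o f) -> mu.-integrable setT (EFin \o g) ->
  mu.-integrable setT (EFin \o (fun x => f x - g x)).
Proof.
move=> fi gi; rewrite (_ : (fun x => _) = fun x => f x + -1 * g x).
  by apply: integrableRD => //; exact: integrableRZ.
by apply/funext => x; rewrite mulN1r.
Qed.

Lemma integrableR_sum (I : Type) (s : seq I) (F : I -> T -> R) :
  (forall i, mu.-integrable setT (EFin \o F i)) ->
  mu.-integrable setT (EFin \o (fun x => \sum_(i <- s) F i x)).
Proof.
move=> Fi; elim: s => [|i s ih].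
  rewrite (_ : _ \o _ = cst 0%E); first exact: integrable0.
  by apply/funext => x; rewrite /= big_nil.
rewrite (_ : (fun x => _) = fun x => F i x + \sum_(i <- s) F i x).
  exact: integrableRD.
by apply/funext => x; rewrite big_cons.
Qed.

Lemma Rintegral_sumR (I : Type) (s : seq I) (F : I -> T -> R) :
  (forall i, mu.-integrable setT (EFin \o F i)) ->
  \int[mu]_x (\sum_(i <- s) F i x) = \sum_(i <- s) \int[mu]_x F i x.
Proof.
move=> Fi; elim: s => [|i s ih].
  rewrite big_nil /Rintegral integral0_eq// => x _; by rewrite big_nil.
rewrite big_cons -ih -RintegralD//; last exact: integrableR_sum.
by apply: eq_Rintegral => x _; rewrite big_cons.
Qed.

Lemma integrableR_le f g : measurable_fun setT f ->
  mu.-integrable setT (EFin \o g) -> (forall x, `|f x| <= g x) ->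
  mu.-integrable setT (EFin \o f).
Proof.
move=> mf gi fg; apply: le_integrable gi => //; first exact/measurable_EFinP.
by move=> x _; rewrite /= lee_fin (le_trans (fg x))// ler_norm.
Qed.

Lemma integrableR_measurable f : mu.-integrable setT (EFin \o f) ->
  measurable_fun setT f.
Proof. by case/integrableP => /measurable_EFinP. Qed.

End real_integrable.

Section real_expectation.
Context d (T : measurableType d) (R : realType) (P : probability T R).

Lemma bounded_integrable (f : T -> R) (M : R) :
  measurable_fun setT f -> (forall x, `|f x| <= M) ->
  P.-integrable setT (EFin \o f).
Proof.
move=> mf fM; apply: measurable_bounded_integrable => //.
  by rewrite (le_lt_trans (probability_le1 _ _)) ?ltry.
by exists M; split; [exact: num_real | move=> y My x _; exact: le_trans (fM x) (ltW My)].
Qed.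

Lemma Rintegral_cstT (r : R) : \int[P]_x r = r.
Proof.
by rewrite Rintegral_cst//= probability_setT mulr1.
Qed.

Lemma integrable_cstT (r : R) : P.-integrable setT (EFin \o (fun=> r)).
Proof. by apply: (@bounded_integrable _ `|r|). Qed.

Lemma Rintegral_dist (f g : T -> R) (e : R) :
  P.-integrable setT (EFin \o f) -> P.-integrable setT (EFin \o g) ->
  (forall x, `|f x - g x| <= e) ->
  `| \int[P]_x f x - \int[P]_x g x | <= e.
Proof.
move=> fi gi fg; rewrite -RintegralB//.
have fgi := integrableRB fi gi.
apply: le_trans (le_normr_Rintegral _ fgi) _ => //.
rewrite -[leRHS]Rintegral_cstT; apply: le_Rintegral => //.
- by have /integrable_norm := fgi.
- exact: integrable_cstT.
Qed.

Lemma Rintegral_bound (f : T -> R) (M : R) :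
  P.-integrable setT (EFin \o f) -> (forall x, `|f x| <= M) ->
  `| \int[P]_x f x | <= M.
Proof.
move=> fi fM; have := @Rintegral_dist f (fun=> 0) M fi (integrable_cstT 0).
by rewrite Rintegral_cstT subr0; apply=> x; rewrite subr0.
Qed.

(** Off [A] the integrands differ by at most [e], on [A] by at most [2 * C]. Later [A] is the event
    that some coordinate of a random vector leaves a cube. *)
Lemma Rintegral_dist_except (f g : T -> R) (e C : R) (A : set T) :
  measurable A ->
  measurable_fun setT f -> measurable_fun setT g -> 0 <= e ->
  (forall x, `|f x| <= C) -> (forall x, `|g x| <= C) ->
  (forall x, ~ A x -> `|f x - g x| <= e) ->
  `| \int[P]_x f x - \int[P]_x g x | <= e + 2 * C * fine (P A).
Proof.
move=> mA mf mg e0 fC gC fg.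
have fi := bounded_integrable mf fC; have gi := bounded_integrable mg gC.
rewrite -RintegralB//.
have fgi := integrableRB fi gi.
have C0 : 0 <= C by apply: le_trans (fC point).
have mi : measurable_fun setT (\1_A : T -> R) by exact: measurable_indic.
have ii : P.-integrable setT (EFin \o (\1_A : T -> R)).
  apply: (@bounded_integrable _ 1) => // x.
  by rewrite indicE; case: (_ \in _); rewrite ?normr1 ?normr0.
have i2 : P.-integrable setT (EFin \o (fun x => 2 * C * \1_A x)).
  apply: (@bounded_integrable _ (2 * C)); first exact: measurable_funM.
  move=> x; rewrite indicE; case: (_ \in _);
  rewrite ?mulr1 ?mulr0 ?normr0 ?ger0_norm//; lra.
apply: le_trans (le_normr_Rintegral _ fgi) _ => //.
have -> : e + 2 * C * fine (P A) = \int[P]_x (e + 2 * C * \1_A x).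
  rewrite RintegralD// ?Rintegral_cstT ?RintegralZl//; last first.
    exact: integrable_cstT.
  by rewrite /Rintegral integral_indic// setIT.
apply: le_Rintegral => //.
- by have /integrable_norm := fgi.
- by apply: integrableRD => //; exact: integrable_cstT.
- move=> x _; rewrite indicE; have [Ax|/negP] := boolP (x \in A).
    have := ler_normB (f x) (g x); have := fC x; have := gC x; rewrite mulr1; lra.
  by rewrite inE => /fg; rewrite mulr0 addr0.
Qed.

Lemma Rdominated_cvg (f_ : nat -> T -> R) (f g : T -> R) :
  (forall n, measurable_fun setT (f_ n)) -> measurable_fun setT f ->
  P.-integrable setT (EFin \o g) ->
  (forall x, f_ n x @[n --> \oo] --> f x) -> (forall n x, `|f_ n x| <= g x) ->
  \int[P]_x f_ n x @[n --> \oo] --> \int[P]_x f x.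
Proof.
move=> mf_ mf gi ff fg.
have [] := @dominated_convergence _ T R P setT measurableT (fun n => EFin \o f_ n)
  (EFin \o f) (EFin \o g).
- by move=> n; apply/measurable_EFinP.
- by apply/measurable_EFinP.
- apply: aeW => x _ /=; apply: cvg_EFin; last exact: ff.
  by near=> n.
- exact: gi.
- by apply: aeW => x /= n _; rewrite lee_fin.
move=> fi _ h; apply: fine_cvg; move: h; rewrite /= fineK//.
exact: integrable_fin_num.
Unshelve. all: by end_near. Qed.

Lemma expectationE (f : T -> R) : P.-integrable setT (EFin \o f) ->
  ('E_P[f] = (\int[P]_x f x)%:E)%E.
Proof.
by move=> fi; rewrite unlock /Rintegral fineK// integrable_fin_num.
Qed.

End real_expectation.

(** * Second and third order estimates for sine and cosine *)

Section sine_cosine.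
Context {R : realType}.
Implicit Types u y : R.

Lemma normr_sin_le u : `|sin u| <= `|u|.
Proof.
wlog u0 : u / 0 < u.
  move=> h; have [/h//|u0|<-] := ltgtP 0 u; last by rewrite sin0 !normr0.
  by have := h (- u); rewrite sinN !normrN oppr_gt0; exact.
have [|c _] := @MVT R sin cos 0 u u0 (fun x _ => is_derive_sin x).
  by apply: continuous_subspaceT; exact: continuous_sin.
by rewrite sin0 !subr0 => ->; rewrite normrM ler_piMl// cos_max.
Qed.

Lemma onem_cosE u : 1 - cos u = 2 * sin (u / 2) ^+ 2.
Proof.
have -> : cos u = cos ((u / 2) *+ 2) by congr cos; rewrite -mulr_natr mulfVK.
rewrite cos_mulr2n sin2cos2; ring.
Qed.

Lemma onem_cos_ge0 u : 0 <= 1 - cos u.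
Proof. by rewrite subr_ge0 cos_le1. Qed.

Lemma onem_cos_le u : 1 - cos u <= u ^+ 2 / 2.
Proof.
rewrite onem_cosE -(real_normK (num_real (sin _))).
have : `|sin (u / 2)| ^+ 2 <= `|u / 2| ^+ 2.
  by rewrite lerXn2r ?nnegrE// normr_sin_le.
rewrite (real_normK (num_real (u/2))) expr_div_n; lra.
Qed.

(** For positive [u] the mean value theorem gives [sin u = cos c * u] with [c] between 0 and [u],
    and [1 - cos c] is at most [c ^+ 2 / 2]. Only the cubic order matters, not the constant. *)
Lemma normr_sinB_le3 u : `|sin u - u| <= `|u| ^+ 3.
Proof.
wlog u0 : u / 0 < u.
  move=> h; have [/h//|u0|<-] := ltgtP 0 u; last by rewrite sin0 subrr normr0 expr0n.
  by have := h (- u); rewrite sinN -opprD !normrN oppr_gt0; exact.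
have [|c /[!in_itv]/= /andP[c0 cu]] := @MVT R sin cos 0 u u0 (fun x _ => is_derive_sin x).
  by apply: continuous_subspaceT; exact: continuous_sin.
rewrite sin0 !subr0 => ->.
rewrite -{2}[u]mul1r -mulrBl normrM exprSr ler_wpM2r//.
rewrite distrC (ger0_norm (onem_cos_ge0 _)) (le_trans (onem_cos_le _))//.
rewrite (gtr0_norm u0) ler_pdivrMr//.
have : c ^+ 2 <= u ^+ 2 by rewrite lerXn2r ?nnegrE ?ltW.
have := sqr_ge0 u; lra.
Qed.

(** The cubic bound for [u] of absolute value at most 1, the triangle inequality beyond. With only
    second moments at hand, dominated convergence needs a quadratic majorant. *)
Lemma normr_sinB_le2 u : `|sin u - u| <= 2 * u ^+ 2.
Proof.
have [u1|u1] := leP `|u| 1.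
  apply: le_trans (normr_sinB_le3 u) _; rewrite -(real_normK (num_real u)).
  rewrite exprS; have := sqr_ge0 `|u|; nra.
apply: le_trans (ler_normB _ _) _; have := normr_sin_le u.
rewrite -(real_normK (num_real u)) expr2; nra.
Qed.

Lemma cvg_sinM_div (t : R^nat) y : (forall n, t n != 0) -> t n @[n --> \oo] --> (0 : R) ->
  sin (t n * y) / t n @[n --> \oo] --> y.
Proof.
move=> t0 tc; apply/cvgrPdist_le => e e0.
have h : `|t n| ^+ 2 * `|y| ^+ 3 @[n --> \oo] --> (0 : R).
  rewrite -[X in _ --> X](mul0r (`|y| ^+ 3)); apply: cvgMr_tmp.
  rewrite -[X in _ --> X](mul0r 0 : 0 * 0 = (0:R)).
  have tn : `|t n| @[n --> \oo] --> (0 : R) by rewrite -(@normr0 _ R); apply: cvg_norm.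
  by under eq_fun do rewrite expr2; apply: cvgM.
move/cvgrPdist_le : h => /(_ e e0); apply: filterS => n.
rewrite sub0r normrN ger0_norm ?mulr_ge0// => le; apply: le_trans le.
rewrite distrC -{2}[y](mulKf (t0 n)) [_^-1 * _]mulrC -mulrBl normrM normfV.
rewrite ler_pdivrMr ?normr_gt0//.
apply: le_trans (normr_sinB_le3 _) _.
by rewrite normrM exprMn exprSr mulrAC.
Qed.

Lemma cvg_onem_cosM_div (t : R^nat) y : (forall n, t n != 0) ->
  t n @[n --> \oo] --> (0 : R) ->
  (1 - cos (t n * y)) / t n ^+ 2 @[n --> \oo] --> y ^+ 2 / 2.
Proof.
move=> t0 tc.
(* The half-angle formula reduces the second order quotient to the square of the first order one. *)
rewrite (_ : (fun n => _) = fun n => 2 * ((sin (t n * (y / 2)) / t n) * (sin (t n * (y / 2)) / t n))); last first.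
  by apply/funext => n; rewrite onem_cosE -expr2 expr_div_n !mulrA.
have -> : y ^+ 2 / 2 = 2 * ((y / 2) * (y / 2)) by field.
by apply: cvgMl_tmp; apply: cvgM; apply: cvg_sinM_div.
Qed.

Lemma cvg_sinBM_div (t : R^nat) y : (forall n, t n != 0) ->
  t n @[n --> \oo] --> (0 : R) ->
  (sin (t n * y) - t n * y) / t n ^+ 2 @[n --> \oo] --> (0 : R).
Proof.
move=> t0 tc; apply/cvgrPdist_le => e e0.
have h : `|t n| * `|y| ^+ 3 @[n --> \oo] --> (0 : R).
  rewrite -[X in _ --> X](mul0r (`|y| ^+ 3)); apply: cvgMr_tmp.
  by rewrite -(@normr0 _ R); apply: cvg_norm.
move/cvgrPdist_le : h => /(_ e e0); apply: filterS => n.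
rewrite !sub0r !normrN ger0_norm ?mulr_ge0// => le; apply: le_trans le.
rewrite normrM normfV normrX ler_pdivrMr ?exprn_gt0 ?normr_gt0//.
apply: le_trans (normr_sinB_le3 _) _.
by rewrite normrM exprMn exprS [leRHS]mulrAC.
Qed.

End sine_cosine.

(** * Characteristic functions of sums of independent variables *)

Section cf_expansion.
Context d (T : measurableType d) (R : realType) (P : probability T R).
Variables (f : T -> R) (mf : measurable_fun setT f)
  (f2 : P.-integrable setT (EFin \o (fun x => f x ^+ 2))).

Lemma square_integrable_integrable : P.-integrable setT (EFin \o f).
Proof.
apply: (@integrableR_le _ _ _ _ _ (fun x => 1 + f x ^+ 2)) => //.
  by apply: integrableRD => //; exact: integrable_cstT.
move=> x; rewrite -(real_normK (num_real (f x))).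
have := sqr_ge0 (`|f x| - 1); rewrite !expr2; nra.
Qed.

Lemma measurable_sinM (c : R) : measurable_fun setT (fun x => sin (c * f x)).
Proof.
apply: (measurableT_comp (f := sin)); last exact: measurable_funM.
by apply: continuous_measurable_fun; exact: continuous_sin.
Qed.

Lemma measurable_cosM (c : R) : measurable_fun setT (fun x => cos (c * f x)).
Proof.
apply: (measurableT_comp (f := cos)); last exact: measurable_funM.
by apply: continuous_measurable_fun; exact: continuous_cos.
Qed.

Lemma integrable_cosM (c : R) : P.-integrable setT (EFin \o (fun x => cos (c * f x))).
Proof. by apply: (@bounded_integrable _ _ _ _ _ 1); [exact: measurable_cosM|move=> x; exact: cos_max]. Qed.

Lemma integrable_sinM (c : R) : P.-integrable setT (EFin \o (fun x => sin (c * f x))).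
Proof. by apply: (@bounded_integrable _ _ _ _ _ 1); [exact: measurable_sinM|move=> x; exact: sin_max]. Qed.

Variables (t : R^nat) (t0 : forall n, t n != 0)
  (tc : t n @[n --> \oo] --> (0 : R)).

(** Dominated convergence: by [onem_cos_le] the quotients are bounded by [f x ^+ 2], uniformly in
    [n]. *)
Lemma cvg_onem_cf_cos :
  (1 - \int[P]_x cos (t n * f x)) / t n ^+ 2 @[n --> \oo] -->
  (\int[P]_x (f x ^+ 2)) / 2.
Proof.
rewrite -RintegralZr//.
rewrite (_ : (fun n => _) =
   fun n => \int[P]_x ((1 - cos (t n * f x)) / t n ^+ 2)); last first.
  apply/funext => n; rewrite RintegralZr//; last first.
    by apply: integrableRB; [exact: integrable_cstT|exact: integrable_cosM].
  rewrite RintegralB//; last 2 first.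
  - exact: integrable_cstT.
  - exact: integrable_cosM.
  by rewrite Rintegral_cstT.
apply: (@Rdominated_cvg _ _ _ _ _ _ (fun x => f x ^+ 2)) => //.
- move=> n; apply: measurable_funM => //; apply: measurable_funB => //.
  exact: measurable_cosM.
- by apply: measurable_funM => //; exact: measurable_funX.
- by move=> x; exact: cvg_onem_cosM_div.
- move=> n x; rewrite ger0_norm; last first.
    by rewrite divr_ge0 ?onem_cos_ge0// sqr_ge0.
  have t2 : 0 < t n ^+ 2 by rewrite exprn_even_gt0//= t0.
  rewrite ler_pdivrMr// (le_trans (onem_cos_le _))// exprMn mulrC.
  by have := mulr_ge0 (sqr_ge0 (t n)) (sqr_ge0 (f x)); lra.
Qed.

Hypothesis f0 : \int[P]_x f x = 0.

(** Since [f] is centered, [t n * f x] can be subtracted from the sine without changing the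
    integral. What remains is cubic pointwise, so the quotient tends to 0, and is dominated by
    [2 * f x ^+ 2]. *)
Lemma cvg_cf_sin :
  (\int[P]_x sin (t n * f x)) / t n ^+ 2 @[n --> \oo] --> (0 : R).
Proof.
have fi := square_integrable_integrable.
rewrite -[X in _ --> X](_ : \int[P]_x (cst 0 x) = 0); last first.
  by rewrite Rintegral_cstT.
rewrite (_ : (fun n => _) =
   fun n => \int[P]_x ((sin (t n * f x) - t n * f x) / t n ^+ 2)); last first.
  apply/funext => n; rewrite RintegralZr//; last first.
    by apply: integrableRB; [exact: integrable_sinM|exact: integrableRZ].
  rewrite RintegralB//; last 2 first.
  - exact: integrable_sinM.
  - exact: integrableRZ.
  by rewrite RintegralZl// f0 mulr0 subr0.
apply: (@Rdominated_cvg _ _ _ _ _ _ (fun x => 2 * f x ^+ 2)) => //.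
- move=> n; apply: measurable_funM => //; apply: measurable_funB => //.
    exact: measurable_sinM.
  exact: measurable_funM.
- exact: integrableRZ.
- by move=> x; exact: cvg_sinBM_div.
- move=> n x; rewrite normrM normfV normrX.
  rewrite (real_normK (num_real (t n))).
  have t2 : 0 < t n ^+ 2 by rewrite exprn_even_gt0//= t0.
  rewrite ler_pdivrMr// (le_trans (normr_sinB_le2 _))// exprMn; lra.
Qed.

End cf_expansion.

(** For [u = v * t n ^+ 2 / 2], the bound [1 + y <= expR y] at [y = u] and [y = - u] yields
    [u / (1 + u) <= 1 - expR (- u) <= u]; dividing by [t n ^+ 2] gives the squeeze. *)
Lemma cvg_onem_expR (R : realType) (t : R^nat) (v : R) : 0 <= v ->
  (forall n, t n != 0) -> t n @[n --> \oo] --> (0 : R) ->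
  (1 - expR (- (v * t n ^+ 2 / 2))) / t n ^+ 2 @[n --> \oo] --> v / 2.
Proof.
move=> v0 t0 tc.
pose u n := v * t n ^+ 2 / 2.
have u0 n : 0 <= u n by rewrite /u divr_ge0// mulr_ge0// sqr_ge0.
have uc : u n @[n --> \oo] --> (0 : R).
  rewrite -[X in _ --> X](mul0r 2^-1); apply: cvgMr_tmp.
  rewrite -[X in _ --> X](mulr0 v); apply: cvgMl_tmp.
  rewrite -[X in _ --> X](mul0r 0 : 0 * 0 = (0:R)).
  by under eq_fun do rewrite expr2; apply: cvgM.
apply: (@squeeze_cvgr _ _ _ _ (fun n => (v / 2) * (1 + u n)^-1) (fun=> v / 2)).
- near=> n.
  have t2 : 0 < t n ^+ 2 by rewrite exprn_even_gt0//= t0.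
  have un1 : 0 < 1 + u n by rewrite ltr_pwDl.
  have h1 := expR_ge1Dx (u n); have h2 := expR_ge1Dx (- u n).
  rewrite ler_pdivlMr// ler_pdivrMr//; apply/andP; split; last first.
    by move: h2; rewrite /u; lra.
  rewrite expRN mulrAC -[v / 2 * _]mulrAC -/(u n).
  have -> : u n / (1 + u n) = 1 - (1 + u n)^-1.
    by field; rewrite gt_eqF.
  by rewrite lerD2l lerN2 lef_pV2// ?posrE// expR_gt0.
- rewrite -[X in _ --> X]mulr1; apply: cvgMl_tmp.
  rewrite -[X in _ --> X]invr1; apply: cvgV; first exact: oner_neq0.
  rewrite -[X in _ --> X]addr0; apply: cvgD => //; exact: cvg_cst.
- exact: cvg_cst.
Unshelve. all: by end_near. Qed.

(** * Independence of a partial sum and the next observation *)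

Section independence.
Context d (T : measurableType d) (R : realType) (Pr : probability T R).
Context d1 (T1 : measurableType d1) d2 (T2 : measurableType d2).

Definition independent_pair (U : T -> T1) (V : T -> T2) : Prop :=
  forall A B, measurable A -> measurable B ->
  Pr (U @^-1` A `&` V @^-1` B) = (Pr (U @^-1` A) * Pr (V @^-1` B))%E.

Context (U : {mfun T >-> T1}) (V : {mfun T >-> T2}).

Definition pairing : T -> T1 * T2 := fun w => (U w, V w).

Lemma measurable_pairing : measurable_fun setT pairing.
Proof. exact: measurable_fun_pair. Qed.

HB.instance Definition _ :=
  isMeasurableFun.Build _ _ _ _ pairing measurable_pairing.

Hypothesis UV : independent_pair U V.

Lemma law_independent_pair (C : set (T1 * T2)) : measurable C ->
  (distribution Pr U \x distribution Pr V)%E C = distribution Pr pairing C.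
Proof.
by move=> mC; apply: product_measure_unique => // A B mA mB; exact: UV.
Qed.

(** By independence the joint law is the product of the two laws, and Fubini's theorem splits the
    integral. *)
Lemma Rintegral_mul_independent (g : T1 -> R) (h : T2 -> R) :
  measurable_fun setT g -> measurable_fun setT h ->
  Pr.-integrable setT (EFin \o (g \o U)) ->
  Pr.-integrable setT (EFin \o (h \o V)) ->
  Pr.-integrable setT (EFin \o (fun w => g (U w) * h (V w))) ->
  \int[Pr]_w (g (U w) * h (V w)) =
  (\int[Pr]_w (g (U w))) * (\int[Pr]_w (h (V w))).
Proof.
move=> mg mh gi hi ghi.
pose F (z : T1 * T2) := ((g z.1 * h z.2)%:E : \bar R).
have mF : measurable_fun setT F.
  apply/measurable_EFinP; apply: measurable_funM;
  by apply: measurableT_comp.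
have FE : (\int[Pr]_w ((g (U w) * h (V w))%:E) =
   \int[(distribution Pr U \x distribution Pr V)%E]_z F z)%E.
  rewrite (eq_measure_integral (distribution Pr pairing)); last first.
    by move=> A mA _; exact: law_independent_pair.
  by rewrite integral_distribution.
have Fi : (distribution Pr U \x distribution Pr V)%E.-integrable setT F.
  apply/integrableP; split => //.
  rewrite (eq_measure_integral (distribution Pr pairing)); last first.
    by move=> A mA _; exact: law_independent_pair.
  rewrite ge0_integral_distribution//; last exact: measurableT_comp.
  by have /integrableP[_] := ghi.
have gU : (\int[distribution Pr U]_x (g x)%:E = (\int[Pr]_w g (U w))%:E)%E.
  rewrite integral_distribution//; last exact/measurable_EFinP.
  by rewrite /Rintegral fineK//; exact: integrable_fin_num.
have hV : (\int[distribution Pr V]_x (h x)%:E = (\int[Pr]_w h (V w))%:E)%E.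
  rewrite integral_distribution//; last exact/measurable_EFinP.
  by rewrite /Rintegral fineK//; exact: integrable_fin_num.
have gi' : (distribution Pr U).-integrable setT (EFin \o g).
  apply/integrableP; split; first exact/measurable_EFinP.
  rewrite ge0_integral_distribution//.
    by have /integrableP[_] := gi.
  by apply: measurableT_comp => //; exact/measurable_EFinP.
have hi' : (distribution Pr V).-integrable setT (EFin \o h).
  apply/integrableP; split; first exact/measurable_EFinP.
  rewrite ge0_integral_distribution//.
    by have /integrableP[_] := hi.
  by apply: measurableT_comp => //; exact/measurable_EFinP.
rewrite {1}/Rintegral FE -integral12_prod_meas1//= /fubini_F.
under eq_integral.
  move=> x _; rewrite /F /=; under eq_integral do rewrite EFinM.
  rewrite integralZl// hV; over.
by rewrite integralZr// gU -EFinM.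
Qed.

End independence.

Section independence_generator.
Context d (T : measurableType d) (R : realType) (Pr : probability T R).
Local Open Scope ereal_scope.

Lemma independent_event_generator d' (T' : measurableType d')
    (G : set (set T')) (W : T -> T') (E : set T) :
  measurable_fun setT W -> measurable E ->
  @measurable _ T' = <<s G >> -> setI_closed G ->
  (forall A, G A -> Pr (W @^-1` A `&` E) = Pr (W @^-1` A) * Pr E) ->
  forall A, measurable A -> Pr (W @^-1` A `&` E) = Pr (W @^-1` A) * Pr E.
Proof.
move=> mW mE mG GI GE.
have mp A : measurable A -> measurable (W @^-1` A).
  by move=> mA; rewrite -[X in measurable X]setTI; exact: mW.
suff : measurable `<=` [set A | Pr (W @^-1` A `&` E) = Pr (W @^-1` A) * Pr E] by [].
rewrite mG; apply: (@dynkin_induction _ _ G _ mG GI) => //=.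
- by rewrite preimage_setT setTI [X in X * _]probability_setT mul1e.
- move=> S mS SE.
  have -> : W @^-1` (~` S) = ~` (W @^-1` S) by rewrite -preimage_setC.
  have e1 : Pr (E `\` W @^-1` S) = Pr E - Pr (W @^-1` S `&` E).
    rewrite measureD//; last 2 first.
    + exact: mp.
    + by rewrite (le_lt_trans (probability_le1 _ _)) ?ltry.
    by rewrite setIC.
  have e2 : Pr (~` (W @^-1` S)) = 1 - Pr (W @^-1` S).
    by rewrite probability_setC//; exact: mp.
  rewrite setIC -setDE e1 e2 SE.
  by rewrite muleBl ?mul1e// ?fin_num_measure.
- move=> F mF tF FE.
  have mWF n : measurable (W @^-1` F n) by exact: mp.
  have tWF : trivIset setT (fun n => W @^-1` F n).
    apply/trivIsetP => i j _ _ ij; rewrite -preimage_setI.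
    by move/trivIsetP : tF => ->//; rewrite preimage_set0.
  have tWFE : trivIset setT (fun n => W @^-1` F n `&` E).
    by apply: trivIset_setIr.
  rewrite preimage_bigcup setI_bigcupl.
  rewrite !measure_semi_bigcup//=; last 3 first.
  + exact: bigcup_measurable.
  + by move=> n; exact: measurableI.
  + by apply: bigcup_measurable => n _; exact: measurableI.
  under eq_eseriesr do rewrite FE.
  rewrite -(fineK (fin_num_measure Pr E mE)) muleC -nneseriesZl//.
  by apply: eq_eseriesr => n _; rewrite muleC.
Qed.
End independence_generator.

Section partial_sums.
Context d (T : measurableType d) (R : realType) (Pr : probability T R).
Context dX (X : measurableType dX) (xi : nat -> {RV Pr >-> X}).
Hypothesis xi_indep : mutually_independent Pr (fun i => xi i : T -> X).
Variables (g : nat -> X -> R) (mg : forall i, measurable_fun setT (g i)).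

Definition partial_sum (m : nat) (w : T) : R := \sum_(i < m) g i (xi i w).

Lemma measurable_partial_sum m : measurable_fun setT (partial_sum m).
Proof.
apply: measurable_sum => i; apply: measurableT_comp => //.
Qed.

Lemma partial_sumS m w : partial_sum m.+1 w = partial_sum m w + g m (xi m w).
Proof. by rewrite /partial_sum big_ord_recr. Qed.

Let cyl (J : {fset nat}) (A : nat -> set X) : set T :=
  \bigcap_(i in [set` J]) (xi i @^-1` A i).

Let measurable_cyl (J : {fset nat}) A : (forall i, measurable (A i)) -> measurable (cyl J A).
Proof.
move=> mA; apply: fin_bigcap_measurable; first exact: finite_fset.
move=> i _; exact: measurable_funPTI.
Qed.

Let cylU1 (J : {fset nat}) (A : nat -> set X) m (B : set X) : m \notin J ->
  cyl (m |` J)%fset (fun i => if i == m then B else A i) =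
  xi m @^-1` B `&` cyl J A.
Proof.
move=> mJ; apply/seteqP; split=> [w h|w [wB h] i /=].
  split; first by have := h m; rewrite /= !inE eqxx; exact.
  move=> i /= iJ; have := h i; rewrite /= !inE iJ orbT => /(_ isT).
  by case: eqP => // im; move: mJ; rewrite -im iJ.
by rewrite !inE; case: eqP => [-> _//|_ /=]; exact: h.
Qed.

Let prob_cylU1 (J : {fset nat}) (A : nat -> set X) m (B : set X) :
  (forall i, measurable (A i)) -> measurable B -> m \notin J ->
  (Pr (xi m @^-1` B `&` cyl J A) = Pr (xi m @^-1` B) * Pr (cyl J A))%E.
Proof.
move=> mA mB mJ; rewrite -cylU1// /cyl !xi_indep//; last by move=> i; case: ifP.
rewrite (big_fsetD1 m)/= ?eqxx; last by rewrite !inE eqxx.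
have -> : ((m |` J) `\ m)%fset = J by apply: fsetU1K.
congr (_ * _)%E; rewrite !big_seq; apply: eq_bigr => i iJ.
by case: eqP => // im; move: mJ; rewrite -im iJ.
Qed.

(** Only [J = [fset m]] is wanted, but the induction needs all cylinders over later indices:
    [partial_sum m.+1] is a function of [partial_sum m] and [xi m], and on a rectangle the condition
    on [xi m] becomes one more side of the cylinder. *)
Lemma partial_sum_indep_cylinder m (J : {fset nat}) (A : nat -> set X) :
  (forall i, measurable (A i)) -> (forall i, i \in J -> (m <= i)%N) ->
  forall B, measurable B ->
  (Pr (partial_sum m @^-1` B `&` \bigcap_(i in [set` J]) (xi i @^-1` A i)) =
   Pr (partial_sum m @^-1` B) *
   Pr (\bigcap_(i in [set` J]) (xi i @^-1` A i)))%E.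
Proof.
rewrite -/(cyl J A); elim: m J A => [|m ih] J A mA mJ B mB.
  have [B0|B0] := pselect (B 0).
    rewrite (_ : _ @^-1` _ = setT) ?setTI ?[X in (X * _)%E]probability_setT ?mul1e//.
    by apply/seteqP; split=> // w _; rewrite /= /partial_sum big_ord0.
  rewrite (_ : _ @^-1` _ = set0) ?set0I ?measure0 ?mul0e//.
  by apply/seteqP; split=> // w; rewrite /= /partial_sum big_ord0.
pose W w := (partial_sum m w, xi m w).
have mW : measurable_fun setT W.
  by apply: measurable_fun_pair => //; exact: measurable_partial_sum.
have mJm : m \notin J by apply/negP => /mJ; rewrite ltnn.
have addW : partial_sum m.+1 = (fun z : R * X => z.1 + g m z.2) \o W.
  by apply/funext => w; rewrite partial_sumS.
rewrite addW comp_preimage.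
apply: (@independent_event_generator _ _ _ _ _ _
  [set A1 `*` A2 | A1 in measurable & A2 in measurable]) => //.
- exact: measurable_cyl.
- exact: measurable_prod_measurableType.
- move=> _ _ [A1 mA1 [A2 mA2 <-]] [B1 mB1 [B2 mB2 <-]].
  exists (A1 `&` B1); first exact: measurableI.
  exists (A2 `&` B2); first exact: measurableI.
  by rewrite setXI.
- move=> _ [A1 mA1 [A2 mA2 <-]].
  have -> : W @^-1` (A1 `*` A2) = partial_sum m @^-1` A1 `&` xi m @^-1` A2 by [].
  (* The event on [xi m] joins the cylinder, whose indices are then all at least [m], as the
     induction hypothesis requires. *)
  rewrite -setIA -cylU1// ih//; last 2 first.
  + by move=> i; case: ifP.
  + by move=> i; rewrite !inE => /orP[/eqP->//|/mJ/ltnW].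
  rewrite cylU1// prob_cylU1// muleA; congr (_ * _)%E.
  (* A second use of the induction hypothesis, on the cylinder over [m] alone, reassembles the
     probability of the rectangle. *)
  have := ih [fset m]%fset (fun _ => A2); rewrite /cyl !set_fset1 !bigcap_set1.
  by move=> ->// i; rewrite inE => /eqP ->.
- rewrite -[X in measurable X]setTI.
  have : measurable_fun setT (fun z : R * X => z.1 + g m z.2).
    by apply: measurable_funD => //; apply: measurableT_comp.
  exact.
Qed.

Lemma partial_sum_indep m : independent_pair Pr (partial_sum m) (xi m).
Proof.
move=> B A mB mA.
have := @partial_sum_indep_cylinder m [fset m]%fset (fun _ => A).
by rewrite !set_fset1 !bigcap_set1; apply => // i; rewrite inE => /eqP ->.
Qed.

End partial_sums.

Section transfer.
Context d (T : measurableType d) (R : realType) (Pr : probability T R).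
Context dX (X : measurableType dX) (P : probability X R) (xi : {RV Pr >-> X}).
Hypothesis xi_law : has_law Pr xi P.

Lemma has_law_ge0_integral (f : X -> \bar R) : measurable_fun setT f ->
  (forall x, 0 <= f x)%E -> (\int[Pr]_w f (xi w) = \int[P]_x f x)%E.
Proof.
move=> mf f0; rewrite -(@ge0_integral_distribution _ _ _ _ _ Pr xi f)//.
by apply: eq_measure_integral => A mA _; exact: xi_law.
Qed.

Lemma has_law_integrable (f : X -> R) : P.-integrable setT (EFin \o f) ->
  Pr.-integrable setT (EFin \o (f \o xi)).
Proof.
move=> fi; have mf := integrableR_measurable fi.
apply/integrableP; split.
  by apply/measurable_EFinP; exact: measurableT_comp.
rewrite (has_law_ge0_integral (f := fun x => `|(f x)%:E|%E))//.
  by have /integrableP[] := fi.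
by apply: measurableT_comp => //; exact/measurable_EFinP.
Qed.

Lemma has_law_Rintegral (f : X -> R) : P.-integrable setT (EFin \o f) ->
  \int[Pr]_w f (xi w) = \int[P]_x f x.
Proof.
move=> fi; have mf := integrableR_measurable fi.
rewrite /Rintegral; congr fine.
rewrite -(@integral_distribution _ _ _ _ _ Pr xi (EFin \o f)).
- by apply: eq_measure_integral => A mA _; exact: xi_law.
- exact/measurable_EFinP.
- exact: has_law_integrable.
Qed.

End transfer.

(** * Central limit theorem for triangular arrays *)

Section telescoping.
Context d (T : measurableType d) (R : realType) (Pr : probability T R).
Context dX (X : measurableType dX) (xi : nat -> {RV Pr >-> X}).
Hypothesis xi_indep : mutually_independent Pr (fun i => xi i : T -> X).
Variables (g : nat -> X -> R) (mg : forall i, measurable_fun setT (g i)).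

Let S := partial_sum xi g.
Let C m := \int[Pr]_w cos (S m w).
Let D m := \int[Pr]_w sin (S m w).
Let c m := \int[Pr]_w cos (g m (xi m w)).
Let s m := \int[Pr]_w sin (g m (xi m w)).

Let mcos : measurable_fun setT (@cos R).
Proof. by apply: continuous_measurable_fun; exact: continuous_cos. Qed.

Let msin : measurable_fun setT (@sin R).
Proof. by apply: continuous_measurable_fun; exact: continuous_sin. Qed.

Let mS m : measurable_fun setT (S m) := measurable_partial_sum xi mg m.

Let mgx m : measurable_fun setT (g m \o xi m).
Proof. by apply: measurableT_comp. Qed.

Let integrable_cs (f h : R -> R) (Y Z : T -> R) :
  measurable_fun setT f -> measurable_fun setT h ->
  (forall x, `|f x| <= 1) -> (forall x, `|h x| <= 1) ->
  measurable_fun setT Y -> measurable_fun setT Z ->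
  Pr.-integrable setT (EFin \o (fun w => f (Y w) * h (Z w))).
Proof.
move=> mf mh f1 h1 mY mZ; apply: (@bounded_integrable _ _ _ _ _ 1).
  by apply: measurable_funM; apply: measurableT_comp.
by move=> w; rewrite normrM mulr_ile1.
Qed.

Let integrable_c (f : R -> R) (Y : T -> R) : measurable_fun setT f ->
  (forall x, `|f x| <= 1) -> measurable_fun setT Y ->
  Pr.-integrable setT (EFin \o (fun w => f (Y w))).
Proof.
move=> mf f1 mY; apply: (@bounded_integrable _ _ _ _ _ 1) => //.
exact: measurableT_comp.
Qed.

HB.instance Definition _ m := isMeasurableFun.Build _ _ _ _ (S m) (mS m).

Let factor (f h : R -> R) m : measurable_fun setT f -> measurable_fun setT h ->
  (forall x, `|f x| <= 1) -> (forall x, `|h x| <= 1) ->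
  \int[Pr]_w (f (S m w) * h (g m (xi m w))) =
  (\int[Pr]_w f (S m w)) * (\int[Pr]_w h (g m (xi m w))).
Proof.
move=> mf mh f1 h1.
apply: (@Rintegral_mul_independent _ _ _ Pr _ _ _ _ (S m) (xi m) _ f (h \o g m)).
- exact: partial_sum_indep.
- exact: mf.
- exact: measurableT_comp.
- by apply: integrable_c.
- by apply: (@integrable_c h (g m \o xi m)).
- by apply: (@integrable_cs f h (S m) (g m \o xi m)).
Qed.

(** [CS] and [DS] are the real and imaginary parts of the multiplicativity of characteristic
    functions: [C + iD] gets multiplied by [c + is]. *)
Let CS m : C m.+1 = C m * c m - D m * s m.
Proof.
rewrite /C /D /c /s -!factor//; try by [exact: cos_max|exact: sin_max].
rewrite -RintegralB//.
- by apply: eq_Rintegral => w _; rewrite /S partial_sumS cosD.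
- by apply: (@integrable_cs _ _ (S m) (g m \o xi m)) => //; exact: cos_max.
- by apply: (@integrable_cs _ _ (S m) (g m \o xi m)) => //; exact: sin_max.
Qed.

Let DS m : D m.+1 = D m * c m + C m * s m.
Proof.
rewrite /C /D /c /s -!factor//; try by [exact: cos_max|exact: sin_max].
rewrite -RintegralD//.
- by apply: eq_Rintegral => w _; rewrite /S partial_sumS sinD.
- apply: (@integrable_cs _ _ (S m) (g m \o xi m)) => //; [exact: sin_max|exact: cos_max].
- apply: (@integrable_cs _ _ (S m) (g m \o xi m)) => //; [exact: cos_max|exact: sin_max].
Qed.

Let C1 m : `|C m| <= 1.
Proof.
apply: Rintegral_bound; last by move=> w; exact: cos_max.
by apply: integrable_c => //; exact: cos_max.
Qed.

Let D1 m : `|D m| <= 1.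
Proof.
apply: Rintegral_bound; last by move=> w; exact: sin_max.
by apply: integrable_c => //; exact: sin_max.
Qed.

Let c1 m : `|c m| <= 1.
Proof.
apply: Rintegral_bound; last by move=> w; exact: cos_max.
by apply: (@integrable_c _ (g m \o xi m)) => //; exact: cos_max.
Qed.

Variables (u : nat -> R) (eta : R) (N : nat).
Hypothesis u0 : forall i, 0 <= u i.
Hypothesis c_eta : forall i, (i < N)%N -> `|c i - expR (- u i)| <= eta.
Hypothesis s_eta : forall i, (i < N)%N -> `|s i| <= eta.

(** All factors have absolute value at most 1, so each new summand adds at most [eta] for replacing
    [c m] by [expR (- u m)] and [eta] for the term in [s m]: hence the factor 2. The sine part must
    be carried along because it feeds back into the cosine part. *)
Lemma cf_partial_sum_bound :
  `|\int[Pr]_w cos (partial_sum xi g N w) - expR (- \sum_(i < N) u i)|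
    <= 2 * N%:R * eta /\
  `|\int[Pr]_w sin (partial_sum xi g N w)| <= 2 * N%:R * eta.
Proof.
suff H m : (m <= N)%N ->
    `|C m - expR (- \sum_(i < m) u i)| <= 2 * m%:R * eta /\ `|D m| <= 2 * m%:R * eta.
  exact: H.
elim: m => [_|m ih mN].
  rewrite big_ord0 oppr0 expR0 mulr0 mul0r /C /D.
  under eq_Rintegral do rewrite /S /partial_sum big_ord0 cos0.
  rewrite Rintegral_cstT subrr normr0; split=> //.
  under eq_Rintegral do rewrite /S /partial_sum big_ord0 sin0.
  by rewrite Rintegral_cstT normr0.
have [ih1 ih2] := ih (ltnW mN).
have ce := c_eta mN; have se := s_eta mN.
have m1 : 2 * m.+1%:R * eta = 2 * m%:R * eta + eta + eta.
  by rewrite -natr1; ring.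
have eta0 : 0 <= eta by apply: le_trans se.
rewrite CS DS m1; split.
  rewrite big_ord_recr/= opprD expRD.
  set W := expR (- \sum_(i < m) u i).
  set e := expR (- u m).
  have e1 : `|e| <= 1.
    by rewrite ger0_norm ?expR_ge0// -expR0 ler_expR oppr_le0.
  have -> : C m * c m - D m * s m - W * e =
     C m * (c m - e) + (C m - W) * e - D m * s m by ring.
  apply: le_trans (ler_normB _ _) _; apply: lerD; last first.
    by rewrite normrM -[leRHS]mul1r ler_pM.
  apply: le_trans (ler_normD _ _) _; rewrite addrC; apply: lerD.
    by rewrite normrM -[leRHS]mulr1 ler_pM.
  by rewrite normrM -[leRHS]mul1r ler_pM.
apply: le_trans (ler_normD _ _) _.
apply: (@le_trans _ _ (2 * m%:R * eta + eta)); last by rewrite lerDl.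
apply: lerD; first by rewrite normrM -[leRHS]mulr1 ler_pM.
by rewrite normrM -[leRHS]mul1r ler_pM.
Qed.

End telescoping.

Section central_limit.
Context d (T : measurableType d) (R : realType) (Pr : probability T R).
Context dX (X : measurableType dX) (P : probability X R).
Context (xi : nat -> {RV Pr >-> X}).
Hypothesis xi_law : forall i, has_law Pr (xi i) P.
Hypothesis xi_indep : mutually_independent Pr (fun i => xi i : T -> X).
Context (I : finType) (f : I -> X -> R).
Hypothesis mf : forall b, measurable_fun setT (f b).
Hypothesis f2 : forall b, P.-integrable setT (EFin \o (fun x => f b x ^+ 2)).
Hypothesis f0 : forall b, \int[P]_x f b x = 0.
Variables (t : R^nat) (N : nat -> nat) (K : R) (B : nat -> nat -> I) (v : R).
Hypothesis t0 : forall n, t n != 0.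
Hypothesis tc : t n @[n --> \oo] --> (0 : R).
Hypothesis NK : forall n, (N n)%:R * t n ^+ 2 <= K.
Hypothesis vc : t n ^+ 2 * \sum_(i < N n) \int[P]_x (f (B n i) x ^+ 2)
  @[n --> \oo] --> v.

Let S n w := \sum_(i < N n) (t n * f (B n i) (xi i w)).

Let expansion (e : R) : 0 < e -> \forall n \near \oo, forall b,
  `|\int[P]_x cos (t n * f b x) -
     expR (- ((\int[P]_x (f b x ^+ 2)) * t n ^+ 2 / 2))| <= e * t n ^+ 2 /\
  `|\int[P]_x sin (t n * f b x)| <= e * t n ^+ 2.
Proof.
move=> e0; apply: filter_forall => b.
have v0 : 0 <= \int[P]_x (f b x ^+ 2) by apply: Rintegral_ge0 => x _; exact: sqr_ge0.
have h1 := cvg_onem_cf_cos (mf b) (f2 b) t0 tc.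
have h2 := cvg_onem_expR v0 t0 tc.
have h3 := cvg_cf_sin (mf b) (f2 b) t0 tc (f0 b).
have h4 : (1 - \int[P]_x cos (t n * f b x)) / t n ^+ 2 -
    (1 - expR (- ((\int[P]_x (f b x ^+ 2)) * t n ^+ 2 / 2))) / t n ^+ 2
    @[n --> \oo] --> (0 : R).
  by rewrite -[X in _ --> X](subrr ((\int[P]_x (f b x ^+ 2)) / 2)); apply: cvgB.
move/cvgrPdist_le : h4 => /(_ e e0) h4.
move/cvgrPdist_le : h3 => /(_ e e0) h3.
near=> n.
have t2 : 0 < t n ^+ 2 by rewrite exprn_even_gt0//= t0.
split.
  have : `|0 - ((1 - \int[P]_x cos (t n * f b x)) / t n ^+ 2 -
     (1 - expR (- ((\int[P]_x (f b x ^+ 2)) * t n ^+ 2 / 2))) / t n ^+ 2)| <= e.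
    by near: n.
  rewrite -mulrBl sub0r normrN normrM normfV (gtr0_norm t2) ler_pdivrMr//.
  by rewrite opprB addrC addrA subrK distrC.
have : `|0 - (\int[P]_x sin (t n * f b x)) / t n ^+ 2| <= e by near: n.
by rewrite sub0r normrN normrM normfV (gtr0_norm t2) ler_pdivrMr.
Unshelve. all: by end_near. Qed.

Let SE n : S n = partial_sum xi (fun i x => t n * f (B n i) x) (N n).
Proof. by []. Qed.

(** Each of the [N n] summands costs an error [e * t n ^+ 2], and [N n * t n ^+ 2] stays below
    [K]. *)
Let bound (e : R) : 0 < e -> \forall n \near \oo,
  `|\int[Pr]_w cos (S n w) - expR (- (t n ^+ 2 *
     \sum_(i < N n) \int[P]_x (f (B n i) x ^+ 2) / 2))| <= 2 * K * e /\
  `|\int[Pr]_w sin (S n w)| <= 2 * K * e.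
Proof.
move=> e0; apply: filterS (expansion e0) => n En.
have mg i : measurable_fun setT (fun x => t n * f (B n i) x).
  exact: measurable_funM.
have [|||h1 h2] := @cf_partial_sum_bound _ _ _ Pr _ X xi xi_indep _ mg
  (fun i => (\int[P]_x (f (B n i) x ^+ 2)) * t n ^+ 2 / 2) (e * t n ^+ 2) (N n).
- move=> i; rewrite divr_ge0// mulr_ge0 ?sqr_ge0//.
  by apply: Rintegral_ge0 => x _; exact: sqr_ge0.
- move=> i _; rewrite (has_law_Rintegral (xi_law i) (f := fun x => cos (t n * f (B n i) x))).
    by case: (En (B n i)).
  exact: integrable_cosM.
- move=> i _; rewrite (has_law_Rintegral (xi_law i) (f := fun x => sin (t n * f (B n i) x))).
    by case: (En (B n i)).
  exact: integrable_sinM.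
rewrite -!SE in h1 h2.
have le : 2 * (N n)%:R * (e * t n ^+ 2) <= 2 * K * e.
  have := NK n; nra.
split; last exact: le_trans le.
apply: le_trans le; apply: le_trans h1.
rewrite le_eqVlt; apply/orP; left; apply/eqP; congr (`| _ - expR (- _) |).
by rewrite mulr_sumr; apply: eq_bigr => i _; ring.
Qed.

Lemma cvg_cf_triangular_cos :
  \int[Pr]_w cos (\sum_(i < N n) (t n * f (B n i) (xi i w)))
    @[n --> \oo] --> expR (- (v / 2)).
Proof.
have vc' : expR (- (t n ^+ 2 *
     \sum_(i < N n) \int[P]_x (f (B n i) x ^+ 2) / 2)) @[n --> \oo] --> expR (- (v / 2)).
  apply: continuous_cvg; first exact: continuous_expR.
  apply: cvgN; under eq_fun do rewrite -mulr_suml mulrA.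
  exact: cvgMr_tmp.
apply/cvgrPdist_le => e e0.
(* At precision [e / (4 * (|K| + 1))] the bound [2 * K * e] becomes at most [e / 2]; the absolute
   value and the 1 make the denominator positive. *)
have K1 : 0 < 4 * (`|K| + 1) by rewrite mulr_gt0// ltr_wpDl.
have h1 : \forall n \near \oo, `|\int[Pr]_w cos (S n w) - expR (- (t n ^+ 2 *
     \sum_(i < N n) \int[P]_x (f (B n i) x ^+ 2) / 2))| <= e / 2.
  apply: filterS (bound (divr_gt0 e0 K1)) => n [h _].
  apply: le_trans h _; rewrite mulrA ler_pdivrMr//.
  have := ler_norm K; nra.
move/cvgrPdist_le : vc' => /(_ (e / 2)); rewrite divr_gt0// => /(_ isT) h3.
near=> n.
have a1 : `|\int[Pr]_w cos (S n w) - expR (- (t n ^+ 2 *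
     \sum_(i < N n) \int[P]_x (f (B n i) x ^+ 2) / 2))| <= e / 2 by near: n.
have a2 : `|expR (- (v / 2)) - expR (- (t n ^+ 2 *
     \sum_(i < N n) \int[P]_x (f (B n i) x ^+ 2) / 2))| <= e / 2 by near: n.
rewrite distrC in a1; rewrite (splitr e).
by apply: le_trans (ler_distD _ _ _) (lerD a2 a1).
Unshelve. all: by end_near. Qed.

Lemma cvg_cf_triangular_sin :
  \int[Pr]_w sin (\sum_(i < N n) (t n * f (B n i) (xi i w)))
    @[n --> \oo] --> (0 : R).
Proof.
apply/cvgrPdist_le => e e0.
have K1 : 0 < 4 * (`|K| + 1) by rewrite mulr_gt0// ltr_wpDl.
apply: filterS (bound (divr_gt0 e0 K1)) => n [_ h].
rewrite sub0r normrN; apply: le_trans h _; rewrite mulrA ler_pdivrMr//.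
have := ler_norm K; have := normr_ge0 K; nra.
Qed.

End central_limit.

Section second_moment.
Context d (T : measurableType d) (R : realType) (Pr : probability T R).
Context dX (X : measurableType dX) (P : probability X R).
Context (xi : nat -> {RV Pr >-> X}).
Hypothesis xi_law : forall i, has_law Pr (xi i) P.
Hypothesis xi_indep : mutually_independent Pr (fun i => xi i : T -> X).
Variables (g : nat -> X -> R).
Hypothesis mg : forall i, measurable_fun setT (g i).
Hypothesis g2 : forall i, P.-integrable setT (EFin \o (fun x => g i x ^+ 2)).
Hypothesis g0 : forall i, \int[P]_x g i x = 0.

Let S := partial_sum xi g.
Let mS m : measurable_fun setT (S m) := measurable_partial_sum xi mg m.
HB.instance Definition _ m := isMeasurableFun.Build _ _ _ _ (S m) (mS m).

(** The cross term has mean zero, because [partial_sum m] is independent of the centered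
    [g m (xi m w)]. Integrability goes through the same induction, since that of the cross term
    comes from the two squares. *)
Lemma second_moment_partial_sum m :
  Pr.-integrable setT (EFin \o (fun w => partial_sum xi g m w ^+ 2)) /\
  \int[Pr]_w (partial_sum xi g m w ^+ 2) = \sum_(i < m) \int[P]_x (g i x ^+ 2).
Proof.
elim: m => [|m [ih1 ih2]].
  rewrite big_ord0 (_ : (fun w => _) = fun=> 0); last first.
    by apply/funext => w; rewrite /partial_sum big_ord0 expr0n.
  split; first exact: integrable_cstT.
  exact: Rintegral_cstT.
have gi := square_integrable_integrable (mg m) (g2 m).
have i1 : Pr.-integrable setT (EFin \o (fun w => g m (xi m w))).
  exact: (has_law_integrable (xi_law m) gi).
have i2 : Pr.-integrable setT (EFin \o (fun w => g m (xi m w) ^+ 2)).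
  exact: (has_law_integrable (xi_law m) (g2 m)).
have i0 : Pr.-integrable setT (EFin \o S m).
  exact: (square_integrable_integrable (mS m) ih1).
have ix : Pr.-integrable setT (EFin \o (fun w => S m w * g m (xi m w))).
  apply: (@integrableR_le _ _ _ _ _ (fun w => S m w ^+ 2 + g m (xi m w) ^+ 2)).
  - by apply: measurable_funM => //; apply: measurableT_comp.
  - exact: integrableRD.
  - move=> w; rewrite normrM -(real_normK (num_real (S m w))).
    rewrite -(real_normK (num_real (g m (xi m w)))).
    have := sqr_ge0 (`|S m w| - `|g m (xi m w)|).
    by rewrite !expr2; have := normr_ge0 (S m w); have := normr_ge0 (g m (xi m w)); nra.
have ix0 : \int[Pr]_w (S m w * g m (xi m w)) = 0.
  have -> := @Rintegral_mul_independent _ _ _ Pr _ _ _ _ (S m) (xi m)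
    (partial_sum_indep xi_indep mg m) idfun (g m) (@measurable_id _ _ setT) (mg m) i0 i1 ix.
  by rewrite (has_law_Rintegral (xi_law m) gi) g0 mulr0.
have E w : partial_sum xi g m.+1 w ^+ 2 =
    S m w ^+ 2 + g m (xi m w) ^+ 2 + 2 * (S m w * g m (xi m w)).
  by rewrite partial_sumS /S; ring.
have -> : (fun w => partial_sum xi g m.+1 w ^+ 2) =
  fun w => S m w ^+ 2 + g m (xi m w) ^+ 2 + 2 * (S m w * g m (xi m w)).
  exact/funext.
have i12 := integrableRD ih1 i2.
split; first by apply: integrableRD => //; exact: integrableRZ.
rewrite RintegralD//; last exact: integrableRZ.
rewrite RintegralZl// ix0 mulr0 addr0 RintegralD// ih2 big_ord_recr/=.
by rewrite (has_law_Rintegral (xi_law m) (g2 m)).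
Qed.

End second_moment.

(** * Counting the kept observations *)

Section kept_items.
Context (R : realType).
Variables (k : nat -> nat) (del : forall m : nat, {set 'I_m}).
Hypothesis del_k : deletion_sets k del.

(** The index is a natural number because sets in different types ['I_m] have to be compared at the
    same observation. *)
Definition kept (m i : nat) : bool :=
  [exists j : 'I_m, (j == i :> nat) && (j \notin del m)].

Let deleted (m i : nat) : bool :=
  [exists j : 'I_m, (j == i :> nat) && (j \in del m)].

Lemma kept_ord m (i : 'I_m) : kept m i = (i \notin del m).
Proof.
apply/existsP/idP => [[j /andP[/eqP ji]]|id].
  by have -> : j = i by exact: val_inj.
by exists i; rewrite eqxx.
Qed.

Let deleted_ord m (i : 'I_m) : deleted m i = (i \in del m).
Proof.
apply/existsP/idP => [[j /andP[/eqP ji]]|id].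
  by have -> : j = i by exact: val_inj.
by exists i; rewrite eqxx.
Qed.

Lemma kept_lt m i : kept m i -> (i < m)%N.
Proof. by move=> /existsP[j /andP[/eqP <- _]]. Qed.

(** Puts the marginals at all times on the common range ['I_n], so that sums over marginals and over
    observations can be exchanged. *)
Lemma kept_sum m n (F : nat -> R) : (m <= n)%N ->
  \sum_(i < m | i \notin del m) F i = \sum_(i < n) (kept m i)%:R * F i.
Proof.
move=> mn.
transitivity (\sum_(i < m) (kept m i)%:R * F i).
  rewrite big_mkcond/=; apply: eq_bigr => i _; rewrite kept_ord.
  by case: ifP => _; rewrite ?mul1r ?mul0r.
rewrite (big_ord_widen n (fun i => (kept m i)%:R * F i) mn) big_mkcond/=.
apply: eq_bigr => i _; case: ifPn => // im.
by case: (boolP (kept m i)) => [/kept_lt ki|_]; [move: im; rewrite ki|rewrite mul0r].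
Qed.

Let sum_deleted m n : (m <= n)%N ->
  \sum_(i < n) (deleted m i)%:R <= (k m)%:R :> R.
Proof.
move=> mn.
have -> : \sum_(i < n) (deleted m i)%:R = (#|del m|)%:R :> R.
  rewrite -sum1_card natr_sum.
  transitivity (\sum_(i < m) (deleted m i)%:R : R); last first.
    rewrite [RHS]big_mkcond/=; apply: eq_bigr => i _; rewrite deleted_ord.
    by case: ifP.
  rewrite (big_ord_widen n (fun i => (deleted m i)%:R) mn) [RHS]big_mkcond/=.
  apply: eq_bigr => i _; case: ifPn => // im.
  case: (boolP (deleted m i)) => // /existsP[j /andP[/eqP ji _]].
  by move: im; rewrite -ji ltn_ord.
by rewrite del_k; case: ifP => _; rewrite ler_nat.
Qed.

Let keptE m i : kept m i = (i < m)%N && ~~ deleted m i.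
Proof.
have [im|im] := ltnP i m; last first.
  by apply/negbTE/negP => /kept_lt; rewrite ltnNge im.
by rewrite (kept_ord (Ordinal im)) (deleted_ord (Ordinal im)).
Qed.

(** An index below [minn a b] that is not kept at both times is deleted at [a] or at [b]. However
    the two sets are placed, this loses at most [k a + k b] indices. *)
Lemma kept_both_count a b n : (a <= n)%N -> (b <= n)%N ->
  `|\sum_(i < n) (kept a i)%:R * (kept b i)%:R - (minn a b)%:R|
    <= (k a)%:R + (k b)%:R :> R.
Proof.
move=> an bn.
have -> : (minn a b)%:R = \sum_(i < n) (i < minn a b)%N%:R :> R.
  have mn : (minn a b <= n)%N by rewrite geq_min an.
  rewrite -natr_sum; congr _%:R.
  transitivity (\sum_(i < minn a b) 1)%N; first by rewrite sum1_card card_ord.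
  rewrite (big_ord_widen n (fun=> 1)%N mn) big_mkcond/=.
  by apply: eq_bigr => i _; case: ifP.
rewrite -sumrB.
apply: le_trans (ler_norm_sum _ _ _) _.
apply: le_trans (lerD (sum_deleted an) (sum_deleted bn)).
rewrite -big_split/=; apply: ler_sum => i _; rewrite !keptE leq_min.
by case: (i < a)%N (i < b)%N (deleted a i) (deleted b i) => [] [] [] [] /=;
  rewrite ?mulr0 ?mulr1 ?mul0r ?subrr ?sub0r ?subr0 ?addr0 ?add0r ?normrN ?normr0 ?normr1//; lra.
Qed.

End kept_items.

Section truncn_limits.
Context (R : realType).

Lemma truncn_scale_le (x : R) n : 0 <= x <= 1 ->
  (Num.truncn (n%:R * x) <= n)%N.
Proof.
move=> /andP[x0 x1]; have := truncn_le (n%:R * x).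
rewrite mulr_ge0// => h; rewrite -(@ler_nat R); apply: le_trans h _.
by rewrite ler_piMr.
Qed.

Lemma cvg_truncn_scale (x : R) : 0 <= x ->
  (Num.truncn (n.+1%:R * x))%:R / n.+1%:R @[n --> \oo] --> x.
Proof.
move=> x0.
apply: (@squeeze_cvgr _ _ _ _ (fun n => x - n.+1%:R^-1) (fun=> x)).
- apply: nearW => n.
  have n0 : 0 < n.+1%:R :> R by [].
  have nx0 : 0 <= n.+1%:R * x by rewrite mulr_ge0.
  have h1 := truncn_le (n.+1%:R * x); rewrite nx0 in h1.
  have h2 := truncnS_gt (n.+1%:R * x); rewrite -[X in _ < X]natr1 in h2.
  rewrite ler_pdivlMr// mulrBl mulVf ?gt_eqF// ler_pdivrMr// ![x * _]mulrC h1 andbT.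
  by rewrite lerBlDr ltW.
- rewrite -[X in _ --> X]subr0; apply: cvgB; first exact: cvg_cst.
  exact: cvg_harmonic.
- exact: cvg_cst.
Qed.

(** The sizes [a n] need not tend to infinity (they are all 0 at time 0), so the hypothesis on [k]
    cannot simply be composed with [a]: large values of [a n] are handled by the hypothesis, small
    ones by a constant. *)
Lemma cvg_small_index (k a : nat -> nat) : (forall n, (a n <= n.+1)%N) ->
  (k n)%:R / n%:R @[n --> \oo] --> (0 : R) ->
  (k (a n))%:R / n.+1%:R @[n --> \oo] --> (0 : R).
Proof.
move=> an kc; apply/cvgrPdist_le => e e0.
have e2 : 0 < e / 2 by rewrite divr_gt0.
have /cvgrPdist_le/(_ _ e2)[M _ kM] := kc.
pose C := (\sum_(i < M.+1) k i)%N.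
(* One affine bound for all [m]: the slope serves [m > M], and the sum [C] of the first values
   serves the others. *)
have kC m : (k m)%:R <= e / 2 * m%:R + C%:R :> R.
  have [Mm|mM] := ltnP M m.
    have := kM m (ltnW Mm); rewrite sub0r normrN ger0_norm ?divr_ge0//.
    rewrite ler_pdivrMr ?ltr0n ?(leq_ltn_trans _ Mm)// => h.
    by apply: le_trans h _; rewrite lerDl.
  apply: (@le_trans _ _ C%:R); last by rewrite lerDr mulr_ge0// ltW.
  have mM' : (m < M.+1)%N by [].
  by rewrite ler_nat /C (bigD1 (Ordinal mM'))//= leq_addr.
have h : C%:R / n.+1%:R @[n --> \oo] --> (0 : R).
  rewrite -[X in _ --> X](mulr0 C%:R); apply: cvgMl_tmp; exact: cvg_harmonic.
have /cvgrPdist_le/(_ _ e2)[N _ hN] := h.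
exists N => // n /= Nn; have := hN n Nn.
rewrite !sub0r !normrN !ger0_norm ?divr_ge0// => hn.
have n0 : 0 < n.+1%:R :> R by [].
rewrite ler_pdivrMr//; move: hn; rewrite ler_pdivrMr// => hn.
have := kC (a n).
have : (a n)%:R <= n.+1%:R :> R by rewrite ler_nat.
nra.
Qed.

End truncn_limits.

Lemma cvg_sumR (R : realType) (F : set_system nat) {FF : Filter F} (I : Type) (s : seq I)
    (u : I -> nat -> R) (l : I -> R) :
  (forall i, u i n @[n --> F] --> l i) ->
  \sum_(i <- s) u i n @[n --> F] --> \sum_(i <- s) l i.
Proof.
move=> ul; elim: s => [|i s ih].
  by under eq_fun do rewrite big_nil; rewrite big_nil; exact: cvg_cst.
by under eq_fun do rewrite big_cons; rewrite big_cons; apply: cvgD.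
Qed.

Section covariance_formulas.
Context d (X : measurableType d) (R : realType) (P : probability X R).
Implicit Types f g : X -> R.

Definition square_integrable f : Prop :=
  measurable_fun setT f /\ P.-integrable setT (EFin \o (fun x => f x ^+ 2)).

Lemma square_integrable_mul f g : square_integrable f -> square_integrable g ->
  P.-integrable setT (EFin \o (fun x => f x * g x)).
Proof.
move=> [mf f2] [mg g2].
apply: (@integrableR_le _ _ _ _ _ (fun x => f x ^+ 2 + g x ^+ 2)).
- exact: measurable_funM.
- exact: integrableRD.
move=> x; rewrite normrM -(real_normK (num_real (f x))) -(real_normK (num_real (g x))).
have := sqr_ge0 (`|f x| - `|g x|).
by rewrite !expr2; have := normr_ge0 (f x); have := normr_ge0 (g x); nra.
Qed.

Lemma square_integrableD f g : square_integrable f -> square_integrable g ->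
  square_integrable (fun x => f x + g x).
Proof.
move=> sf sg; split; first by apply: measurable_funD; [case: sf|case: sg].
rewrite (_ : (fun x => _) = fun x => f x ^+ 2 + g x ^+ 2 + 2 * (f x * g x)); last first.
  by apply/funext => x; ring.
apply: integrableRD; last by apply: integrableRZ; exact: square_integrable_mul.
by apply: integrableRD; [case: sf|case: sg].
Qed.

Lemma square_integrableZ c f : square_integrable f ->
  square_integrable (fun x => c * f x).
Proof.
move=> [mf f2]; split; first exact: measurable_funM.
under eq_fun do rewrite exprMn; exact: integrableRZ.
Qed.

Lemma square_integrable_cst c : square_integrable (fun=> c).
Proof. by split => //; exact: integrable_cstT. Qed.

Lemma square_integrable_sum (I : Type) (s : seq I) (F : I -> X -> R) :
  (forall i, square_integrable (F i)) ->
  square_integrable (fun x => \sum_(i <- s) F i x).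
Proof.
move=> sF; elim: s => [|i s ih].
  by under eq_fun do rewrite big_nil; exact: square_integrable_cst.
by under eq_fun do rewrite big_cons; exact: square_integrableD.
Qed.

Definition centered f : X -> R := fun x => f x - \int[P]_y f y.

Lemma centered_square_integrable f : square_integrable f -> square_integrable (centered f).
Proof. by move=> sf; apply: square_integrableD => //; exact: square_integrable_cst. Qed.

Lemma Rintegral_centered f : square_integrable f -> \int[P]_x centered f x = 0.
Proof.
move=> [mf f2]; have fi := square_integrable_integrable mf f2.
by rewrite RintegralB//= ?Rintegral_cstT ?subrr//; exact: integrable_cstT.
Qed.

Lemma Rintegral_centered_mul f g : square_integrable f -> square_integrable g ->
  \int[P]_x (centered f x * centered g x) =
  \int[P]_x (f x * g x) - (\int[P]_x f x) * (\int[P]_x g x).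
Proof.
move=> sf sg; have fgi := square_integrable_mul sf sg.
case: (sf) => mf f2; case: (sg) => mg g2.
have fi := square_integrable_integrable mf f2.
have gi := square_integrable_integrable mg g2.
set a := \int[P]_x f x; set b := \int[P]_x g x.
transitivity (\int[P]_x (f x * g x + (- b * f x + (- a * g x + a * b)))).
  by apply: eq_Rintegral => x _; rewrite /centered -/a -/b; ring.
have i1 := integrableRZ (- b) fi; have i2 := integrableRZ (- a) gi.
have i3 := integrable_cstT P (a * b).
have i4 := integrableRD i2 i3; have i5 := integrableRD i1 i4.
rewrite RintegralD// RintegralD// RintegralD// Rintegral_cstT !RintegralZl// -/a -/b; ring.
Qed.

End covariance_formulas.

Definition kiefer_mueller_cov d (X : measurableType d) (R : realType)
    (P : probability X R) (s t : R * (X -> R)) : R :=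
  Num.min s.1 t.1 * (\int[P]_y (s.2 y * t.2 y) -
    (\int[P]_y s.2 y) * (\int[P]_y t.2 y)).

Section process_cf.
Context d (T : measurableType d) (R : realType) (Pr : probability T R).
Context dX (X : measurableType dX) (P : probability X R).
Context (xi : nat -> {RV Pr >-> X}).
Hypothesis xi_law : forall i, has_law Pr (xi i) P.
Hypothesis xi_indep : mutually_independent Pr (fun i => xi i : T -> X).
Context (k : nat -> nat) (del : forall m : nat, {set 'I_m}).
Hypothesis del_k : deletion_sets k del.
Hypothesis k_small : (k n)%:R / n%:R @[n --> \oo] --> (0 : R).
Context (p : nat) (tt : 'I_p -> R * (X -> R)) (lam : 'I_p -> R).
Hypothesis tt01 : forall j, 0 <= (tt j).1 <= 1.
Hypothesis tt2 : forall j, square_integrable P (tt j).2.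

Let Y := deleted_sequential_process P (fun i => xi i : T -> X) del.
Let cf j := centered P (tt j).2.
Let sc j : square_integrable P (cf j) := centered_square_integrable (tt2 j).
Let Phi (b : {set 'I_p}) (x : X) : R :=
  \sum_(j < p) (j \in b)%:R * lam j * cf j x.
Let a n j := Num.truncn (n.+1%:R * (tt j).1).
Let B n i : {set 'I_p} := [set j | kept del (a n j) i].
Let tn n : R := (Num.sqrt n.+1%:R)^-1.

Let a_le n j : (a n j <= n.+1)%N. Proof. exact: truncn_scale_le. Qed.

Let tn2 n : tn n ^+ 2 = n.+1%:R^-1.
Proof. by rewrite exprVn sqr_sqrtr. Qed.

Let tn0 n : tn n != 0.
Proof. by rewrite invr_eq0 gt_eqF// sqrtr_gt0. Qed.

Let tnc : tn n @[n --> \oo] --> (0 : R).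
Proof.
rewrite (_ : tn = fun n => Num.sqrt (n.+1%:R^-1)); last first.
  by apply/funext => n; rewrite /tn sqrtrV.
rewrite -[X in _ --> X]sqrtr0; apply: continuous_cvg; first exact: sqrt_continuous.
exact: cvg_harmonic.
Qed.

(** Exchanging the two sums collects, for each observation, the marginals that keep it; the result
    has the form treated by the triangular central limit theorem. *)
Let YE n w : \sum_(j < p) lam j * Y n.+1 (tt j) w =
  \sum_(i < n.+1) (tn n * Phi (B n i) (xi i w)).
Proof.
rewrite -mulr_sumr exchange_big/= mulr_sumr; apply: eq_bigr => j _.
rewrite /Y /deleted_sequential_process -/(tn n) mulrCA; congr (_ * _).
rewrite (kept_sum del (fun i => cf j (xi i w)) (a_le n j)) mulr_sumr.
by apply: eq_bigr => i _; rewrite inE; ring.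
Qed.

Let Phi_sq b : square_integrable P (Phi b).
Proof.
by apply: square_integrable_sum => j; exact: square_integrableZ.
Qed.

Let Phi0 b : \int[P]_x Phi b x = 0.
Proof.
have ci j : P.-integrable setT (EFin \o cf j).
  by case: (sc j) => mc c2; exact: square_integrable_integrable.
rewrite Rintegral_sumR; last by move=> j; exact: integrableRZ.
by rewrite big1// => j _; rewrite RintegralZl// Rintegral_centered// mulr0.
Qed.

Let Phi2 b : \int[P]_x (Phi b x ^+ 2) = \sum_(j < p) \sum_(l < p)
   ((j \in b)%:R * (l \in b)%:R) * (lam j * lam l * \int[P]_x (cf j x * cf l x)).
Proof.
have ci j l : P.-integrable setT (EFin \o (fun x => cf j x * cf l x)).
  exact: square_integrable_mul.
transitivity (\int[P]_x (\sum_(j < p) \sum_(l < p)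
   ((j \in b)%:R * (l \in b)%:R * (lam j * lam l)) * (cf j x * cf l x))).
  apply: eq_Rintegral => x _; rewrite expr2 /Phi mulr_suml.
  apply: eq_bigr => j _; rewrite mulr_sumr; apply: eq_bigr => l _; ring.
rewrite Rintegral_sumR; last first.
  by move=> j; apply: integrableR_sum => l; exact: integrableRZ.
apply: eq_bigr => j _; rewrite Rintegral_sumR; last first.
  by move=> l; exact: integrableRZ.
by apply: eq_bigr => l _; rewrite (@RintegralZl _ _ _ P setT (fun x => cf j x * cf l x))// [RHS]mulrA.
Qed.

(** The proportion of observations kept by both marginals differs from [minn (a n j) (a n l) / n.+1]
    by at most the two deletion numbers over [n.+1]. This is where the smallness of [k] enters. *)
Let count_cvg j l : tn n ^+ 2 * \sum_(i < n.+1) ((j \in B n i)%:R * (l \in B n i)%:R)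
  @[n --> \oo] --> Num.min (tt j).1 (tt l).1.
Proof.
have hmin : (minn (a n j) (a n l))%:R / n.+1%:R @[n --> \oo] --> Num.min (tt j).1 (tt l).1.
  have h i : (a n i)%:R / n.+1%:R @[n --> \oo] --> (tt i).1.
    by apply: cvg_truncn_scale; case/andP: (tt01 i).
  (* Truncation is monotone, so the order of the times decides the order of [a n j] and [a n l] for
     every [n]. *)
  wlog jl : j l / (tt j).1 <= (tt l).1.
    move=> H; case/orP: (le_total (tt j).1 (tt l).1); first exact: H.
    by move=> lj; rewrite minC; under eq_fun do rewrite minnC; exact: H.
  rewrite min_l//; apply: cvg_trans (h j); apply: near_eq_cvg; near=> n.
  congr (_%:R / _); apply/esym/minn_idPl; rewrite /a; apply: le_truncn.
  by rewrite ler_wpM2l.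
have hk : ((k (a n j))%:R + (k (a n l))%:R) / n.+1%:R @[n --> \oo] --> (0 : R).
  under eq_fun do rewrite mulrDl.
  have h i : (k (a n i))%:R / n.+1%:R @[n --> \oo] --> (0 : R).
    by apply: cvg_small_index k_small => n; exact: a_le.
  by have := cvgD (h j) (h l); rewrite addr0; exact.
apply/cvgrPdist_le => e e0.
have e2 : 0 < e / 2 by rewrite divr_gt0.
move/cvgrPdist_le : hmin => /(_ _ e2) hmin.
move/cvgrPdist_le : hk => /(_ _ e2) hk.
near=> n.
have h1 : `|Num.min (tt j).1 (tt l).1 - (minn (a n j) (a n l))%:R / n.+1%:R| <= e / 2.
  by near: n.
have h2 : `|0 - ((k (a n j))%:R + (k (a n l))%:R) / n.+1%:R| <= e / 2.
  by near: n.
have n0 : 0 < n.+1%:R :> R by [].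
rewrite sub0r normrN ger0_norm ?divr_ge0 ?addr_ge0// in h2.
have h3 := kept_both_count R del_k (a_le n j) (a_le n l).
rewrite (splitr e); apply: le_trans (ler_distD _ _ _) (lerD h1 _).
apply: le_trans h2; rewrite tn2 mulrC -mulrBr normrM mulrC
  [X in _ * X <= _]gtr0_norm ?invr_gt0//.
rewrite ler_pM2r ?invr_gt0// distrC; apply: le_trans h3.
by under eq_bigr do rewrite !inE.
Unshelve. all: by end_near. Qed.

Let v := \sum_(j < p) \sum_(l < p) lam j * lam l * kiefer_mueller_cov P (tt j) (tt l).

Let var_cvg : tn n ^+ 2 * \sum_(i < n.+1) \int[P]_x (Phi (B n i) x ^+ 2)
  @[n --> \oo] --> v.
Proof.
rewrite (_ : (fun n => _) = fun n => \sum_(j < p) \sum_(l < p)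
   (lam j * lam l * \int[P]_x (cf j x * cf l x)) *
   (tn n ^+ 2 * \sum_(i < n.+1) ((j \in B n i)%:R * (l \in B n i)%:R))); last first.
  apply/funext => n; under eq_bigr do rewrite Phi2.
  rewrite exchange_big mulr_sumr/=; apply: eq_bigr => j _.
  rewrite exchange_big mulr_sumr/=; apply: eq_bigr => l _.
  by rewrite mulrCA; congr (_ * _); rewrite mulr_sumr; apply: eq_bigr => i _; rewrite mulrC.
apply: cvg_sumR => j; apply: cvg_sumR => l.
rewrite /kiefer_mueller_cov -Rintegral_centered_mul// [Num.min _ _ * _]mulrC mulrA.
apply: cvgMl_tmp; exact: count_cvg.
Qed.

Let NK n : (n.+1)%:R * tn n ^+ 2 <= 1.
Proof. by rewrite tn2 divff. Qed.

Lemma cvg_process_cos :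
  \int[Pr]_w cos (\sum_(j < p) lam j * Y n (tt j) w) @[n --> \oo] --> expR (- (v / 2)).
Proof.
(* The limit is taken along [n.+1], which keeps the normalization [tn n] nonzero. *)
rewrite -(cvg_shiftS _ _); under eq_fun do under eq_Rintegral do rewrite YE.
by apply: (cvg_cf_triangular_cos xi_law xi_indep _ _ Phi0 tn0 tnc NK var_cvg) => b;
  case: (Phi_sq b).
Qed.

Lemma cvg_process_sin :
  \int[Pr]_w sin (\sum_(j < p) lam j * Y n (tt j) w) @[n --> \oo] --> (0 : R).
Proof.
rewrite -(cvg_shiftS _ _); under eq_fun do under eq_Rintegral do rewrite YE.
by apply: (@cvg_cf_triangular_sin _ _ _ _ _ _ P xi xi_law xi_indep _ Phi _ _ Phi0
  tn (fun n => n.+1) 1 B tn0 tnc NK) => b;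
  case: (Phi_sq b).
Qed.

End process_cf.

(** * Loeb measure *)

Section ultrafilter_limit.
Context (R : realType) (U : set_system nat) (UU : UltraFilter U).

Definition ulim (u : nat -> R) : R := lim (u n @[n --> U]).

(** Compactness of the segment gives a cluster point, and a cluster point of an ultrafilter is a
    limit: a neighborhood whose preimage is not in [U] would have the preimage of its complement in
    [U]. *)
Lemma ulim_cvg (u : nat -> R) (M : R) : (forall n, `|u n| <= M) ->
  u n @[n --> U] --> ulim u.
Proof.
move=> uM.
have [|p [_ pu]] := @segment_compact R (- M) M (u n @[n --> U]) _.

  by apply: nearW => n; rewrite /= in_itv/= -ler_norml.
suff pU : u n @[n --> U] --> p by apply: cvgP pU.
move=> B pB; have [//|UB] := in_ultra_setVsetC (u @^-1` B) UU.
by have [y []] := pu (~` B) B UB pB.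
Qed.

Lemma ulimE (u : nat -> R) (l : R) : u n @[n --> U] --> l -> ulim u = l.
Proof. by move=> ul; apply: cvg_lim. Qed.

End ultrafilter_limit.

(* Sequences are not identified modulo U: the sets [internal] below do not
   separate equivalent ones. *)
Definition ultrapower d (T : measurableType d) (U : set_system nat)
  (UU : UltraFilter U) : Type := nat -> T.

HB.instance Definition _ d (T : measurableType d) U (UU : UltraFilter U) :=
  Pointed.copy (ultrapower T UU) (nat -> T).

Section internal_sets.
Context d (T : measurableType d) (U : set_system nat) (UU : UltraFilter U).
Local Notation uT := (ultrapower T UU).

Definition internal (A : nat -> set T) : set uT :=
  [set w | U [set n | A n (w n)]].

Lemma internal_setC A : ~` internal A = internal (fun n => ~` A n).
Proof.
apply/seteqP; split=> [w|w UC UA] /=.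
  by have [|] := in_ultra_setVsetC [set n | A n (w n)] UU.
have : U set0 by apply: filterS2 UC UA => n.
exact: filter_not_empty.
Qed.

Lemma internal_setI A B :
  internal A `&` internal B = internal (fun n => A n `&` B n).
Proof.
apply/seteqP; split=> [w [UA UB]|w UAB] /=; first exact: filterI.
by split; apply: filterS UAB => n [].
Qed.

Lemma internal_setU A B :
  internal A `|` internal B = internal (fun n => A n `|` B n).
Proof.
rewrite -[LHS]setCK setCU !internal_setC internal_setI internal_setC.
by congr internal; apply/funext => n; rewrite setCI !setCK.
Qed.

Lemma internal_set0 : internal (fun=> set0) = set0.
Proof. by apply/seteqP; split=> // w; exact: filter_not_empty. Qed.

Lemma internal_setT : internal (fun=> setT) = setT.
Proof. by apply/seteqP; split=> // w _; apply: filterS filterT. Qed.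

(** If the inclusion failed for [U]-almost all [n], choosing a counterexample at each such [n] would
    give a sequence in [internal A] but not in [internal B]. Thus [internal] determines its
    representing sequence [U]-almost everywhere. *)
Lemma internal_subset A B : internal A `<=` internal B ->
  U [set n | A n `<=` B n].
Proof.
move=> AB; have [//|UC] := in_ultra_setVsetC [set n | A n `<=` B n] UU.
have /choice[w hw] n : exists x, ~ (A n `<=` B n) -> A n x /\ ~ B n x.
  have [nAB|AnB] := pselect (exists x, A n x /\ ~ B n x).
    by case: nAB => x hx; exists x.
  exists point => nAB; exfalso; apply: nAB => x Ax.
  by apply: contrapT => nBx; apply: AnB; exists x.
have Aw : internal A w by apply: filterS UC => n /hw[].
have : U set0.
  by apply: filterS2 (AB _ Aw) UC => n Bw /hw[].
by move/(@filter_not_empty _ _ _).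
Qed.

Hypothesis Uoo : \oo `<=` U.

(** Countable compactness of internal sets, by diagonalization. Without a finite subcover, for every
    [K] the set [C K n] of points of [A n] that avoid the first [K] sets is nonempty for [U]-almost
    all [n]; one sequence that lies in all of them contradicts the cover. *)
Lemma internal_saturation A (B : nat -> nat -> set T) :
  internal A `<=` \bigcup_k internal (B k) ->
  exists N, internal A `<=` \bigcup_(k < N) internal (B k).
Proof.
move=> AB; apply: contrapT => nN.
pose C K n := A n `&` [set x | forall k, (k < K)%N -> ~ B k n x].
have UC K : U [set n | C K n !=set0].
  have [w [Aw nB]] : exists w, internal A w /\ forall k, (k < K)%N -> ~ internal (B k) w.
    apply: contrapT => h; apply: nN; exists K => w Aw.
    apply: contrapT => nB; apply: h; exists w; split=> // k kK Bw.
    by apply: nB; exists k.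
  have UB : U [set n | forall k, (k < K)%N -> ~ B k n (w n)].
    elim: K nB => [|K ih] nB; first by apply: filterS filterT => n _ k.
    have h1 : U [set n | forall k, (k < K)%N -> ~ B k n (w n)].
      by apply: ih => k kK; apply: nB; rewrite (ltn_trans kK).
    have h2 : U [set n | ~ B K n (w n)].
      have : (~` internal (B K)) w by apply: nB.
      by rewrite internal_setC.
    apply: filterS2 h1 h2 => n a b k; rewrite ltnS leq_eqVlt => /predU1P[->//|].
    exact: a.
  by apply: filterS2 Aw UB => n a b; exists (w n).
have C_anti K K' n : (K <= K')%N -> C K' n `<=` C K n.
  by move=> KK x [Ax h]; split=> // k kK; apply: h; exact: leq_trans kK KK.
(* At index [n], the point is taken in [C K n] for the largest [K <= n] for which it is nonempty;
   monotonicity in [K] then covers the smaller values. *)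
have /choice[w hw] n : exists x, forall K, (K <= n)%N -> C K n !=set0 -> C K n x.
  suff H M : exists x, forall K, (K <= M)%N -> C K n !=set0 -> C K n x by exact: H.
  elim: M => [|M [x hx]].
    have [[x Cx]|nC] := pselect (C 0%N n !=set0).
      by exists x => K; rewrite leqn0 => /eqP ->.
    by exists point => K; rewrite leqn0 => /eqP -> /nC.
  have [[y Cy]|nC] := pselect (C M.+1 n !=set0).
    by exists y => K KM _; exact: C_anti Cy.
  by exists x => K; rewrite leq_eqVlt => /predU1P[-> /nC//|]; rewrite ltnS; exact: hx.
have UCw K : U [set n | C K n (w n)].
  (* The diagonal choice respects [K] only from index [K] on, which is harmless because [U] contains
     the cofinite sets. *)
  have Uge : U [set n | (K <= n)%N] by apply: Uoo; exact: nbhs_infty_ge.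
  by apply: filterS2 Uge (UC K) => n; exact: hw.
have Aw : internal A w by apply: filterS (UCw 0%N) => n [].
have [k _ Bw] := AB _ Aw.
have : U set0.
  by apply: filterS2 Bw (UCw k.+1) => n /= Bkn [_ /(_ k (ltnSn k))].
exact: filter_not_empty.
Qed.

End internal_sets.
Arguments internal {d T U} UU A.

Section ultraproduct_measure.
Context d (T : measurableType d) (R : realType) (Pr : probability T R).
Context (U : set_system nat) (UU : UltraFilter U).
Hypothesis Uoo : \oo `<=` U.
Local Notation uT := (ultrapower T UU).

Definition internal_measurable : set (set uT) :=
  [set internal UU A | A in [set A | forall n, measurable (A n)]].

Let im0 : internal_measurable set0.
Proof. by exists (fun=> set0) => //; exact: internal_set0. Qed.

Let imU : setU_closed internal_measurable.
Proof.
move=> _ _ [A mA <-] [B mB <-]; exists (fun n => A n `|` B n).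
  by move=> n; exact: measurableU.
by rewrite internal_setU.
Qed.

Let imC : setC_closed internal_measurable.
Proof.
move=> _ [A mA <-]; exists (fun n => ~` A n); first by move=> n; exact: measurableC.
by rewrite internal_setC.
Qed.

HB.instance Definition _ :=
  isAlgebraOfSets.Build default_measure_display (ultrapower T UU) im0 imU imC.

Let prob_seq (A : nat -> set T) (n : nat) : R := fine (Pr (A n)).

Let prob_seq_bound A n : (forall n, measurable (A n)) -> `|prob_seq A n| <= 1.
Proof.
move=> mA; rewrite ger0_norm ?fine_ge0// -[leRHS]/(fine 1%E) fine_le//.
- exact: fin_num_measure.
- exact: probability_le1.
Qed.

Let prob_seq_cvg A : (forall n, measurable (A n)) ->
  prob_seq A n @[n --> U] --> ulim U (prob_seq A).
Proof. by move=> mA; apply: (@ulim_cvg _ _ _ _ 1) => n; exact: prob_seq_bound. Qed.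

(* The hypothesis on U is an argument so that the measure instance, which needs
   it for countable additivity, can be found from the function alone. *)
Definition internal_content (_ : \oo `<=` U) (S : set uT) : \bar R :=
  (ulim U (prob_seq (xget (fun=> set0)
    [set A | (forall n, measurable (A n)) /\ internal UU A = S])))%:E.

(** Makes the content independent of the representative picked by [xget]: equal internal sets have
    sequences that agree for [U]-almost all [n]. *)
Let ulim_eq A B : (forall n, measurable (A n)) -> (forall n, measurable (B n)) ->
  internal UU A = internal UU B -> ulim U (prob_seq A) = ulim U (prob_seq B).
Proof.
move=> mA mB AB; apply: ulimE.
have h1 : U [set n | A n `<=` B n] by apply: (@internal_subset _ _ _ UU); rewrite AB.
have h2 : U [set n | B n `<=` A n] by apply: (@internal_subset _ _ _ UU); rewrite AB.
apply: cvg_trans (prob_seq_cvg mB); apply: near_eq_cvg.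
by apply: filterS2 h1 h2 => n ab ba; rewrite /prob_seq (_ : A n = B n)//; exact/seteqP.
Qed.

Lemma internal_contentE A : (forall n, measurable (A n)) ->
  internal_content Uoo (internal UU A) = (ulim U (fun n => fine (Pr (A n))))%:E.
Proof.
move=> mA; rewrite /internal_content; case: xgetP => [B -> [mB BA]|/(_ A)[]//].
by congr EFin; exact: ulim_eq.
Qed.

Let ic_ge0 S : (0 <= internal_content Uoo S)%E.
Proof.
rewrite lee_fin; case: xgetP => [B _ [mB _]|_].
  apply: limr_ge; first by apply: cvgP; exact: prob_seq_cvg.
  by apply: nearW => n; rewrite fine_ge0.
rewrite (@ulimE _ _ _ _ 0)// (_ : prob_seq _ = fun=> 0); first exact: cvg_cst.
by apply/funext => n; rewrite /prob_seq measure0.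
Qed.

Let ic0 : internal_content Uoo set0 = 0%E.
Proof.
rewrite -(@internal_set0 _ T _ UU) internal_contentE//; congr EFin; apply: ulimE.
rewrite (_ : (fun n => _) = fun=> 0); first exact: cvg_cst.
by apply/funext => n; rewrite measure0.
Qed.

Let icU (S S' : set uT) : measurable S -> measurable S' -> S `&` S' = set0 ->
  (internal_content Uoo (S `|` S') = internal_content Uoo S + internal_content Uoo S')%E.
Proof.
move=> [A mA <-] [B mB <-]; rewrite internal_setI internal_setU => AB0.
rewrite !internal_contentE//; last by move=> n; exact: measurableU.
rewrite -EFinD; congr EFin; apply: ulimE.
have h : U [set n | A n `&` B n `<=` set0].
  apply: (@internal_subset _ _ _ UU (fun n => A n `&` B n) (fun=> set0)).
  by rewrite AB0.
apply: cvg_trans (cvgD (prob_seq_cvg mA) (prob_seq_cvg mB)).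
apply: near_eq_cvg; apply: filterS h => n /=; rewrite subset0 => AB.
by rewrite /= measureU// fineD// fin_num_measure.
Qed.

Let ic_bigU (F : nat -> set uT) n : (forall k, measurable (F k)) -> trivIset setT F ->
  (internal_content Uoo (\big[setU/set0]_(k < n) F k) =
  \sum_(k < n) internal_content Uoo (F k))%E.
Proof.
move=> mF tF; elim: n => [|n ih]; first by rewrite !big_ord0 ic0.
rewrite !big_ord_recr/= icU//; first by rewrite ih.
- exact: bigsetU_measurable.
- rewrite -bigcup_mkord setI_bigcupl; apply: bigcup0 => i /= iN.
  by move/trivIsetP : tF => ->//; rewrite ltn_eqF.
Qed.

(** By saturation an internal union of internal sets is already a finite union, so the partial sums
    are eventually constant and finite additivity is enough. *)
Let ic_sigma_additive : semi_sigma_additive (internal_content Uoo).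
Proof.
move=> F mF tF mUF.
have [A /= Am AE] := mUF.
have /choice[B hB] k : exists B, (forall n, measurable (B n)) /\ internal UU B = F k.
  by have [B mB BE] := mF k; exists B.
have [|N hN] := @internal_saturation _ _ _ UU Uoo A B.
  rewrite AE => w [k _ Fw]; exists k => //.
  by case: (hB k) => _ ->.
apply: cvg_near_cst; exists N => // n /= Nn.
rewrite big_mkord -ic_bigU//; congr internal_content; apply/seteqP; split=> w.
  by rewrite -bigcup_mkord => -[k _ Fk]; exists k.
rewrite -AE => /hN[k /= kN Bk]; rewrite -bigcup_mkord; exists k => /=.
  exact: leq_trans kN Nn.
by case: (hB k) => _ <-.
Qed.

HB.instance Definition _ := isMeasure.Build default_measure_display (ultrapower T UU) R
  (internal_content Uoo) ic0 ic_ge0 ic_sigma_additive.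

End ultraproduct_measure.

(** * Integration on the Loeb space *)

Section ultraproduct_integral.
Context d (T : measurableType d) (R : realType) (Pr : probability T R).
Context (U : set_system nat) (UU : UltraFilter U).
Hypothesis Uoo : \oo `<=` U.
Local Notation uT := (ultrapower T UU).

Definition loeb_space : measurableType _ :=
  g_sigma_algebraType (@measurable default_measure_display (ultrapower T UU)).

Definition loeb_measure : set loeb_space -> \bar R :=
  measure_extension (internal_content Pr Uoo).

HB.instance Definition _ := Measure.on (loeb_measure).

Lemma measurable_internal (A : nat -> set T) : (forall n, measurable (A n)) ->
  measurable (internal UU A : set loeb_space).
Proof. by move=> mA; apply: sub_sigma_algebra; exists A. Qed.

Lemma loeb_measure_internal (A : nat -> set T) : (forall n, measurable (A n)) ->
  loeb_measure (internal UU A) = (ulim U (fun n => fine (Pr (A n))))%:E.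
Proof.
move=> mA; rewrite -(@internal_contentE _ _ R Pr U UU Uoo)//.
by rewrite /loeb_measure /measure_extension measurable_mu_extE//; exists A.
Qed.

Let loeb_setT : loeb_measure setT = 1%E.
Proof.
rewrite -(@internal_setT _ T _ UU) loeb_measure_internal//; congr EFin.
by apply: ulimE; rewrite probability_setT; exact: cvg_cst.
Qed.

HB.instance Definition _ := Measure_isProbability.Build _ loeb_space R
  (loeb_measure) loeb_setT.

Let Q : probability loeb_space R := loeb_measure.

Definition ulift (g : nat -> T -> R) (w : loeb_space) : R :=
  ulim U (fun n => g n (w n)).

Lemma measurable_ulift (g : nat -> T -> R) (M : R) :
  (forall n, measurable_fun setT (g n)) -> (forall n x, `|g n x| <= M) ->
  measurable_fun setT (ulift g).
Proof.
move=> mg gM.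
have gc (w : loeb_space) : g n (w n) @[n --> U] --> ulift g w by exact: ulim_cvg.
apply: (measurability (@RGenOInfty.G R)); first exact: RGenOInfty.measurableE.
move=> _ [_ [a ->] <-]; rewrite setTI.
have mA k n : measurable (g n @^-1` `]a + k.+1%:R^-1, +oo[).
  by rewrite -[X in measurable X]setTI; exact: mg.
(* A strict inequality does not survive a limit; the margin [k.+1%:R^-1] makes the condition
   [a < lim] a countable union of internal sets. *)
rewrite (_ : _ @^-1` _ = \bigcup_k internal UU (fun n => g n @^-1` `]a + k.+1%:R^-1, +oo[)).
  by apply: bigcup_measurable => k _; exact: measurable_internal.
apply/seteqP; split=> w /=; rewrite ?in_itv/= ?andbT.
  move=> aw.
  have [k ka] : exists k, a + k.+1%:R^-1 < ulift g w by exact: ltr_add_invr.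
  exists k => //=; rewrite /internal /=.
  have ug : U [set n | a + k.+1%:R^-1 < g n (w n)].
    by apply: (cvgr_gt _ (gc w)); exact: ka.
  by apply: filterS ug => n /=; rewrite in_itv/= andbT.
move=> [k _] Ug.
apply: (@lt_le_trans _ _ (a + k.+1%:R^-1)); first by rewrite ltrDl.
apply: limr_ge; first by apply: cvgP; exact: gc.
by apply: filterS Ug => n /=; rewrite in_itv/= andbT => /ltW.
Qed.

(** On [0, 1] this is the floor of [N * y] divided by [N], written as a sum of indicators so that
    its mean is a finite sum of probabilities. *)
Let stair (N : nat) (y : R) : R :=
  \sum_(k < N) N%:R^-1 * ((k.+1%:R / N%:R <= y)%R : nat)%:R.

Let stair_dist N y : (0 < N)%N -> 0 <= y <= 1 -> `|y - stair N y| <= N%:R^-1.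
Proof.
move=> N0 /andP[y0 y1].
have NR : 0 < N%:R :> R by rewrite ltr0n.
have Ny0 : 0 <= N%:R * y by rewrite mulr_ge0.
pose m := Num.truncn (N%:R * y).
have h1 : m%:R <= N%:R * y by have := truncn_le (N%:R * y); rewrite Ny0.
have h2 : N%:R * y < m%:R + 1 by have := truncnS_gt (N%:R * y); rewrite -natr1.
have mN : (m <= N)%N.
  by rewrite -(@ler_nat R); apply: le_trans h1 _; rewrite ler_piMr.
have -> : stair N y = m%:R / N%:R.
  rewrite /stair -mulr_sumr mulrC; congr (_ * _).
  rewrite -natr_sum; congr _%:R.
  transitivity (\sum_(i < m) 1)%N; last by rewrite sum1_card card_ord.
  rewrite (big_ord_widen N (fun=> 1)%N mN) [RHS]big_mkcond/=.
  apply: eq_bigr => i _; rewrite ler_pdivrMr// [y * _]mulrC.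
  have -> : (i.+1%:R <= N%:R * y) = (i < m)%N.
    apply/idP/idP => [h|h]; last by apply: le_trans h1; rewrite ler_nat.
    by rewrite -ltnS -(@ltr_nat R) -[X in _ < X]natr1; exact: le_lt_trans h h2.
  by case: ifP.
have -> : y - m%:R / N%:R = (N%:R * y - m%:R) / N%:R by field; rewrite gt_eqF.
rewrite normrM normfV (gtr0_norm NR) ler_piMl ?invr_ge0//.
by rewrite ger0_norm ?subr_ge0// lerBlDl ltW.
Qed.

(** For finite sums of indicators of internal sets the identity is the definition of the Loeb
    measure; staircases carry it over to functions with values in [0, 1], with uniform error
    [N%:R^-1]. *)
Let integral_ulift01 (g : nat -> T -> R) :
  (forall n, measurable_fun setT (g n)) -> (forall n x, 0 <= g n x <= 1) ->
  \int[Q]_w ulift g w = ulim U (fun n => \int[Pr]_x g n x).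
Proof.
move=> mg g01.
have gM n x : `|g n x| <= 1 by have /andP[? ?] := g01 n x; rewrite ger0_norm.
have mL := measurable_ulift mg gM.
have gc (w : loeb_space) : g n (w n) @[n --> U] --> ulift g w by exact: ulim_cvg.
have LM w : `|ulift g w| <= 1.
  rewrite ler_norml; apply/andP; split.
    apply: limr_ge; first by apply: cvgP; exact: gc.
    by apply: nearW => n; have := gM n (w n); rewrite ler_norml => /andP[].
  apply: limr_le; first by apply: cvgP; exact: gc.
  by apply: nearW => n; have := gM n (w n); rewrite ler_norml => /andP[].
have Li := bounded_integrable Q mL LM.
have gi n := bounded_integrable Pr (mg n) (gM n).
have gic : \int[Pr]_x g n x @[n --> U] --> ulim U (fun n => \int[Pr]_x g n x).
  by apply: (@ulim_cvg _ _ _ _ 1) => n; apply: Rintegral_bound.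
apply/eqP; rewrite -subr_eq0 -normr_eq0; apply/eqP/le_anti; rewrite normr_ge0 andbT.
apply/ler_addgt0Pl => e e0; rewrite addr0.
(* One error for the staircase on the Loeb space and one for the staircases along the sequence. *)
have [N N0 Ne] : exists2 N, (0 < N)%N & 2 * N%:R^-1 <= e.
  exists (Num.truncn (2 / e)).+1 => //.
  rewrite ler_pdivrMr ?ltr0n// mulrC -ler_pdivrMr//.
  by apply/ltW; exact: truncnS_gt.
pose A k n := [set x | k.+1%:R / N%:R <= g n x].
have mA k n : measurable (A k n).
  rewrite (_ : A k n = g n @^-1` `[k.+1%:R / N%:R, +oo[); last first.
    by apply/seteqP; split=> x; rewrite /A /= in_itv/= andbT.
  by rewrite -[X in measurable X]setTI; exact: mg.
have ind_int d' (V : measurableType d') (P : probability V R) (S : set V) :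
    measurable S -> P.-integrable setT (EFin \o (fun x => N%:R^-1 * \1_S x)).
  move=> mS; apply: integrableRZ; apply: (@bounded_integrable _ _ _ _ _ 1).
    exact: measurable_indic.
  by move=> x; rewrite indicE; case: (_ \in _); rewrite ?normr1 ?normr0.
have ind_E d' (V : measurableType d') (P : probability V R) (S : set V) :
    measurable S -> \int[P]_x (N%:R^-1 * \1_S x) = N%:R^-1 * fine (P S).
  move=> mS; rewrite RintegralZl//; first by rewrite /Rintegral integral_indic// setIT.
  apply: (@bounded_integrable _ _ _ _ _ 1); first exact: measurable_indic.
  by move=> x; rewrite indicE; case: (_ \in _); rewrite ?normr1 ?normr0.
pose s n x : R := \sum_(k < N) N%:R^-1 * \1_(A k n) x.
pose Ls (w : loeb_space) : R := \sum_(k < N) N%:R^-1 * \1_(internal UU (A k)) w.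
have sE n x : s n x = stair N (g n x).
  rewrite /s /stair; apply: eq_bigr => k _; congr (_ * _); rewrite indicE.
  by congr ((nat_of_bool _)%:R); apply/idP/idP; rewrite inE.
have d1 n : `|\int[Pr]_x g n x - \int[Pr]_x s n x| <= N%:R^-1.
  apply: Rintegral_dist => //; first by apply: integrableR_sum => k; exact: ind_int.
  by move=> x; rewrite sE; exact: stair_dist.
have d2 : `|\int[Q]_w ulift g w - \int[Q]_w Ls w| <= N%:R^-1.
  apply: Rintegral_dist => //.
    by apply: integrableR_sum => k; apply: ind_int; exact: measurable_internal.
  move=> w; rewrite distrC.
  (* [Ls w] may differ from the staircase of [ulift g w] when the limit hits a grid level. It does
     equal [s n (w n)] for [U]-almost all [n], and the bound passes to the limit in this form. *)
  have hU : U [set n | forall k : 'I_N, \1_(A k n) (w n) = \1_(internal UU (A k)) w :> R].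
    have hk (k : 'I_N) : U [set n | \1_(A k n) (w n) = \1_(internal UU (A k)) w :> R].
      have [wA|wA] := pselect (internal UU (A k) w).
        have -> : \1_(internal UU (A k)) w = 1 :> R by rewrite indicE mem_set.
        by apply: filterS wA => n Aw /=; rewrite indicE mem_set.
      have -> : \1_(internal UU (A k)) w = 0 :> R by rewrite indicE memNset.
      have : (~` internal UU (A k)) w by [].
      rewrite internal_setC; apply: filterS => n nA /=.
      by rewrite indicE memNset.
    exact: filter_forall hk.
  have h : `|Ls w - g n (w n)| @[n --> U] --> `|Ls w - ulift g w|.
    by apply: cvg_norm; apply: cvgB; [exact: cvg_cst|exact: gc].
  have <- := cvg_lim (@Rhausdorff R) h.
  apply: limr_le; first by apply: cvgP; exact: h.
  apply: filterS hU => n hn.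
  have -> : Ls w = s n (w n) by apply: eq_bigr => k _; rewrite hn.
  by rewrite distrC sE; exact: stair_dist.
have d3 : \int[Q]_w Ls w = ulim U (fun n => \int[Pr]_x s n x).
  apply/esym/ulimE; rewrite Rintegral_sumR; last first.
    by move=> k; apply: ind_int; exact: measurable_internal.
  rewrite (_ : (fun n => _) = fun n => \sum_(k < N) N%:R^-1 * fine (Pr (A k n))); last first.
    apply/funext => n; rewrite Rintegral_sumR; last by move=> k; exact: ind_int.
    by apply: eq_bigr => k _; exact: ind_E.
  apply: cvg_sumR => k; rewrite ind_E; last exact: measurable_internal.
  apply: cvgMl_tmp; rewrite [Q _](loeb_measure_internal (mA k))/=; apply: (@ulim_cvg _ _ _ _ 1) => n.
  rewrite ger0_norm ?fine_ge0// -[leRHS]/(fine 1%E) fine_le//.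
  - exact: fin_num_measure.
  - exact: probability_le1.
have sic : \int[Pr]_x s n x @[n --> U] --> \int[Q]_w Ls w.
  rewrite d3; apply: (@ulim_cvg _ _ _ _ (1 + N%:R^-1)) => n.
  rewrite -[X in `|X|](subrK (\int[Pr]_x g n x)) addrC.
  apply: le_trans (ler_normD _ _) _; rewrite distrC lerD//.
  exact: Rintegral_bound.
have d4 : `|\int[Q]_w Ls w - ulim U (fun n => \int[Pr]_x g n x)| <= N%:R^-1.
  have h : `|\int[Pr]_x s n x - \int[Pr]_x g n x| @[n --> U] -->
      `|\int[Q]_w Ls w - ulim U (fun n => \int[Pr]_x g n x)|.
    by apply: cvg_norm; apply: cvgB; [exact: sic|exact: gic].
  rewrite -(cvg_lim (@Rhausdorff R) h); apply: limr_le; first by apply: cvgP; exact: h.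
  by apply: nearW => n; rewrite /= distrC.
apply: le_trans (ler_distD (\int[Q]_w Ls w) _ _) _.
by apply: le_trans (lerD d2 d4) _; lra.
Qed.

(** An affine change of scale brings the values into [0, 1]; [K = M + 1] is positive even when
    [M = 0]. *)
Lemma integral_ulift (g : nat -> T -> R) (M : R) :
  (forall n, measurable_fun setT (g n)) -> (forall n x, `|g n x| <= M) ->
  \int[Q]_w ulift g w = ulim U (fun n => \int[Pr]_x g n x).
Proof.
move=> mg gM.
have M0 : 0 <= M by apply: le_trans (gM 0%N point).
pose K := M + 1; have K0 : 0 < K by rewrite ltr_wpDl.
pose g' n x := (2 * K)^-1 * (g n x + K).
have mg' n : measurable_fun setT (g' n).
  by apply: measurable_funM => //; exact: measurable_funD.
have g'01 n x : 0 <= g' n x <= 1.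
  have := gM n x; rewrite ler_norml => /andP[h1 h2].
  rewrite /g' mulrC; apply/andP; split.
    by rewrite divr_ge0// /K; lra.
  by rewrite ler_pdivrMr /K; lra.
have h := integral_ulift01 mg' g'01.
have gc (w : loeb_space) : g n (w n) @[n --> U] --> ulift g w by exact: ulim_cvg.
have E w : ulift g' w = (2 * K)^-1 * (ulift g w + K).
  by apply: ulimE; apply: cvgMl_tmp; apply: cvgD => //; exact: cvg_cst.
have LM w : `|ulift g w| <= M.
  rewrite ler_norml; apply/andP; split.
    apply: limr_ge; first by apply: cvgP; exact: gc.
    by apply: nearW => n; have := gM n (w n); rewrite ler_norml => /andP[].
  apply: limr_le; first by apply: cvgP; exact: gc.
  by apply: nearW => n; have := gM n (w n); rewrite ler_norml => /andP[].
have Li := bounded_integrable Q (measurable_ulift mg gM) LM.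
have gi n := bounded_integrable Pr (mg n) (gM n).
have E1 : \int[Q]_w ulift g' w = (2 * K)^-1 * (\int[Q]_w ulift g w + K).
  under eq_Rintegral do rewrite E.
  rewrite RintegralZl//; last by apply: integrableRD => //; exact: integrable_cstT.
  by rewrite RintegralD// ?Rintegral_cstT//; exact: integrable_cstT.
have E2 : ulim U (fun n => \int[Pr]_x g' n x) =
    (2 * K)^-1 * (ulim U (fun n => \int[Pr]_x g n x) + K).
  apply: ulimE; rewrite (_ : (fun n => _) =
      fun n => (2 * K)^-1 * (\int[Pr]_x g n x + K)); last first.
    apply/funext => n.
    rewrite RintegralZl//; last by apply: integrableRD => //; exact: integrable_cstT.
    by rewrite RintegralD// ?Rintegral_cstT//; exact: integrable_cstT.
  apply: cvgMl_tmp; apply: cvgD; last exact: cvg_cst.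
  by apply: (@ulim_cvg _ _ _ _ M) => n; apply: Rintegral_bound.
move: h; rewrite E1 E2 => /mulfI h; apply/(addIr K)/h.
by rewrite invr_eq0 gt_eqF// mulr_gt0.
Qed.

End ultraproduct_integral.
Arguments loeb_space {d} T {U} UU.
Arguments loeb_measure {d T R} Pr {U} UU Uoo.

(** * The ultralimit of a tight sequence of processes *)

Section ultraproduct_process.
Context d (T : measurableType d) (R : realType) (Pr : probability T R).
Context (U : set_system nat) (UU : UltraFilter U).
Hypothesis Uoo : \oo `<=` U.
Context (I : Type) (Y : nat -> I -> T -> R).
Hypothesis mY : forall n i, measurable_fun setT (Y n i).
Hypothesis tightY : forall i (e : R), 0 < e ->
  exists M : R, forall n, fine (Pr [set x | M < `|Y n i x|]) <= e.

Let Q : probability (loeb_space T UU) R := loeb_measure Pr UU Uoo.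

Let low (M : nat) n i := [set x | `|Y n i x| <= M%:R].

Let mlow M n i : measurable (low M n i).
Proof.
rewrite (_ : low M n i = (fun x => `|Y n i x|) @^-1` `]-oo, M%:R]); last first.
  by apply/seteqP; split=> x; rewrite /low /= in_itv.
rewrite -[X in measurable X]setTI.
have : measurable_fun setT (fun x => `|Y n i x|) by apply: measurableT_comp.
exact.
Qed.

Definition nearstandard i : set (loeb_space T UU) :=
  \bigcup_M internal UU (fun n => low M n i).

Lemma measurable_nearstandard i : measurable (nearstandard i).
Proof.
by apply: bigcup_measurable => M _; apply: measurable_internal => n; exact: mlow.
Qed.

Lemma nearstandard_almost_sure i : Q (~` nearstandard i) = 0%E.
Proof.
apply/eqP; rewrite eq_le measure_ge0 andbT; apply/lee_addgt0Pr => e e0; rewrite add0e.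
have [M hM] := tightY i e0.
pose N := (Num.truncn M).+1.
have MN : M < N%:R by exact: truncnS_gt.
apply: (@le_trans _ _ (Q (internal UU (fun n => ~` low N n i)))).
  apply: le_measure; rewrite ?inE.
  - by apply: measurableC; exact: measurable_nearstandard.
  - by apply: measurable_internal => n; apply: measurableC; exact: mlow.
  - by rewrite -internal_setC; apply: subsetC => w Nw; exists N.
have mC n : measurable (~` low N n i) by apply: measurableC; exact: mlow.
rewrite [Q _](loeb_measure_internal Pr UU Uoo mC) lee_fin.
have mM n : measurable [set x | M < `|Y n i x|].
  rewrite (_ : [set x | _] = (fun x => `|Y n i x|) @^-1` `]M, +oo[); last first.
    by apply/seteqP; split=> x; rewrite /= in_itv/= andbT.
  rewrite -[X in measurable X]setTI.
  have : measurable_fun setT (fun x => `|Y n i x|) by apply: measurableT_comp.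
  exact.
apply: limr_le.
  apply: cvgP; apply: (@ulim_cvg _ _ _ _ 1) => n.
  rewrite ger0_norm ?fine_ge0// -[leRHS]/(fine 1%E) fine_le//.
  - exact: fin_num_measure.
  - exact: probability_le1.
apply: nearW => n; apply: le_trans (hM n); apply: fine_le.
- exact: fin_num_measure.
- exact: fin_num_measure.
- apply: le_measure; rewrite ?inE// => x /= /negP; rewrite -ltNge.
  exact: lt_trans.
Qed.

(* The indicator gives [standard_part] the value 0 where Y n i (w n) is unbounded
   along U and [ulim] is a junk value. *)
Definition standard_part i (w : loeb_space T UU) : R :=
  \1_(nearstandard i) w * ulim U (fun n => Y n i (w n)).

Lemma cvg_standard_part i w : nearstandard i w ->
  Y n i (w n) @[n --> U] --> standard_part i w.
Proof.
move=> nw; have [M _ UM] := nw.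
rewrite /standard_part indicE mem_set// mul1r.
(* The values are bounded only for [U]-almost all [n]; clamping bounds all of them without changing
   the limit along [U]. *)
pose v n := Num.max (- M%:R) (Num.min M%:R (Y n i (w n))).
have vM n : `|v n| <= M%:R.
  by rewrite ler_norml /v le_max lexx/= ge_max ge_min lexx/= (le_trans _ (ler0n _ M))// oppr_le0.
have UE : U [set n | v n = Y n i (w n)].
  apply: filterS UM => n; rewrite /low /= /v ler_norml => /andP[h1 h2].
  by rewrite min_r// max_r.
have vY : Y n i (w n) @[n --> U] --> ulim U v.
  by apply: cvg_trans (ulim_cvg UU vM); apply: near_eq_cvg.
by rewrite (ulimE UU vY).
Qed.

(** The lifts of the sequences clamped at level [M] are measurable, and at a nearstandard point they
    equal the standard part for all large [M]. *)
Lemma measurable_standard_part i : measurable_fun setT (standard_part i).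
Proof.
pose g (M : nat) n x := Num.max (- M%:R) (Num.min M%:R (Y n i x)) : R.
have mg M n : measurable_fun setT (g M n).
  by apply: measurable_maxr => //; apply: measurable_minr.
have gM M n x : `|g M n x| <= M%:R.
  by rewrite ler_norml /g le_max lexx/= ge_max ge_min lexx/= (le_trans _ (ler0n _ M))// oppr_le0.
apply: (@measurable_fun_cvg _ _ _ _
  (fun M (w : loeb_space T UU) => \1_(nearstandard i) w * ulift (g M) w)).
  move=> M; apply: measurable_funM.
    by apply: measurable_indic; exact: measurable_nearstandard.
  by apply: (@measurable_ulift _ _ _ _ UU (g M) M%:R).
move=> w _; have [nw|nw] := pselect (nearstandard i w); last first.
  rewrite /standard_part indicE memNset// mul0r.
  by under eq_fun do rewrite mul0r; exact: cvg_cst.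
have [M _ UM] := nw.
apply: cvg_near_cst; exists M => // K /= MK; congr (_ * _).
rewrite /ulift; apply: ulimE.
have := cvg_standard_part nw; rewrite /standard_part indicE mem_set// mul1r.
apply: cvg_trans; apply: near_eq_cvg; apply: filterS UM => n.
rewrite /low /= /g ler_norml => /andP[h1 h2].
have MK' : M%:R <= K%:R :> R by rewrite ler_nat.
rewrite min_r ?max_r// ?(le_trans h2)//.
by apply: le_trans h1; rewrite lerN2.
Qed.

HB.instance Definition _ i :=
  isMeasurableFun.Build _ _ _ _ (standard_part i) (measurable_standard_part i).

Definition standard_part_RV i : {RV Q >-> R} := standard_part i.

(** By continuity the cosine of the standard parts is the lift of the cosines wherever the finitely
    many coordinates are nearstandard, hence almost surely; the cosines are bounded, so
    [integral_ulift] applies. *)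
Lemma integral_cos_standard_part p (t : 'I_p -> I) (lam : 'I_p -> R) (th : R) :
  \int[Q]_w cos (th + \sum_(j < p) lam j * standard_part (t j) w) =
  ulim U (fun n => \int[Pr]_x cos (th + \sum_(j < p) lam j * Y n (t j) x)).
Proof.
pose g n x := cos (th + \sum_(j < p) lam j * Y n (t j) x) : R.
have mcos : measurable_fun setT (@cos R).
  by apply: continuous_measurable_fun; exact: continuous_cos.
have mg n : measurable_fun setT (g n).
  apply: measurableT_comp => //; apply: measurable_funD => //.
  by apply: measurable_sum => j; exact: measurable_funM.
rewrite -(@integral_ulift _ _ _ Pr _ UU Uoo g 1)//; last first.
  by move=> n x; exact: cos_max.
rewrite /Rintegral; congr fine; apply: ae_eq_integral => //.
- apply/measurable_EFinP; apply: measurableT_comp => //; apply: measurable_funD => //.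
  by apply: measurable_sum => j; exact: measurable_funM.
- apply/measurable_EFinP; apply: (@measurable_ulift _ _ _ _ UU g 1) => // n x.
  exact: cos_max.
- have hae : \forall w \ae Q, forall j : 'I_p, nearstandard (t j) w.
    apply: filter_forall => j; exists (~` nearstandard (t j)); split=> //.
      by apply: measurableC; exact: measurable_nearstandard.
    exact: nearstandard_almost_sure.
  apply: filterS hae => w nw _.
  congr EFin; apply/esym/ulimE.
  apply: continuous_cvg; first exact: continuous_cos.
  apply: cvgD; first exact: cvg_cst.
  apply: cvg_sumR => j; apply: cvgMl_tmp; exact: cvg_standard_part.
Qed.

End ultraproduct_process.

(** * Convergence in distribution from characteristic functions *)

Section bernstein_weights.
Context {R : realType}.
Implicit Types (u : R) (f : nat -> R).

(* The binomial weights C(N,k) u^k (1-u)^(N-k), given by their recursion. *)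
Fixpoint bernstein (N k : nat) u : R :=
  if N is N'.+1 then
    (if k is k'.+1 then u * bernstein N' k' u else 0) + (1 - u) * bernstein N' k u
  else (k == 0%N)%:R.

Lemma bernstein_gt N k u : (N < k)%N -> bernstein N k u = 0.
Proof.
elim: N k => [|N ih] [|k]//= Nk.
by rewrite !ih ?mulr0 ?addr0// (ltn_trans _ Nk).
Qed.

Lemma bernstein_ge0 N k u : 0 <= u <= 1 -> 0 <= bernstein N k u.
Proof.
move=> /andP[u0 u1]; elim: N k => [|N ih] k; first exact: ler0n.
rewrite /= addr_ge0 ?mulr_ge0 ?subr_ge0//.
by case: k => // k; rewrite mulr_ge0.
Qed.

(** For [0 <= u <= 1] this is conditioning a binomial variable on one trial, a success with
    probability [u] raising the count by one. Mean and variance follow from it by induction. *)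
Lemma sum_bernsteinS N u f :
  \sum_(k < N.+2) f k * bernstein N.+1 k u =
  u * (\sum_(k < N.+1) f k.+1 * bernstein N k u) +
  (1 - u) * (\sum_(k < N.+1) f k * bernstein N k u).
Proof.
under eq_bigr do rewrite /= mulrDr.
rewrite big_split/=; congr (_ + _).
  rewrite big_ord_recl/= mulr0 add0r mulr_sumr.
  by apply: eq_bigr => k _; rewrite /bump/= add1n mulrCA.
rewrite big_ord_recr/= bernstein_gt// !mulr0 addr0 mulr_sumr.
by apply: eq_bigr => k _; rewrite mulrCA.
Qed.

Lemma sum_bernstein N u : \sum_(k < N.+1) bernstein N k u = 1.
Proof.
elim: N => [|N ih]; first by rewrite big_ord1.
have := sum_bernsteinS N u (fun=> 1).
have e1 m n : \sum_(k < m) 1 * bernstein n k u = \sum_(k < m) bernstein n k u.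
  by apply: eq_bigr => k _; rewrite mul1r.
by rewrite !e1 => ->; rewrite ih !mulr1 addrC subrK.
Qed.

Lemma sum_bernstein_mean N u :
  \sum_(k < N.+1) (k%:R - N%:R * u) * bernstein N k u = 0.
Proof.
elim: N => [|N ih]; first by rewrite big_ord1/= mul0r subrr mul0r.
rewrite (sum_bernsteinS N u (fun k => k%:R - N.+1%:R * u)).
have s1 := sum_bernstein N u.
have -> : \sum_(k < N.+1) (k.+1%:R - N.+1%:R * u) * bernstein N k u =
    \sum_(k < N.+1) (k%:R - N%:R * u) * bernstein N k u +
    (1 - u) * \sum_(k < N.+1) bernstein N k u.
  by rewrite mulr_sumr -big_split/=; apply: eq_bigr => k _; rewrite -!natr1; ring.
have -> : \sum_(k < N.+1) (k%:R - N.+1%:R * u) * bernstein N k u =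
    \sum_(k < N.+1) (k%:R - N%:R * u) * bernstein N k u +
    (- u) * \sum_(k < N.+1) bernstein N k u.
  by rewrite mulr_sumr -big_split/=; apply: eq_bigr => k _; rewrite -!natr1; ring.
by rewrite ih s1; ring.
Qed.

Lemma sum_bernstein_variance N u :
  \sum_(k < N.+1) (k%:R - N%:R * u) ^+ 2 * bernstein N k u = N%:R * (u * (1 - u)).
Proof.
elim: N => [|N ih]; first by rewrite big_ord1/= !mul0r subrr expr0n mul0r.
rewrite (sum_bernsteinS N u (fun k => (k%:R - N.+1%:R * u) ^+ 2)).
have s1 := sum_bernstein N u; have s2 := sum_bernstein_mean N u.
(* A new trial shifts the centered count by [1 - u] or by [- u]. The cross term vanishes by
   [sum_bernstein_mean], and the two squares average to [u * (1 - u)]. *)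
have E (a : R) : \sum_(k < N.+1) ((k%:R - N%:R * u) + a) ^+ 2 * bernstein N k u =
    N%:R * (u * (1 - u)) + a ^+ 2.
  transitivity (\sum_(k < N.+1) (k%:R - N%:R * u) ^+ 2 * bernstein N k u +
      (2 * a * \sum_(k < N.+1) (k%:R - N%:R * u) * bernstein N k u +
       a ^+ 2 * \sum_(k < N.+1) bernstein N k u)).
    rewrite !mulr_sumr -!big_split/=; apply: eq_bigr => k _; ring.
  by rewrite ih s1 s2; ring.
have -> : \sum_(k < N.+1) (k.+1%:R - N.+1%:R * u) ^+ 2 * bernstein N k u =
    \sum_(k < N.+1) ((k%:R - N%:R * u) + (1 - u)) ^+ 2 * bernstein N k u.
  by apply: eq_bigr => k _; rewrite -!natr1; congr (_ ^+ 2 * _); ring.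
have -> : \sum_(k < N.+1) (k%:R - N.+1%:R * u) ^+ 2 * bernstein N k u =
    \sum_(k < N.+1) ((k%:R - N%:R * u) + (- u)) ^+ 2 * bernstein N k u.
  by apply: eq_bigr => k _; rewrite -!natr1; congr (_ ^+ 2 * _); ring.
by rewrite !E -natr1; ring.
Qed.

Section product.
Context (p N : nat) (u : 'I_p -> R).

Definition bernstein_prod (k : {ffun 'I_p -> 'I_N.+1}) : R :=
  \prod_(j < p) bernstein N (k j) (u j).

(** The marginal of a product weight: distributing the product over the sum leaves a total mass 1
    for each of the other coordinates. *)
Lemma sum_bernstein_prod_dep (i : 'I_p) (f : nat -> R) :
  \sum_(k : {ffun 'I_p -> 'I_N.+1}) f (k i) * bernstein_prod k = \sum_(a < N.+1) f a * bernstein N a (u i).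
Proof.
pose F (j : 'I_p) (a : 'I_N.+1) := (if j == i then f a else 1) * bernstein N a (u j).
transitivity (\sum_(k : {ffun 'I_p -> 'I_N.+1}) \prod_j F j (k j)).
  apply: eq_bigr => k _; rewrite big_split/=; congr (_ * _).
  by rewrite (bigD1 i)//= eqxx big1 ?mulr1// => j /negbTE ->.
rewrite -bigA_distr_bigA (bigD1 i)//= [X in _ * X]big1 ?mulr1.
  by apply: eq_bigr => a _; rewrite /F eqxx.
move=> j /negbTE ji; rewrite -(sum_bernstein N (u j)).
by apply: eq_bigr => a _; rewrite /F ji mul1r.
Qed.

Lemma sum_bernstein_prod : \sum_k bernstein_prod k = 1.
Proof.
rewrite /bernstein_prod -(bigA_distr_bigA (fun j (a : 'I_N.+1) => bernstein N a (u j))).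
by rewrite big1// => j _; exact: sum_bernstein.
Qed.

Lemma bernstein_prod_ge0 k : (forall j, 0 <= u j <= 1) -> 0 <= bernstein_prod k.
Proof. by move=> u01; apply: prodr_ge0 => j _; exact: bernstein_ge0. Qed.

End product.

(** Bernstein's argument: grid points within [del] of [u] contribute at most [e], and Chebyshev's
    inequality bounds the weight of the others, each coordinate having variance at most
    [N%:R^-1]. *)
Lemma bernstein_approx (p N : nat) (u : 'I_p -> R) (H : ('I_p -> R) -> R) (C e del : R) :
  (0 < N)%N -> (forall j, 0 <= u j <= 1) -> 0 < del -> 0 <= e ->
  (forall v, `|H v| <= C) ->
  (forall v, (forall j, 0 <= v j <= 1) -> (forall j, `|v j - u j| <= del) ->
     `|H v - H u| <= e) ->
  `|\sum_(k : {ffun 'I_p -> 'I_N.+1})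
      H (fun j => (k j)%:R / N%:R) * bernstein_prod u k - H u| <=
  e + 2 * C * p%:R / (N%:R * del ^+ 2).
Proof.
move=> N0 u01 del0 e0 HC Hu.
have NR : 0 < N%:R :> R by rewrite ltr0n.
have C0 : 0 <= C by apply: le_trans (HC (fun=> 0)).
have -> : H u = \sum_(k : {ffun 'I_p -> 'I_N.+1}) H u * bernstein_prod u k.
  by rewrite -mulr_sumr sum_bernstein_prod mulr1.
rewrite -sumrB.
apply: le_trans (ler_norm_sum _ _ _) _.
pose D (k : {ffun 'I_p -> 'I_N.+1}) j := ((k j)%:R / N%:R - u j) ^+ 2.
(* Both cases in one bound: as soon as some coordinate is farther than [del], the second summand is
   at least [2 * C]. *)
apply: (@le_trans _ _ (\sum_(k : {ffun 'I_p -> 'I_N.+1})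
    (e + 2 * C / del ^+ 2 * \sum_j D k j) * bernstein_prod u k)).
  apply: ler_sum => k _; rewrite -mulrBl normrM (ger0_norm (bernstein_prod_ge0 _ u01)).
  apply: ler_wpM2r; first exact: bernstein_prod_ge0.
  have D0 : 0 <= \sum_j D k j by apply: sumr_ge0 => j _; exact: sqr_ge0.
  have cd : 0 <= 2 * C / del ^+ 2 by apply: divr_ge0; [exact: mulr_ge0|exact: sqr_ge0].
  have [kd|kd] := pselect (forall j, `|(k j)%:R / N%:R - u j| <= del).
    apply: (@le_trans _ _ e); last by rewrite lerDl mulr_ge0.
    apply: Hu => // j; rewrite divr_ge0//= ler_pdivrMr// mul1r ler_nat.
    by rewrite -ltnS.
  have [j kj] : exists j, del < `|(k j)%:R / N%:R - u j|.
    by apply: contrapT => nj; apply: kd => j; rewrite leNgt; apply/negP => h; apply: nj; exists j.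
  apply: (@le_trans _ _ (2 * C)).
    apply: le_trans (ler_normB _ _) _.
    by have := HC (fun j => (k j)%:R / N%:R); have := HC u; lra.
  apply: (@le_trans _ _ (2 * C / del ^+ 2 * \sum_j D k j)); last by rewrite lerDr.
  rewrite -[leLHS](mulfVK (lt0r_neq0 (exprn_gt0 2 del0))) ler_wpM2l//.
  rewrite (bigD1 j)//=; apply: ler_wpDr.
    by apply: sumr_ge0 => i _; exact: sqr_ge0.
  rewrite /D -(real_normK (num_real ((k j)%:R / N%:R - u j))).
  by rewrite lerXn2r// ?nnegrE ?ltW.
under eq_bigr do rewrite mulrDl.
rewrite big_split/= -mulr_sumr sum_bernstein_prod mulr1 lerD2l.
have -> : \sum_(k : {ffun 'I_p -> 'I_N.+1})
    2 * C / del ^+ 2 * (\sum_j D k j) * bernstein_prod u k =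
  2 * C / del ^+ 2 * \sum_j ((u j * (1 - u j)) / N%:R).
  rewrite mulr_sumr.
  under eq_bigr do rewrite -mulrA mulr_suml mulr_sumr.
  rewrite exchange_big/=; apply: eq_bigr => j _; rewrite -mulr_sumr; congr (_ * _).
  rewrite (sum_bernstein_prod_dep N u j (fun a => (a%:R / N%:R - u j) ^+ 2)).
  have := sum_bernstein_variance N (u j) => h.
  transitivity (N%:R^-2 * \sum_(k < N.+1) (k%:R - N%:R * u j) ^+ 2 * bernstein N k (u j)).
    rewrite mulr_sumr; apply: eq_bigr => a _; rewrite mulrA; congr (_ * _).
    by field; rewrite gt_eqF.
  by rewrite h; field; rewrite gt_eqF.
apply: (@le_trans _ _ (2 * C / del ^+ 2 * \sum_(j < p) N%:R^-1)).
  apply: ler_wpM2l; first by apply: divr_ge0; [exact: mulr_ge0|exact: sqr_ge0].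
  apply: ler_sum => j _; rewrite ler_piMl ?invr_ge0//.
  by have /andP[? ?] := u01 j; nra.
rewrite sumr_const card_ord -[_ *+ p]mulr_natr le_eqVlt; apply/orP; left; apply/eqP.
by field; rewrite !gt_eqF.
Qed.

End bernstein_weights.

(** * Approximation by trigonometric polynomials *)

Section trigonometric_polynomials.
Context {R : realType} (p : nat).

Definition dotf (lam : 'I_p -> R) (y : 'rV[R]_p) : R := \sum_(j < p) lam j * y ord0 j.

Inductive trig_poly : ('rV[R]_p -> R) -> Prop :=
| trig_cos (lam : 'I_p -> R) (th : R) : trig_poly (fun y => cos (th + dotf lam y))
| trig_add G H : trig_poly G -> trig_poly H -> trig_poly (fun y => G y + H y)
| trig_scale c G : trig_poly G -> trig_poly (fun y => c * G y).

Lemma trig_cst c : trig_poly (fun=> c).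
Proof.
have := trig_scale c (trig_cos (fun=> 0) 0); congr trig_poly.
by apply/funext => y; rewrite /dotf big1 ?addr0 ?cos0 ?mulr1// => j _; rewrite mul0r.
Qed.

Lemma trig_sin (i : 'I_p) c : trig_poly (fun y => sin (c * y ord0 i)).
Proof.
have := trig_cos (fun j => if j == i then c else 0) (- (pi / 2)); congr trig_poly.
apply/funext => y; rewrite /dotf (bigD1 i)//= eqxx big1 ?addr0.
  by rewrite addrC cosBpihalf.
by move=> j /negbTE ->; rewrite mul0r.
Qed.

(** The product-to-sum formula turns a product of two cosines with phases into half the sum of two
    such cosines; the rest is bilinearity. *)
Lemma trig_mul G H : trig_poly G -> trig_poly H -> trig_poly (fun y => G y * H y).
Proof.
move=> tG; elim: tG H => [lam th|G1 G2 _ ih1 _ ih2|c G1 _ ih] H tH.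
- elim: tH => [lam' th'|H1 H2 _ ih1 _ ih2|c H1 _ ih].
  + have := trig_scale 2^-1 (trig_add
      (trig_cos (fun j => lam j + lam' j) (th + th'))
      (trig_cos (fun j => lam j - lam' j) (th - th'))).
    congr trig_poly; apply/funext => y.
    have -> : dotf (fun j => lam j + lam' j) y = dotf lam y + dotf lam' y.
      by rewrite /dotf -big_split/=; apply: eq_bigr => j _; rewrite mulrDl.
    have -> : dotf (fun j => lam j - lam' j) y = dotf lam y - dotf lam' y.
      by rewrite /dotf -sumrB; apply: eq_bigr => j _; rewrite mulrBl.
    have -> : th - th' + (dotf lam y - dotf lam' y) =
      (th + dotf lam y) - (th' + dotf lam' y) by ring.
    rewrite addrACA; set a := th + dotf lam y; set b := th' + dotf lam' y.
    by rewrite (cosD a b) cosB; field.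
  + have := trig_add ih1 ih2; congr trig_poly; apply/funext => y; by rewrite mulrDr.
  + have := trig_scale c ih; congr trig_poly; apply/funext => y; by rewrite mulrCA.
- have := trig_add (ih1 _ tH) (ih2 _ tH); congr trig_poly; apply/funext => y.
  by rewrite mulrDl.
- have := trig_scale c (ih _ tH); congr trig_poly; apply/funext => y.
  by rewrite mulrA.
Qed.

Lemma trig_prod (I : Type) (s : seq I) (F : I -> 'rV[R]_p -> R) :
  (forall i, trig_poly (F i)) -> trig_poly (fun y => \prod_(i <- s) F i y).
Proof.
move=> tF; elim: s => [|i s ih].
  by under eq_fun do rewrite big_nil; exact: trig_cst.
by under eq_fun do rewrite big_cons; exact: trig_mul.
Qed.

Lemma trig_sum (I : Type) (s : seq I) (F : I -> 'rV[R]_p -> R) :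
  (forall i, trig_poly (F i)) -> trig_poly (fun y => \sum_(i <- s) F i y).
Proof.
move=> tF; elim: s => [|i s ih].
  by under eq_fun do rewrite big_nil; exact: trig_cst.
by under eq_fun do rewrite big_cons; exact: trig_add.
Qed.

Lemma trig_bernstein N k (s : 'rV[R]_p -> R) : trig_poly s ->
  trig_poly (fun y => bernstein N k (s y)).
Proof.
move=> ts; elim: N k => [|N ih] k /=; first exact: trig_cst.
have t1s : trig_poly (fun y => 1 - s y).
  have := trig_add (trig_cst 1) (trig_scale (-1) ts); congr trig_poly.
  by apply/funext => y; rewrite mulN1r.
by apply: trig_add; [case: k => [|k]; [exact: trig_cst|exact: trig_mul]|exact: trig_mul].
Qed.

Lemma cvg_row (F : set_system nat) {FF : Filter F} (f : nat -> 'I_p -> R) (l : 'I_p -> R) :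
  (forall j, f n j @[n --> F] --> l j) ->
  (\row_j f n j) @[n --> F] --> (\row_j l j : 'rV[R]_p).
Proof.
move=> fl; apply/cvg_ballP => e e0.
have h j : \forall n \near F, ball (l j) e (f n j) by move/cvg_ballP : (fl j); exact.
have hh : \forall n \near F, forall j, ball (l j) e (f n j) by exact: filter_forall.
near=> n.
have hn : forall j, ball (l j) e (f n j) by near: n.
by split=> // i j; rewrite !mxE.
Unshelve. all: by end_near. Qed.

(* Heine-Cantor, by taking limits along an ultrafilter. *)
Lemma uniform_continuity_cube (h : 'rV[R]_p -> R) (psi : R -> R) :
  continuous h -> continuous psi -> forall e : R, 0 < e ->
  exists2 del : R, 0 < del & forall u v : 'I_p -> R,
    (forall j, 0 <= u j <= 1) -> (forall j, 0 <= v j <= 1) ->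
    (forall j, `|v j - u j| <= del) ->
    `|h (\row_j psi (v j)) - h (\row_j psi (u j))| <= e.
Proof.
move=> ch cpsi e e0; apply: contrapT => nh.
have /choice[uv huv] n : exists uv : ('I_p -> R) * ('I_p -> R),
    [/\ forall j, 0 <= uv.1 j <= 1, forall j, 0 <= uv.2 j <= 1,
      forall j, `|uv.2 j - uv.1 j| <= n.+1%:R^-1 &
      e < `|h (\row_j psi (uv.2 j)) - h (\row_j psi (uv.1 j))|].
  apply: contrapT => nuv; apply: nh; exists n.+1%:R^-1 => // u v u1 v1 d.
  by rewrite leNgt; apply/negP => lt; apply: nuv; exists (u, v); split.
have [U [UU Uoo]] := ultraFilterLemma (F := \oo) _.
have bnd (a : R) : 0 <= a <= 1 -> `|a| <= 1.
  by move=> /andP[a0 a1]; rewrite ger0_norm.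
pose l j := ulim U (fun n => (uv n).1 j).
have ul j : (uv n).1 j @[n --> U] --> l j.
  by apply: (@ulim_cvg _ _ _ _ 1) => n; apply: bnd; case: (huv n).
have vl j : (uv n).2 j @[n --> U] --> l j.
  apply/cvgrPdist_le => d d0.
  have d2 : 0 < d / 2 by rewrite divr_gt0.
  have h1 : U [set n | `|l j - (uv n).1 j| <= d / 2].
    by move/cvgrPdist_le : (ul j); apply.
  have h2 : U [set n | n.+1%:R^-1 <= d / 2].
    apply: Uoo; have := @cvg_harmonic R; move/cvgrPdist_le => /(_ _ d2).
    by apply: filterS => n; rewrite sub0r normrN ger0_norm// invr_ge0.
  apply: filterS2 h1 h2 => n h1 h2.
  have [_ _ h3 _] := huv n.
  rewrite (splitr d); apply: le_trans (ler_distD ((uv n).1 j) _ _) (lerD h1 _).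
  by rewrite distrC (le_trans (h3 j)).
have hc (w : nat -> 'I_p -> R) : (forall j, w n j @[n --> U] --> l j) ->
    h (\row_j psi (w n j)) @[n --> U] --> h (\row_j psi (l j)).
  move=> wl; apply: continuous_cvg; first exact: ch.
  apply: cvg_row => j; apply: continuous_cvg; first exact: cpsi.
  exact: wl.
have hd : `|h (\row_j psi ((uv n).2 j)) - h (\row_j psi ((uv n).1 j))| @[n --> U] --> (0 : R).
  rewrite -(@normr0 _ R) -(subrr (h (\row_j psi (l j)))).
  by apply: cvg_norm; apply: cvgB; exact: hc.
have : U set0.
  have hU : U [set n | `|0 - `|h (\row_j psi ((uv n).2 j)) - h (\row_j psi ((uv n).1 j))| | <= e].
    by move/cvgrPdist_le : hd; apply.
  apply: filterS hU => n /=; rewrite sub0r normrN normr_id leNgt => /negP; apply.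
  by case: (huv n).
exact: filter_not_empty.
Qed.

Lemma trig_poly_approx (h : 'rV[R]_p -> R) (C M e : R) : continuous h ->
  (forall v, `|h v| <= C) -> 0 < e ->
  exists G, [/\ trig_poly G, forall y, `|G y| <= C &
    forall y : 'rV[R]_p, (forall j, `|y ord0 j| <= M) -> `|G y - h y| <= e].
Proof.
move=> ch hC e0.
have C0 : 0 <= C by apply: le_trans (hC 0).
(* On the cube [y j / c] stays below 1 in absolute value, hence inside the interval up to [pi / 2]
   where the sine is invertible. *)
pose M' : R := `|M|; pose c : R := M' + 1.
have c0 : 0 < c by rewrite /c ltr_wpDl// normr_ge0.
have Mc : M' / c < 1 by rewrite ltr_pdivrMr// mul1r /c ltrDl.
have Mc0 : 0 <= M' / c by rewrite divr_ge0 ?(ltW c0)// normr_ge0.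
have pi1 : 1 <= pi / 2 :> R by rewrite ler_pdivlMr// mul1r pi_ge2.
have in_pihalf (x : R) : `|x| <= 1 -> x \in `[- (pi / 2), pi / 2].
  rewrite ler_norml in_itv/= => /andP[h1 h2].
  by rewrite (le_trans h2 pi1) andbT (le_trans _ h1)// lerN2.
have sin_le (x y : R) : `|x| <= 1 -> `|y| <= 1 -> x <= y -> sin x <= sin y.
  by move=> x1 y1 xy; rewrite leNgt ltr_sin ?in_pihalf// -leNgt.
pose s0 : R := sin (M' / c).
have s01 : s0 < 1.
  rewrite -sin_pihalf ltr_sin.
  - exact: lt_le_trans Mc pi1.
  - by rewrite in_pihalf// ger0_norm// ltW.
  - by rewrite in_itv/= lexx andbT (le_trans _ (le_trans ler01 pi1))// oppr_le0 (le_trans ler01 pi1).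
have s00 : 0 <= s0.
  by rewrite -sin0 sin_le ?normr0// ger0_norm// ltW.
(* The arcsine is continuous inside ]-1, 1[. Clamping at [s0 < 1] keeps [psi] continuous everywhere
   and leaves untouched the values that come from the cube. *)
pose clamp (x : R) : R := Num.max (- s0) (Num.min s0 x).
have clamp_itv x : -1 < clamp x < 1.
  rewrite /clamp lt_max ltrN2 s01/= gt_max gt_min s01/= andbT.
  by rewrite (le_lt_trans _ ltr01)// oppr_le0.
pose psi (u : R) : R := c * asin (clamp (2 * u - 1)).
have cpsi : continuous psi.
  move=> u; apply: cvgMl_tmp; apply: continuous_cvg.
    exact: continuous_asin.
  apply: (@continuous_comp R R R (fun u => 2 * u - 1) clamp u).
    by apply: cvgB; [apply: cvgMl_tmp; exact: cvg_id|exact: cvg_cst].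
  apply: continuous_max; first exact: cst_continuous.
  by apply: continuous_min; [exact: cst_continuous|exact: cvg_id].
pose s (j : 'I_p) (y : 'rV[R]_p) := 2^-1 * (1 + sin (c^-1 * y ord0 j)).
have s_01 j y : 0 <= s j y <= 1.
  have := sin_geN1 (c^-1 * y ord0 j); have := sin_le1 (c^-1 * y ord0 j).
  by rewrite /s => h1 h2; apply/andP; split; lra.
have psis j (y : 'rV[R]_p) : `|y ord0 j| <= M -> psi (s j y) = y ord0 j.
  move=> yM; rewrite /psi /s mulrA divff// mul1r addrC addrA addNr add0r.
  have yM' : `|y ord0 j| <= M' by rewrite (le_trans yM)// ler_norm.
  have yc : `|c^-1 * y ord0 j| <= M' / c.
    by rewrite normrM normfV (gtr0_norm c0) mulrC ler_pM2r// invr_gt0.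
  have yc1 := le_trans yc (ltW Mc).
  have /andP[y1 y2] : - s0 <= sin (c^-1 * y ord0 j) <= s0.
    rewrite ler_norml in yc; case/andP: yc => a1 a2.
    rewrite -sinN !sin_le//; by rewrite ?normrN ger0_norm// ltW.
  rewrite /clamp min_r// max_r// sinK ?in_pihalf//.
  by rewrite mulrA divff ?mul1r// gt_eqF.
have [del del0 Hdel] := uniform_continuity_cube ch cpsi (divr_gt0 e0 (ltr0Sn R 1)).
have del2 : 0 < del ^+ 2 by rewrite exprn_gt0.
have [N N0 Ne] : exists2 N, (0 < N)%N & 2 * C * p%:R / (N%:R * del ^+ 2) <= e / 2.
  pose x := 2 * C * p%:R / (e / 2 * del ^+ 2).
  exists (Num.truncn x).+1 => //.
  have e2 : 0 < e / 2 by rewrite divr_gt0.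
  have : x < (Num.truncn x).+1%:R by exact: truncnS_gt.
  rewrite {1}/x ltr_pdivrMr ?mulr_gt0// => hx.
  move: hx; set t := (Num.truncn x).+1%:R => hx.
  have t0 : 0 < t by rewrite ltr0Sn.
  by rewrite ler_pdivrMr ?mulr_gt0//; lra.
pose H (u : 'I_p -> R) := h (\row_j psi (u j)).
pose G (y : 'rV[R]_p) := \sum_(k : {ffun 'I_p -> 'I_N.+1})
      H (fun j => (k j)%:R / N%:R) * bernstein_prod (s ^~ y) k.
exists G; split.
- apply: trig_sum => k; apply: trig_scale; apply: trig_prod => j.
  apply: trig_bernstein; apply: trig_scale; apply: trig_add; first exact: trig_cst.
  exact: trig_sin.
(* [s j y] lies in [0, 1] for every [y], so [G y] is a convex combination of values of [h]. *)
- move=> y; apply: le_trans (ler_norm_sum _ _ _) _.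
  apply: (@le_trans _ _ (\sum_(k : {ffun 'I_p -> 'I_N.+1}) C * bernstein_prod (s ^~ y) k)).
    apply: ler_sum => k _; rewrite normrM [X in _ * X]ger0_norm ?bernstein_prod_ge0//.
    by apply: ler_wpM2r; [exact: bernstein_prod_ge0|exact: hC].
  by rewrite -mulr_sumr sum_bernstein_prod mulr1.
- move=> y yM.
  have -> : h y = H (s ^~ y).
    by congr h; apply/rowP => j; rewrite mxE psis.
  have e2 : 0 <= e / 2 by rewrite divr_ge0// ltW.
  have b := bernstein_approx N0 (fun j => s_01 j y) del0 e2
    (fun v => hC (\row_j psi (v j)))
    (fun v v1 vs => Hdel (s ^~ y) v (fun j => s_01 j y) v1 vs).
  by apply: le_trans b _; rewrite [leRHS]splitr lerD2l.
Qed.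

End trigonometric_polynomials.

Section trig_expectation.
Context d (T : measurableType d) (R : realType) (P : probability T R) (p : nat).
Variable (V : T -> 'rV[R]_p).
Hypothesis mV : forall j, measurable_fun setT (fun w => V w ord0 j).

Lemma trig_bounded (G : 'rV[R]_p -> R) : trig_poly G -> exists C, forall y, `|G y| <= C.
Proof.
elim=> [lam th|G1 G2 _ [C1 h1] _ [C2 h2]|c G1 _ [C h]].
- by exists 1 => y; exact: cos_max.
- by exists (C1 + C2) => y; apply: le_trans (ler_normD _ _) _; exact: lerD.
- by exists (`|c| * C) => y; rewrite normrM ler_wpM2l.
Qed.

Lemma measurable_trig (G : 'rV[R]_p -> R) : trig_poly G ->
  measurable_fun setT (fun w => G (V w)).
Proof.
elim=> [lam th|G1 G2 _ h1 _ h2|c G1 _ h].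
- apply: (measurableT_comp (f := cos)).
    by apply: continuous_measurable_fun; exact: continuous_cos.
  apply: measurable_funD => //; apply: measurable_sum => j; exact: measurable_funM.
- exact: measurable_funD.
- exact: measurable_funM.
Qed.

(** Measurability is assumed coordinate by coordinate only. The trigonometric polynomials within
    [n.+1%:R^-1] of [h] on the cube of radius [n] converge pointwise to [h], as each [V w] lies in
    all large cubes. *)
Lemma measurable_continuous_row (h : 'rV[R]_p -> R) (C : R) : continuous h ->
  (forall v, `|h v| <= C) -> measurable_fun setT (fun w => h (V w)).
Proof.
move=> ch hC.
have /choice[G hG] (n : nat) := trig_poly_approx n%:R ch hC (e := n.+1%:R^-1) ltac:(by []).
apply: (@measurable_fun_cvg _ _ _ _ (fun n w => G n (V w))).
  by move=> n; apply: measurable_trig; case: (hG n).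
move=> w _; apply/cvgrPdist_le => e e0.
have h1 : \forall n \near \oo, n.+1%:R^-1 <= e.
  have := @cvg_harmonic R; move/cvgrPdist_le => /(_ _ e0).
  by apply: filterS => n; rewrite sub0r normrN ger0_norm// invr_ge0.
have h2 : \forall n \near \oo, forall j, `|V w ord0 j| <= n%:R.
  apply: filter_forall => j; exact: nbhs_infty_ger.
apply: filterS2 h1 h2 => n h1 h2; have [_ _ h3] := hG n.
by rewrite distrC; apply: le_trans (h3 _ h2) h1.
Qed.

Lemma probability_bigU_le (I : Type) (s : seq I) (B : I -> set T) :
  (forall i, measurable (B i)) ->
  fine (P (\big[setU/set0]_(i <- s) B i)) <= \sum_(i <- s) fine (P (B i)).
Proof.
move=> mB; elim: s => [|i s ih]; first by rewrite !big_nil measure0.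
rewrite !big_cons; have mU : measurable (\big[setU/set0]_(j <- s) B j).
  by apply: bigsetU_measurable.
apply: (@le_trans _ _ (fine (P (B i)) + fine (P (\big[setU/set0]_(j <- s) B j)))).
  rewrite -fineD ?fin_num_measure//; apply: fine_le.
  - by apply: fin_num_measure; exact: measurableU.
  - by rewrite fin_numD !fin_num_measure.
  - exact: measureU2.
by rewrite lerD2l.
Qed.

Lemma measurable_norm_gt (f : T -> R) (M : R) : measurable_fun setT f ->
  measurable [set w | M < `|f w|].
Proof.
move=> mf; rewrite (_ : [set w | _] = (fun w => `|f w|) @^-1` `]M, +oo[); last first.
  by apply/seteqP; split=> x; rewrite /= in_itv/= andbT.
rewrite -[X in measurable X]setTI.
have : measurable_fun setT (fun w => `|f w|) by apply: measurableT_comp.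
exact.
Qed.

Lemma tight_approx (h G : 'rV[R]_p -> R) (C M e : R) :
  continuous h -> (forall v, `|h v| <= C) -> trig_poly G ->
  (forall v, `|G v| <= C) -> 0 <= e ->
  (forall y : 'rV[R]_p, (forall j, `|y ord0 j| <= M) -> `|G y - h y| <= e) ->
  `|\int[P]_w h (V w) - \int[P]_w G (V w)| <=
  e + 2 * C * \sum_(j < p) fine (P [set w | M < `|V w ord0 j|]).
Proof.
move=> ch hC tG GC e0 Gh.
have C0 : 0 <= C by apply: le_trans (hC 0).
have mj (j : 'I_p) : measurable [set w | M < `|V w ord0 j|].
  exact: measurable_norm_gt.
pose A := \big[setU/set0]_(j < p) [set w | M < `|V w ord0 j|].
have mA : measurable A by apply: bigsetU_measurable => j _.
apply: le_trans (@Rintegral_dist_except _ _ _ P _ _ e C A mA _ _ e0 _ _ _) _.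
- exact: measurable_continuous_row ch hC.
- exact: measurable_trig.
- by move=> w; exact: hC.
- by move=> w; exact: GC.
- move=> w nA; rewrite distrC; apply: Gh => j; rewrite leNgt; apply/negP => Mj.
  by apply: nA; rewrite /A (bigD1 j)//; left.
rewrite lerD2l ler_wpM2l ?mulr_ge0//.
exact: probability_bigU_le.
Qed.

End trig_expectation.

Lemma probability_tight d (T : measurableType d) (R : realType) (P : probability T R)
  (f : T -> R) (e : R) : measurable_fun setT f -> 0 < e ->
  exists M : R, fine (P [set w | M < `|f w|]) <= e.
Proof.
move=> mf e0.
pose F n := [set w | n%:R < `|f w|].
have mF n : measurable (F n) by exact: measurable_norm_gt.
have : P (F n) @[n --> \oo] --> P (\bigcap_n F n).
  apply: nonincreasing_cvg_mu => //.
  - by rewrite (le_lt_trans (probability_le1 _ _)) ?ltry.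
  - exact: bigcap_measurable.
  - by move=> m n mn; apply/subsetPset => w /=; apply: le_lt_trans; rewrite ler_nat.
rewrite (_ : \bigcap_n F n = set0); last first.
  apply/seteqP; split=> // w /(_ (Num.truncn `|f w|).+1 I); rewrite /F /=.
  by rewrite ltNge ltW// truncnS_gt.
rewrite measure0 => h.
have /fine_cvg/cvgrPdist_le/(_ _ e0)[N _ hN] : P (F n) @[n --> \oo] --> (0 : R)%:E by [].
exists N%:R; have := hN N (leqnn N).
by rewrite sub0r normrN ger0_norm// fine_ge0.
Qed.

Lemma cvg_in_distribution_of_cf d d' (T : measurableType d) (T' : measurableType d')
    (R : realType) (P : probability T R) (Q : probability T' R) (p : nat)
    (Y : nat -> T -> 'rV[R]_p) (Z : T' -> 'rV[R]_p) :
  (forall n j, measurable_fun setT (fun w => Y n w ord0 j)) ->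
  (forall j, measurable_fun setT (fun w => Z w ord0 j)) ->
  (forall j e, 0 < e -> exists M, forall n, fine (P [set w | M < `|Y n w ord0 j|]) <= e) ->
  (forall lam th, \int[P]_w cos (th + dotf lam (Y n w)) @[n --> \oo] -->
     \int[Q]_w cos (th + dotf lam (Z w))) ->
  cvg_in_distribution P Q Y Z.
Proof.
move=> mY mZ tY cf h ch [C hC].
have ih n : P.-integrable setT (EFin \o (h \o Y n)).
  apply: (@bounded_integrable _ _ _ _ _ C); last by move=> x; exact: hC.
  exact: (@measurable_continuous_row _ _ _ _ _ (mY n) h C ch hC).
have ihZ : Q.-integrable setT (EFin \o (h \o Z)).
  apply: (@bounded_integrable _ _ _ _ _ C); last by move=> x; exact: hC.
  exact: (@measurable_continuous_row _ _ _ _ _ mZ h C ch hC).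
rewrite (_ : (fun n => 'E_P[h \o Y n])%E = (fun n => (\int[P]_w h (Y n w))%:E)); last first.
  by apply/funext => n; rewrite expectationE.
rewrite expectationE//; apply: cvg_EFin; first exact: nearW.
change (\int[P]_w h (Y n w) @[n --> \oo] --> \int[Q]_w h (Z w)).
have trig_cvg G : trig_poly G -> \int[P]_w G (Y n w) @[n --> \oo] --> \int[Q]_w G (Z w).
  have int_trig d1 (T1 : measurableType d1) (P1 : probability T1 R) (V : T1 -> 'rV[R]_p) G1 :
      (forall j, measurable_fun setT (fun w => V w ord0 j)) -> trig_poly G1 ->
      P1.-integrable setT (EFin \o (fun w => G1 (V w))).
    move=> mV tG1; have [C1 h1] := trig_bounded tG1.
    apply: (@bounded_integrable _ _ _ _ _ C1); last by move=> w; exact: h1.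
    exact: measurable_trig.
  elim=> [lam th|G1 G2 t1 h1 t2 h2|c G1 t1 h1]; first exact: cf.
  - rewrite RintegralD//; [|exact: int_trig..].
    apply: cvg_trans (cvgD h1 h2); apply: near_eq_cvg; apply: nearW => n.
    by rewrite RintegralD//; exact: int_trig.
  - rewrite RintegralZl//; last exact: int_trig.
    apply: cvg_trans (cvgM (cvg_cst c) h1); apply: near_eq_cvg; apply: nearW => n.
    by rewrite RintegralZl//; exact: int_trig.
have C0 : 0 <= C by apply: le_trans (hC 0).
apply/cvgrPdist_le => e e0.
(* Passing from [h] to [G] costs [e' + 2 * C * p%:R * e'] for [Y n] and again for [Z], and the
   convergence for [G] costs [e']: in all [e' * (3 + 4 * C * p%:R)]. *)
pose e' : R := e / (3 + 4 * C * p%:R + 1).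
have den : 0 < 3 + 4 * C * p%:R + 1 :> R.
  by rewrite ltr_wpDl// addr_ge0// !mulr_ge0.
have e'0 : 0 < e' by rewrite divr_gt0.
have tZ (j : 'I_p) : exists M : R, fine (Q [set w | M < `|Z w ord0 j|]) <= e'.
  exact: probability_tight.
have /choice[M1 hM1] (j : 'I_p) := tY j e' e'0.
have /choice[M2 hM2] := tZ.
(* One radius that serves every coordinate of both vectors. *)
pose M : R := \sum_j (`|M1 j| + `|M2 j|).
have MM j : `|M1 j| + `|M2 j| <= M.
  by rewrite /M (bigD1 j)//= lerDl sumr_ge0// => i _; rewrite addr_ge0.
have M1M j : M1 j <= M.
  by apply: le_trans (MM j); rewrite (le_trans (ler_norm _))// lerDl.
have M2M j : M2 j <= M.
  by apply: le_trans (MM j); rewrite (le_trans (ler_norm _))// lerDr.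
have [G [tG GC Gh]] := trig_poly_approx M ch hC e'0.
have b1 n := @tight_approx _ _ _ P p (Y n) (mY n) h G C M e' ch hC tG GC (ltW e'0) Gh.
have b2 := @tight_approx _ _ _ Q p Z mZ h G C M e' ch hC tG GC (ltW e'0) Gh.
have anti d1 (T1 : measurableType d1) (P1 : probability T1 R) (f : T1 -> R) m1 m2 :
    measurable_fun setT f -> m1 <= m2 ->
    fine (P1 [set w | m2 < `|f w|]) <= fine (P1 [set w | m1 < `|f w|]).
  move=> mf m12; apply: fine_le; try by [apply: fin_num_measure; exact: measurable_norm_gt].
  by apply: le_measure; rewrite ?inE; [exact: measurable_norm_gt..|move=> w /=; exact: le_lt_trans].
have s1 n : \sum_(j < p) fine (P [set w | M < `|Y n w ord0 j|]) <= p%:R * e'.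
  rewrite mulr_natl -[p in leRHS](card_ord p) -sumr_const; apply: ler_sum => j _.
  by apply: le_trans (anti _ _ _ _ _ _ (mY n j) (M1M j)) (hM1 j n).
have s2 : \sum_(j < p) fine (Q [set w | M < `|Z w ord0 j|]) <= p%:R * e'.
  rewrite mulr_natl -[p in leRHS](card_ord p) -sumr_const; apply: ler_sum => j _.
  by apply: le_trans (anti _ _ _ _ _ _ (mZ j) (M2M j)) (hM2 j).
move/cvgrPdist_le : (trig_cvg G tG) => /(_ _ e'0); apply: filterS => n b3.
have {}b1 : `|\int[P]_w h (Y n w) - \int[P]_w G (Y n w)| <= e' + 2 * C * (p%:R * e').
  by apply: le_trans (b1 n) _; rewrite lerD2l ler_wpM2l// mulr_ge0.
have {}b2 : `|\int[Q]_w h (Z w) - \int[Q]_w G (Z w)| <= e' + 2 * C * (p%:R * e').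
  by apply: le_trans b2 _; rewrite lerD2l ler_wpM2l// mulr_ge0.
apply: (@le_trans _ _ (e' * (3 + 4 * C * p%:R))); last first.
  by rewrite /e' mulrAC ler_pdivrMr// ler_pM2l// lerDl.
have := ler_distD (\int[Q]_w G (Z w)) (\int[Q]_w h (Z w)) (\int[P]_w h (Y n w)).
have := ler_distD (\int[P]_w G (Y n w)) (\int[Q]_w G (Z w)) (\int[P]_w h (Y n w)).
rewrite [X in _ <= _ + X]distrC; rewrite /comp; lra.
Qed.

(** * Characteristic function of the normal law *)

Section normal_density.
Context (R : realType) (s : R).
Hypothesis s0 : s != 0.
Local Notation mu := (@lebesgue_measure R).
Local Notation g := (normal_pdf 0 s).

Lemma is_derive_affine (th t x : R) : is_derive x 1 (fun y : R => th + t * y) t.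
Proof.
have := is_deriveD (is_derive_cst th x 1) (is_deriveZ t (is_derive_id x 1)).
by move/is_derive_eq; apply; rewrite add0r /GRing.scale/= mulr1.
Qed.

Lemma is_derive_normal_pdf (x : R) : is_derive x 1 g (- (x / s ^+ 2) * g x).
Proof.
rewrite normal_pdfE//.
pose v (y : R) : R := - (y - 0) ^+ 2 / (s ^+ 2 *+ 2).
have dv : is_derive x 1 v (- (x / s ^+ 2)).
  have -> : v = (fun y => (- (s ^+ 2 *+ 2)^-1) *: (id * id) y).
    by apply/funext => y; rewrite /v subr0 mulNr [RHS]mulNr mulrC.
  have := is_deriveZ (- (s ^+ 2 *+ 2)^-1) (is_deriveM (is_derive_id x 1) (is_derive_id x 1)).
  by move/is_derive_eq; apply; rewrite /GRing.scale/= !mulr1; field.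
have dE : is_derive x 1 (expR \o v) (expR (v x) * - (x / s ^+ 2)).
  by apply: is_derive1_comp.
have := is_deriveZ (normal_peak s) dE.
by move/is_derive_eq; apply; rewrite /GRing.scale/= /normal_fun -/(v x); ring.
Qed.

Lemma is_derive_sin_affine (th t x : R) :
  is_derive x 1 (fun y : R => sin (th + t * y)) (t * cos (th + t * x)).
Proof.
have := is_derive1_comp (f := sin) (is_derive_sin _) (is_derive_affine th t x).
by rewrite mulrC.
Qed.

Lemma is_derive_cos_affine (th t x : R) :
  is_derive x 1 (fun y : R => cos (th + y * t)) (- (t * sin (th + x * t))).
Proof.
have := is_derive1_comp (f := cos) (is_derive_cos _) (is_derive_affine th t x).
rewrite (_ : _ \o _ = (fun y : R => cos (th + y * t))); last first.
  by apply/funext => y; rewrite /= mulrC.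
by move/is_derive_eq; apply; rewrite (mulrC x t) mulNr; congr (- _); exact: mulrC.
Qed.

(** The majorant is the normal density of twice the variance. With [u = x ^+ 2 / (4 * s ^+ 2)] the
    two exponents are [- 2 * u] and [- u], and [|x| <= 2 * |s| * expR u] is absorbed by the gap.
    Both the integrability of [|x| * g x] and the decay of [g] come from this. *)
Lemma normal_pdf_norm_le : exists2 K : R, 0 <= K &
  forall x, `|x| * g x <= K * normal_pdf 0 (Num.sqrt 2 * s) x.
Proof.
have r0 : Num.sqrt 2 * s != 0 by rewrite mulf_neq0// gt_eqF// sqrtr_gt0.
have pr := normal_peak_gt0 r0.
exists (2 * `|s| * normal_peak s / normal_peak (Num.sqrt 2 * s)).
  by rewrite divr_ge0 ?mulr_ge0 ?normal_peak_ge0.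
move=> x; rewrite normal_pdfE// (normal_pdfE _ r0) [leRHS]mulrA divfK ?gt_eqF//.
rewrite /normal_fun subr0 exprMn sqr_sqrtr//.
pose u : R := (x / (2 * `|s|)) ^+ 2.
have u0 : 0 <= u by exact: sqr_ge0.
have sn : 0 < `|s| by rewrite normr_gt0.
have s2 : `|s| ^+ 2 = s ^+ 2 by rewrite real_normK ?num_real.
have e1 : - x ^+ 2 / (s ^+ 2 *+ 2) = - u + - u.
  by rewrite /u -s2; field; rewrite gt_eqF.
have e2 : - x ^+ 2 / (2 * s ^+ 2 *+ 2) = - u.
  by rewrite /u -s2; field; rewrite gt_eqF.
rewrite e1 e2 expRD.
have e3 : `|x| <= 2 * `|s| * expR u.
  have h1 : `|x| = 2 * `|s| * `|x / (2 * `|s|)|.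
    by rewrite normrM normfV [X in X^-1]ger0_norm ?mulr_ge0//; field; rewrite gt_eqF.
  rewrite h1 ler_pM2l ?mulr_gt0//.
  apply: (@le_trans _ _ (1 + u)); last exact: expR_ge1Dx.
  rewrite /u -[X in _ <= 1 + X]real_normK ?num_real//.
  by have := sqr_ge0 (`|x / (2 * `|s|)| - 2^-1); nra.
have e4 : expR u * expR (- u) = 1 by rewrite -expRD subrr expR0.
have -> : 2 * `|s| * normal_peak s * expR (- u) =
  (2 * `|s| * expR u) * (normal_peak s * (expR (- u) * expR (- u))).
  by rewrite -[LHS]mulr1 -e4; ring.
by apply: ler_wpM2r => //; rewrite !mulr_ge0 ?normal_peak_ge0 ?expR_ge0.
Qed.

Lemma integrable_norm_normal_pdf :
  mu.-integrable setT (fun x => (`|x| * g x)%:E).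
Proof.
have [K K0 h] := normal_pdf_norm_le.
apply: (@le_integrable _ _ _ mu _ measurableT _ (fun x => (K * normal_pdf 0 (Num.sqrt 2 * s) x)%:E)).
- apply/measurable_EFinP; apply: measurable_funM; last exact: measurable_normal_pdf.
  exact: normr_measurable.
- move=> x _ /=; rewrite lee_fin ger0_norm ?mulr_ge0 ?normal_pdf_ge0//.
  by rewrite (le_trans (h x))// ler_norm.
- under eq_fun do rewrite EFinM.
  by apply: integrableZl => //; exact: integrable_normal_pdf.
Qed.

End normal_density.

Section normal_integrals.
Context (R : realType) (s : R).
Hypothesis s0 : s != 0.
Local Notation mu := (@lebesgue_measure R).
Local Notation g := (normal_pdf 0 s).

(** The fundamental theorem of calculus on the intervals from [- n%:R] to [n%:R], then dominated
    convergence. *)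
Lemma integral_derive_eq0 (G G' : R -> R) :
  (forall x : R, is_derive x 1 G (G' x)) -> continuous G' ->
  mu.-integrable setT (EFin \o G') ->
  G n%:R @[n --> \oo] --> 0 -> G (- n%:R) @[n --> \oo] --> 0 ->
  \int[mu]_x G' x = 0.
Proof.
move=> dG cG' iG' G1 G2.
pose f_ (n : nat) := (EFin \o G') \_ `[- n%:R : R, n%:R].
have mG' : measurable_fun setT (EFin \o G') by case/integrableP: iG'.
have [] := @dominated_convergence _ _ _ mu setT measurableT f_ (EFin \o G')
    (fun x => `|G' x|%:E).
- move=> n; apply: (measurable_restrictT _ _).1 => //.
  exact: measurable_funTS.
- exact: mG'.
- apply: aeW => x _ /=; apply: cvg_near_cst.
  have : \forall n \near \oo, `|x| <= n%:R by exact: nbhs_infty_ger.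
  apply: filterS => n; rewrite ler_norml => xn.
  by rewrite /f_ patchE mem_set// /= in_itv/=.
- exact: integrable_norm.
- apply: aeW => x n _ /=; rewrite /f_ patchE.
  by case: ifPn => _ //=; rewrite lee_fin normr0.
move=> _ _ h.
have fE n : (0 < n)%N -> (\int[mu]_x f_ n x = (G n%:R - G (- n%:R))%:E)%E.
  move=> n0; rewrite -integral_mkcond.
  have nn : - n%:R < n%:R :> R by rewrite -subr_gt0 opprK addr_gt0// ltr0n.
  have cG : continuous G.
    by move=> x; apply: differentiable_continuous; apply/derivable1_diffP; have [] := dG x.
  rewrite (@continuous_FTC2 _ _ G _ _ nn)//.
  - exact: continuous_subspaceT.
  - split=> [x _||]; first by have [] := dG x.
    + by apply: cvg_at_right_filter; exact: cG.
    + by apply: cvg_at_left_filter; exact: cG.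
  - by move=> x _; rewrite derive1E; have [_ ->] := dG x.
have lim0 : (\int[mu]_x f_ n x @[n --> \oo] --> 0%:E)%E.
  have : (G n%:R - G (- n%:R))%:E @[n --> \oo] --> (0 - 0 : R)%:E.
    by apply: cvg_EFin; [exact: nearW|exact: cvgB].
  rewrite subr0; apply: cvg_trans; apply: near_eq_cvg.
  by exists 1%N => // n /= n0; rewrite fE.
by rewrite /Rintegral (cvg_unique _ h lim0).
Qed.

Lemma cvg_normal_pdf (u : nat -> R) : (forall n, n%:R <= `|u n|) ->
  g (u n) @[n --> \oo] --> 0.
Proof.
move=> un; have [K K0 h] := normal_pdf_norm_le s0.
pose M := K * normal_peak (Num.sqrt 2 * s).
have r0 : Num.sqrt 2 * s != 0 by rewrite mulf_neq0// gt_eqF// sqrtr_gt0.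
have hM x : `|x| * g x <= M.
  by apply: le_trans (h x) _; rewrite ler_wpM2l// normal_pdf_ub.
apply/cvgr0Pnorm_le => e e0.
have : \forall n \near \oo, M / e + 1 <= n%:R by exact: nbhs_infty_ger.
apply: filterS => n hn.
rewrite ger0_norm ?normal_pdf_ge0//.
have M0 : 0 <= M by rewrite mulr_ge0// normal_peak_ge0.
have u0 : 0 < `|u n|.
  by apply: lt_le_trans (un n); apply: lt_le_trans hn; rewrite ltr_wpDl// divr_ge0// ltW.
rewrite -(ler_pM2l u0) (le_trans (hM _))// -ler_pdivrMr//.
by apply: le_trans (un n); apply: le_trans hn; rewrite lerDl.
Qed.

Lemma integral_normal_prob (f : R -> R) (M : R) : measurable_fun setT f ->
  (forall x, `|f x| <= M) ->
  \int[normal_prob 0 s]_x f x = \int[mu]_x (f x * g x).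
Proof.
move=> mf fM; rewrite /Rintegral.
have nf : (normal_prob 0 s).-integrable setT (EFin \o f).
  exact: (@bounded_integrable _ _ _ _ _ M).
have dom := normal_prob_dominates 0 s.
rewrite -(Radon_Nikodym_change_of_variables dom)//; congr fine.
apply: ae_eq_integral => //.
- apply: emeasurable_funM; first by case/integrableP: nf.
  apply: (measurable_int mu); exact: Radon_Nikodym_integrable.
- apply/measurable_EFinP; apply: measurable_funM => //; exact: measurable_normal_pdf.
- under [X in ae_eq _ _ _ X]eq_fun do rewrite EFinM.
  apply: ae_eqe_mul2l.
  rewrite Radon_NikodymE.
  case: cid => /= h [h1 h2 h3].
  apply: integral_ae_eq => //=.
    by apply/measurable_EFinP; exact: measurable_normal_pdf.
  by move=> E _ mE; rewrite -h3.
Qed.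

End normal_integrals.

Section normal_cf.
Context (R : realType) (s : R).
Hypothesis s0 : s != 0.
Local Notation mu := (@lebesgue_measure R).
Local Notation g := (normal_pdf 0 s).

Lemma continuous_sin_affine (th t : R) : continuous (fun x : R => sin (th + t * x)).
Proof.
move=> x; apply: differentiable_continuous; apply/derivable1_diffP.
by have [] := is_derive_sin_affine th t x.
Qed.

Lemma continuous_cos_affine (th t : R) : continuous (fun x : R => cos (th + t * x)).
Proof.
move=> x; have := @continuous_sin_affine (th + pi / 2) t x.
have e y : sin (th + pi / 2 + t * y) = cos (th + t * y) by rewrite addrAC sinDpihalf.
by rewrite /continuous_at e; under eq_fun do rewrite e.
Qed.

Lemma integrable_mul_normal_pdf (f : R -> R) : continuous f -> (forall x, `|f x| <= 1) ->
  mu.-integrable setT (EFin \o (fun x => f x * g x)).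
Proof.
move=> cf f1; apply: (integrableR_le _ (@integrable_normal_pdf R 0 s)).
  by apply: measurable_funM; [exact: continuous_measurable_fun|exact: measurable_normal_pdf].
by move=> x; rewrite normrM (ger0_norm (normal_pdf_ge0 _ _ _)) ler_piMl// normal_pdf_ge0.
Qed.

Lemma integrable_mul_id_normal_pdf (f : R -> R) : continuous f -> (forall x, `|f x| <= 1) ->
  mu.-integrable setT (EFin \o (fun x => x * f x * g x)).
Proof.
move=> cf f1; apply: (integrableR_le _ (integrable_norm_normal_pdf s0)).
  apply: measurable_funM; last exact: measurable_normal_pdf.
  by apply: measurable_funM => //; exact: continuous_measurable_fun.
move=> x; rewrite !normrM (ger0_norm (normal_pdf_ge0 _ _ _)) ler_wpM2r ?normal_pdf_ge0//.
by rewrite ler_piMr.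
Qed.

(** Integration by parts: the density has derivative [- (x / s ^+ 2) * g x], and the derivative of
    [sin (th + t * x) * g x] integrates to zero because this function vanishes at both ends. *)
Lemma integral_sin_mul_normal_pdf (th t : R) :
  \int[mu]_x (x * sin (th + t * x) * g x) = s ^+ 2 * t * \int[mu]_x (cos (th + t * x) * g x).
Proof.
have i1 := integrable_mul_normal_pdf (@continuous_cos_affine th t) (fun x => cos_max _).
have i2 := integrable_mul_id_normal_pdf (@continuous_sin_affine th t) (fun x => sin_max _).
pose G' x := t * (cos (th + t * x) * g x) - (s ^+ 2)^-1 * (x * sin (th + t * x) * g x).
have iG' : mu.-integrable setT (EFin \o G').
  by apply: integrableRB => //; exact: integrableRZ.
have s20 : s ^+ 2 != 0 by rewrite sqrf_eq0.
have : \int[mu]_x G' x = 0.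
  apply: (@integral_derive_eq0 _ (fun x => sin (th + t * x) * g x) G' _ _ iG').
  - move=> x; have := is_deriveM (is_derive_sin_affine th t x) (is_derive_normal_pdf s0 x).
    move/is_derive_eq; apply.
    by rewrite /GRing.scale/= /G'; field.
  - move=> x; apply: cvgB; apply: cvgM; try exact: cvg_cst.
      by apply: cvgM; [exact: continuous_cos_affine|exact: continuous_normal_pdf].
    apply: cvgM; last exact: continuous_normal_pdf.
    by apply: cvgM; [exact: cvg_id|exact: continuous_sin_affine].
  - apply/cvgr0Pnorm_le => e e0.
    have := @cvg_normal_pdf _ s s0 (fun n => n%:R) (fun n => ler_norm _).
    move/cvgr0Pnorm_le => /(_ _ e0); apply: filterS => n.
    by apply: le_trans; rewrite normrM ler_piMl// sin_max.
  - apply/cvgr0Pnorm_le => e e0.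
    have h n : n%:R <= `|- n%:R : R| by rewrite normrN ler_norm.
    have := cvg_normal_pdf s0 h.
    move/cvgr0Pnorm_le => /(_ _ e0); apply: filterS => n.
    by apply: le_trans; rewrite normrM ler_piMl// sin_max.
rewrite /G' RintegralB//; [|exact: integrableRZ..].
rewrite !RintegralZl// => /eqP; rewrite subr_eq0 => /eqP h.
by rewrite -mulrA h mulrA divff// mul1r.
Qed.

(** Differentiation under the integral sign in [r] is justified by the integrable majorant
    [|y| * g y], which does not depend on [r]. *)
Lemma integral_cos_mul_normal_pdf (th t : R) :
  \int[mu]_x (cos (th + t * x) * g x) = cos th * expR (- (s ^+ 2 * t ^+ 2) / 2).
Proof.
pose f (r x : R) := cos (th + r * x) * g x.
pose F (r : R) := \int[mu]_x f r x.
have df (r x : R) : is_derive r 1 (f ^~ x) (- (x * sin (th + r * x)) * g x).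
  have := is_deriveM (is_derive_cos_affine th x r) (is_derive_cst (g x) r 1).
  by move/is_derive_eq; apply; rewrite scaler0 add0r /GRing.scale/= mulrC.
have d1E (r x : R) : partial1of2 f r x = - (x * sin (th + r * x)) * g x.
  by rewrite partial1of2E; have [_ ->] := df r x.
have dF (r : R) : is_derive r 1 F (- (s ^+ 2 * r) * F r).
  have hyp1 x : `](r - 1), (r + 1)[%classic x -> mu.-integrable setT (EFin \o f x).
    move=> _; apply: (integrable_mul_normal_pdf (@continuous_cos_affine th x)) => y.
    exact: cos_max.
  have hyp2 (x y : R) : `](r - 1), (r + 1)[%classic x -> [set: R] y -> derivable (f ^~ y) x 1.
    by move=> _ _; have [] := df x y.
  have hyp3 (x y : R) : `](r - 1), (r + 1)[%classic x -> [set: R] y ->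
      `|partial1of2 f x y| <= `|y| * g y.
    move=> _ _; rewrite d1E normrM (ger0_norm (normal_pdf_ge0 _ _ _)).
    by rewrite ler_wpM2r ?normal_pdf_ge0// normrN normrM ler_piMr// sin_max.
  have hr : `](r - 1), (r + 1)[%classic r by rewrite /= in_itv/= ltrBlDr ltrDl ltr01.
  have pos (y : R) : 0 <= `|y| * g y by rewrite mulr_ge0// normal_pdf_ge0.
  have iG := integrable_norm_normal_pdf s0.
  have h1 := @derivable_under_integral R _ _ mu f setT measurableT r _ _ hr hyp1 hyp2 _ pos iG hyp3.
  have h2 := @differentiation_under_integral R _ _ mu f setT measurableT r _ _ hr hyp1 hyp2 _ pos iG hyp3.
  apply: DeriveDef => //; rewrite -derive1E h2.
  have -> : \int[mu]_y partial1of2 f r y = \int[mu]_y (-1 * (y * sin (th + r * y) * g y)).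
    by apply: eq_Rintegral => y _; rewrite d1E mulN1r mulNr.
  rewrite RintegralZl//; last first.
    apply: (integrable_mul_id_normal_pdf (@continuous_sin_affine th r)) => y; exact: sin_max.
  by rewrite integral_sin_mul_normal_pdf mulN1r mulNr.
(* The integrating factor of the differential equation: [H] has zero derivative, so it is
   constant. *)
pose H (r : R) := F r * expR (s ^+ 2 / 2 * (r * r)).
have dH (r : R) : is_derive r 1 H 0.
  have dE : is_derive r 1 (fun r : R => expR (s ^+ 2 / 2 * (r * r)))
      (s ^+ 2 * r * expR (s ^+ 2 / 2 * (r * r))).
    have dq : is_derive r 1 (fun r : R => s ^+ 2 / 2 * (r * r)) (s ^+ 2 * r).
      have := is_deriveZ (s ^+ 2 / 2) (is_deriveM (is_derive_id r 1) (is_derive_id r 1)).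
      by move/is_derive_eq; apply; rewrite /GRing.scale/= !mulr1; field.
    have := is_derive1_comp (f := expR) (is_derive_expR _) dq.
    by move/is_derive_eq; apply; rewrite mulrC.
  have := is_deriveM (dF r) dE.
  by move/is_derive_eq; apply; rewrite /GRing.scale/=; ring.
have HE : H t = H 0.
  by apply: is_derive_0_is_cst.
have F0 : F 0 = cos th.
  rewrite /F /f; under eq_Rintegral do rewrite mul0r addr0.
  rewrite RintegralZl//; last exact: integrable_normal_pdf.
  by rewrite /Rintegral integral_normal_pdf/= mulr1.
move: HE; rewrite /H F0 !mulr0 expR0 mulr1 => <-.
rewrite -[RHS]mulrA -expRD [X in expR X](_ : _ = 0) ?expR0 ?mulr1//; by field.
Qed.

Lemma cf_normal_prob (th t : R) :
  \int[normal_prob 0 s]_x cos (th + t * x) = cos th * expR (- (s ^+ 2 * t ^+ 2) / 2).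
Proof.
rewrite -integral_cos_mul_normal_pdf; apply: (@integral_normal_prob _ _ _ 1) => //.
- by apply: continuous_measurable_fun; exact: continuous_cos_affine.
- by move=> x; exact: cos_max.
Qed.

End normal_cf.

(** * Laws on the line are determined by their characteristic functions *)

Lemma distribution_eq_of_rays (R : realType) (m1 m2 : probability R R) :
  (forall a : R, m1 `]-oo, a]%classic = m2 `]-oo, a]%classic) ->
  forall A, measurable A -> m1 A = m2 A.
Proof.
move=> m12; apply: (measure_unique (@ocitv R) (fun n => `]- n%:R : R, n%:R]%classic)) => //.
- exact: ocitvI.
- by move=> n; exact: is_ocitv.
- rewrite -subTset => x _; exists (Num.truncn `|x|).+1 => //=.
  have : `|x| < (Num.truncn `|x|).+1%:R by exact: truncnS_gt.
  by rewrite ltr_norml in_itv/= => /andP[-> /ltW ->].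
- have ray (m : probability R R) (a b : R) : a <= b ->
      m `]a, b]%classic = (m `]-oo, b]%classic - m `]-oo, a]%classic)%E.
    move=> ab; have -> : `]a, b]%classic = `]-oo, b] `\` `]-oo, a].
      by rewrite -[RHS]setCK setCD setCitvl setUC -[LHS]setCK setCitv.
    rewrite measureD ?setIidr//; first exact: subset_itvl.
    by rewrite -ge0_fin_numE// fin_num_measure.
  move=> _ [[a b]] /= _ <-; have [ab|ba] := leP a b.
    by rewrite !ray// !m12.
  by rewrite set_itv_ge ?measure0// bnd_simp -leNgt ltW.
- by move=> n; rewrite (le_lt_trans (probability_le1 _ _)) ?ltry//.
Qed.

Section law_of_cf.
Context d1 d2 (T1 : measurableType d1) (T2 : measurableType d2) (R : realType).
Context (Q1 : probability T1 R) (Q2 : probability T2 R).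
Variables (V1 : T1 -> R) (V2 : T2 -> R).
Hypotheses (mV1 : measurable_fun setT V1) (mV2 : measurable_fun setT V2).
Hypothesis cfE : forall th t, \int[Q1]_w cos (th + t * V1 w) = \int[Q2]_w cos (th + t * V2 w).

#[local] HB.instance Definition _ := @isMeasurableFun.Build _ _ _ _ V1 mV1.
#[local] HB.instance Definition _ := @isMeasurableFun.Build _ _ _ _ V2 mV2.

(** The sequence constantly equal to [V1] is tight and converges in distribution to [V2] by the
    criterion on characteristic functions; the expectations along a constant sequence have a single
    limit. *)
Lemma expectation_eq_of_cf (h : R -> R) (M : R) : continuous h ->
  (forall x, `|h x| <= M) -> \int[Q1]_w h (V1 w) = \int[Q2]_w h (V2 w).
Proof.
move=> ch hM.
pose row (x : R) : 'rV[R]_1 := \row_j x.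
have cid : cvg_in_distribution Q1 Q2 (fun=> row \o V1) (row \o V2).
  apply: cvg_in_distribution_of_cf => /=.
  - by move=> n j; under eq_fun do rewrite mxE.
  - by move=> j; under eq_fun do rewrite mxE.
  - move=> j e e0; have [M0 hM0] := probability_tight Q1 mV1 e0.
    by exists M0 => n; under eq_set do rewrite mxE.
  - move=> lam th; have e x : dotf lam (row x) = lam ord0 * x.
      by rewrite /dotf big_ord1 mxE.
    have e' d (T : measurableType d) (Q : probability T R) (V : T -> R) :
        \int[Q]_w cos (th + dotf lam (row (V w))) = \int[Q]_w cos (th + lam ord0 * V w).
      by apply: eq_Rintegral => w _; rewrite e.
    by rewrite !e' -cfE; exact: cvg_cst.
have mh : measurable_fun setT h by exact: continuous_measurable_fun.
pose H (v : 'rV[R]_1) := h (v ord0 ord0).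
have := cid H _ _.
have i1 : Q1.-integrable setT (EFin \o (h \o V1)).
  apply: (@bounded_integrable _ _ _ _ _ M); last by move=> w; exact: hM.
  exact: measurableT_comp.
have i2 : Q2.-integrable setT (EFin \o (h \o V2)).
  apply: (@bounded_integrable _ _ _ _ _ M); last by move=> w; exact: hM.
  exact: measurableT_comp.
have e1 : H \o (row \o V1) = h \o V1 by apply/funext => w; rewrite /H /= mxE.
have e2 : H \o (row \o V2) = h \o V2 by apply/funext => w; rewrite /H /= mxE.
rewrite e1 e2 !expectationE// => hc.
have : (\int[Q1]_w (h \o V1) w)%:E @[n --> \oo] --> (\int[Q2]_w (h \o V2) w)%:E.
  apply: hc; last by exists M => v; exact: hM.
  by move=> v; apply: continuous_comp; [exact: coord_continuous|exact: ch].
move=> hc'; apply: EFin_inj.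
by apply: (cvg_unique (@ereal_hausdorff R) _ hc'); exact: cvg_cst.
Qed.

Lemma law_eq_of_cf (A : set R) : measurable A -> Q1 (V1 @^-1` A) = Q2 (V2 @^-1` A).
Proof.
pose m1 : probability R R := distribution Q1 V1.
pose m2 : probability R R := distribution Q2 V2.
apply: (@distribution_eq_of_rays R m1 m2) => a.
(* For positive [n], this is 1 up to [a], 0 from [a + n%:R^-1] on, and affine in between: continuous
   functions that tend to the indicator of the ray. *)
pose h (n : nat) (x : R) : R := Num.max 0 (Num.min 1 (1 - n%:R * (x - a))).
have h01 n x : 0 <= h n x <= 1.
  rewrite /h le_max lexx/= ge_max ler01/= ge_min lexx//.
have h1 n x : `|h n x| <= 1 by case/andP: (h01 n x) => p q; rewrite ger0_norm.
have ch n : continuous (h n).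
  move=> x.
  have c1 : {for x, continuous (fun y => 1 - n%:R * (y - a))}.
    apply: cvgB; first exact: cvg_cst.
    by apply: cvgM; [exact: cvg_cst|apply: cvgB; [exact: cvg_id|exact: cvg_cst]].
  apply: (@continuous_max R _ (cst 0) (fun y => Num.min 1 (1 - n%:R * (y - a))) x).
    exact: cvg_cst.
  by apply: (@continuous_min R _ (cst 1) (fun y => 1 - n%:R * (y - a)) x) => //; exact: cvg_cst.
have hlim x : h n x @[n --> \oo] --> (\1_(`]-oo, a]%classic) x : R).
  have [xa|ax] := leP x a.
    rewrite indicE mem_set ?in_itv//=; apply: cvg_near_cst; apply: nearW => n.
    have : 1 <= 1 - n%:R * (x - a).
      by rewrite lerDl oppr_ge0 mulr_ge0_le0// subr_le0.
    by move=> /min_idPl; rewrite /h => ->; apply/max_idPr.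
  rewrite indicE memNset; last by rewrite /= in_itv/= => /(lt_le_trans ax); rewrite ltxx.
  apply: cvg_near_cst.
  have : \forall n \near \oo, (x - a)^-1 <= n%:R by exact: nbhs_infty_ger.
  apply: filterS => n hn; rewrite /h.
  have : 1 - n%:R * (x - a) <= 0.
    by rewrite subr_le0 -ler_pdivrMr ?subr_gt0// mul1r.
  move=> l0; apply/max_idPl; rewrite ge_min l0 orbT//.
have lim d (T : measurableType d) (Q : probability T R) (V : T -> R) :
   measurable_fun setT V ->
   \int[Q]_w h n (V w) @[n --> \oo] --> fine (Q (V @^-1` `]-oo, a]%classic)).
  move=> mV; have mA : measurable (V @^-1` `]-oo, a]%classic).
    by rewrite -[X in measurable X]setTI; exact: mV.
  have -> : fine (Q (V @^-1` `]-oo, a]%classic)) = \int[Q]_w \1_(V @^-1` `]-oo, a]%classic) w.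
    by rewrite /Rintegral integral_indic// setIT.
  apply: (@Rdominated_cvg _ _ _ _ _ _ (cst 1)) => //.
  - by move=> n; apply: measurableT_comp => //; exact: continuous_measurable_fun.
  - exact: (integrable_cstT Q 1).
have l1 := lim _ _ Q1 V1 mV1; have l2 := lim _ _ Q2 V2 mV2.
have e : (fun n => \int[Q1]_w h n (V1 w)) = (fun n => \int[Q2]_w h n (V2 w)).
  by apply/funext => n; exact: (expectation_eq_of_cf (ch n) (h1 n)).
rewrite e in l1.
have fe := cvg_unique (@Rhausdorff R) l1 l2.
have mA d (T : measurableType d) (V : T -> R) : measurable_fun setT V ->
    measurable (V @^-1` `]-oo, a]%classic).
  by move=> mV; rewrite -[X in measurable X]setTI; exact: mV.
change (Q1 (V1 @^-1` `]-oo, a]%classic) = Q2 (V2 @^-1` `]-oo, a]%classic)).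
rewrite -[LHS]fineK; last exact/fin_num_measure/mA.
by rewrite fe fineK//; exact/fin_num_measure/mA.
Qed.

End law_of_cf.

(** * Gaussian processes *)

Section gaussian_cf.
Context d (T : measurableType d) (R : realType) (Q : probability T R).
Variables (X : T -> R) (v : R).
Hypotheses (mX : measurable_fun setT X) (v0 : 0 <= v).
Hypothesis cfX : forall th t, \int[Q]_w cos (th + t * X w) = cos th * expR (- (v * t ^+ 2 / 2)).

Lemma gaussian_variable_of_cf : gaussian_variable Q X.
Proof.
exists 0, (Num.sqrt v) => A mA; rewrite /gaussian_measure.
have mid : measurable_fun setT (fun x : R => x) by exact: measurable_id.
case: eqVneq => [s0|s0].
- have vE : v = 0 by apply/eqP; rewrite eq_le v0 -sqrtr_eq0 s0 eqxx.
  apply: (@law_eq_of_cf _ _ _ _ _ Q (\d_(0 : R) : probability R R) X (fun x => x)) => //.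
  move=> th t; rewrite cfX vE !mul0r oppr0 expR0 mulr1.
  have mc : measurable_fun setT (fun x : R => cos (th + t * x)).
    by apply: continuous_measurable_fun; exact: continuous_cos_affine.
  rewrite /Rintegral integral_dirac//; last exact/measurable_EFinP.
  by rewrite diracT mul1e/= mulr0 addr0.
- apply: (@law_eq_of_cf _ _ T (measurableTypeR R) R Q (normal_prob 0 (Num.sqrt v)) X (fun x => x)) => //.
  move=> th t; rewrite cfX (cf_normal_prob s0) sqr_sqrtr//.
  by congr (_ * expR _); rewrite mulNr.
Qed.

Let t (n : nat) : R := n.+1%:R^-1.
Let t0 n : t n != 0. Proof. by rewrite invr_eq0. Qed.
Let tc : t n @[n --> \oo] --> (0 : R). Proof. exact: cvg_harmonic. Qed.

Let cf_cos s : \int[Q]_w cos (s * X w) = expR (- (v * s ^+ 2 / 2)).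
Proof.
have := cfX 0 s; rewrite cos0 mul1r => <-.
by apply: eq_Rintegral => w _; rewrite add0r.
Qed.

(** The phase [- (pi / 2)] turns the cosine into a sine and makes the factor [cos th] vanish. *)
Let cf_sin s : \int[Q]_w sin (s * X w) = 0.
Proof.
have := cfX (- (pi / 2)) s; rewrite cosN cos_pihalf mul0r => <-.
by apply: eq_Rintegral => w _; rewrite addrC cosB cos_pihalf sin_pihalf mulr0 add0r mulr1.
Qed.

Let lim_cos : (1 - \int[Q]_w cos (t n * X w)) / t n ^+ 2 @[n --> \oo] --> v / 2.
Proof. by under eq_fun do rewrite cf_cos; exact: cvg_onem_expR. Qed.

(** Fatou's lemma: the nonnegative functions [(1 - cos (t n * X w)) / t n ^+ 2] tend to
    [X w ^+ 2 / 2], while their integrals tend to [v / 2]. *)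
Lemma square_integrable_of_cf : square_integrable Q X.
Proof.
have mX2 : measurable_fun setT (fun w => X w ^+ 2) by exact: measurable_funX.
split=> //.
pose f n w := ((1 - cos (t n * X w)) / t n ^+ 2)%:E.
have mf n : measurable_fun setT (f n).
  apply/measurable_EFinP; apply: measurable_funM => //; apply: measurable_funB => //.
  exact: measurable_cosM.
have f0 n w : setT w -> (0 <= f n w)%E.
  by move=> _; rewrite lee_fin divr_ge0 ?sqr_ge0// subr_ge0 cos_le1.
have := fatou Q measurableT mf f0.
have -> : (fun w => limn_einf (f^~ w)) = (fun w => (X w ^+ 2 / 2)%:E).
  apply/funext => w; apply: (cvg_limn_einf_sup _).1; apply: cvg_EFin; first exact: nearW.
  exact: cvg_onem_cosM_div.
have intc n : Q.-integrable setT (EFin \o (fun w => cos (t n * X w))) by exact: integrable_cosM.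
have intf n : (\int[Q]_w f n w)%E = ((1 - \int[Q]_w cos (t n * X w)) / t n ^+ 2)%:E.
  have i1 : Q.-integrable setT (EFin \o (fun w => 1 - cos (t n * X w))).
    by apply: integrableRB => //; exact: integrable_cstT.
  have -> : (\int[Q]_w f n w)%E = (\int[Q]_w ((1 - cos (t n * X w)) * (t n ^+ 2)^-1))%:E.
    rewrite fineK//; apply: integrable_fin_num => //.
    rewrite (_ : (fun w => _) = EFin \o (fun w => (t n ^+ 2)^-1 * (1 - cos (t n * X w)))); last first.
      by apply/funext => w; rewrite /= mulrC.
    exact: integrableRZ.
  rewrite RintegralZr// RintegralB// ?Rintegral_cstT//; exact: integrable_cstT.
have -> : limn_einf (fun n => \int[Q]_w f n w)%E = (v / 2)%:E.
  apply: (cvg_limn_einf_sup _).1; under eq_fun do rewrite intf.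
  by apply: cvg_EFin; first exact: nearW.
move=> h; apply/integrableP; split; first exact/measurable_EFinP.
change (\int[Q]_w `|(X w ^+ 2)%:E| < +oo)%E.
have -> : (\int[Q]_w `|(X w ^+ 2)%:E| = 2%:E * \int[Q]_w (X w ^+ 2 / 2)%:E)%E.
  rewrite -ge0_integralZl//.
  - by apply: eq_integral => w _ /=; rewrite ger0_norm ?sqr_ge0// -EFinM; congr EFin; field.
  - by apply/measurable_EFinP; exact: measurable_funM.
  - by move=> w _; rewrite lee_fin divr_ge0 ?sqr_ge0.
by apply: (@le_lt_trans _ _ (2%:E * (v / 2)%:E)%E); [exact: lee_wpmul2l|rewrite ltry].
Qed.

(** Once [X] is square integrable, dominated convergence applies to the same quotients, and the two
    limits must agree. *)
Lemma second_moment_of_cf : \int[Q]_w (X w ^+ 2) = v.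
Proof.
have [_ i2] := square_integrable_of_cf.
have l1 := cvg_onem_cf_cos mX i2 t0 tc.
have h : \int[Q]_w (X w ^+ 2) / 2 = v / 2 by exact: (cvg_unique (@Rhausdorff R) l1 lim_cos).
by rewrite -[LHS](@divfK _ 2)// h divfK.
Qed.

(** [sin (t n * X w) / t n] tends to [X w], is dominated by its absolute value and has integral
    zero. *)
Lemma mean_of_cf : \int[Q]_w X w = 0.
Proof.
have [_ i2] := square_integrable_of_cf.
have iX := square_integrable_integrable mX i2.
have l1 : \int[Q]_w (sin (t n * X w) / t n) @[n --> \oo] --> \int[Q]_w X w.
  apply: (@Rdominated_cvg _ _ _ _ _ _ (fun w => `|X w|)) => //.
  - by move=> n; apply: measurable_funM => //; exact: measurable_sinM.
  - exact: integrable_norm iX.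
  - by move=> w; exact: cvg_sinM_div.
  - move=> n w; rewrite normrM normfV ler_pdivrMr ?normr_gt0//.
    by rewrite (le_trans (normr_sin_le _))// normrM mulrC.
have l2 : \int[Q]_w (sin (t n * X w) / t n) @[n --> \oo] --> (0 : R).
  apply: cvg_near_cst; apply: nearW => n; rewrite RintegralZr ?cf_sin ?mul0r//.
  exact: integrable_sinM.
exact: (cvg_unique (@Rhausdorff R) l1 l2).
Qed.

End gaussian_cf.

(** * Tightness of the deleted sequential process *)

Lemma chebyshev_second_moment d (T : measurableType d) (R : realType) (P : probability T R)
    (V : T -> R) (M : R) : square_integrable P V -> 0 < M ->
  fine (P [set w | M < `|V w|]) <= (\int[P]_w (V w ^+ 2)) / M ^+ 2.
Proof.
move=> [mV iV] M0; have mA := measurable_norm_gt M mV.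
rewrite ler_pdivlMr ?exprn_gt0// mulrC.
have -> : fine (P [set w | M < `|V w|]) = \int[P]_w (\1_[set w | M < `|V w|] w : R).
  by rewrite /Rintegral integral_indic// setIT.
have mi : measurable_fun setT (\1_[set w | M < `|V w|] : T -> R) by exact: measurable_indic.
have ii : P.-integrable setT (EFin \o (\1_[set w | M < `|V w|] : T -> R)).
  apply: (@bounded_integrable _ _ _ _ _ 1) => // w.
  by rewrite indicE; case: (_ \in _); rewrite ?normr1 ?normr0.
rewrite -RintegralZl//; apply: le_Rintegral => //; first exact: integrableRZ.
move=> w _; rewrite indicE; have [/set_mem/= Mw|_] := boolP (w \in _); last first.
  by rewrite mulr0 sqr_ge0.
by rewrite mulr1 -[leRHS]real_normK ?num_real// lerXn2r ?nnegrE// ltW.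
Qed.

Section process_tightness.
Context d (T : measurableType d) (R : realType) (Pr : probability T R).
Context dX (X : measurableType dX) (P : probability X R).
Context (xi : nat -> {RV Pr >-> X}).
Hypothesis xi_law : forall i, has_law Pr (xi i) P.
Hypothesis xi_indep : mutually_independent Pr (fun i => xi i : T -> X).
Context (del : forall m : nat, {set 'I_m}).
Let Y := deleted_sequential_process P (fun i => xi i : T -> X) del.

Lemma measurable_process n (xf : R * (X -> R)) : measurable_fun setT xf.2 ->
  measurable_fun setT (Y n xf).
Proof.
move=> mf; apply: measurable_funM => //.
under eq_fun do rewrite big_mkcond/=.
apply: measurable_sum => i; have [_|_] := boolP (i \in _); first exact: measurable_cst.
apply: measurable_funB; [exact: measurableT_comp|exact: measurable_cst].
Qed.

(** At most [n] orthogonal terms, each weighted by at most [b ^+ 2], the inverse of [n]. The bound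
    is uniform in [n], which is what tightness requires. *)
Lemma second_moment_process_le n (x : R) (f : X -> R) :
  0 <= x <= 1 -> square_integrable P f ->
  square_integrable Pr (Y n (x, f)) /\
  \int[Pr]_w (Y n (x, f) w ^+ 2) <= \int[P]_y (centered P f y ^+ 2).
Proof.
move=> x01 sf.
have [mc c2] := centered_square_integrable sf.
have c0 : 0 <= \int[P]_y (centered P f y ^+ 2).
  by apply: Rintegral_ge0 => y _; exact: sqr_ge0.
pose a := Num.truncn (n%:R * x).
have an : (a <= n)%N by exact: truncn_scale_le.
pose b : R := (Num.sqrt n%:R)^-1.
pose g i y : R := b * (kept del a i)%:R * centered P f y.
have YE : Y n (x, f) = partial_sum xi g n.
  apply/funext => w.
  rewrite /Y /deleted_sequential_process /= -/a -/b.
  rewrite (kept_sum del (fun i => centered P f (xi i w)) an) mulr_sumr.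
  by apply: eq_bigr => i _; rewrite /g mulrA.
have mg i : measurable_fun setT (g i) by exact: measurable_funM.
have g2 i : P.-integrable setT (EFin \o (fun y => g i y ^+ 2)).
  by have [] := square_integrableZ (b * (kept del a i)%:R) (centered_square_integrable sf).
have g0 i : \int[P]_y g i y = 0.
  by rewrite RintegralZl ?Rintegral_centered ?mulr0//; exact: square_integrable_integrable.
have [i2 e2] := second_moment_partial_sum xi_law xi_indep mg g2 g0 n.
split; first by split; [apply: measurable_process; case: sf|rewrite YE].
rewrite YE e2.
apply: (@le_trans _ _ (\sum_(i < n) b ^+ 2 * \int[P]_y (centered P f y ^+ 2))).
  apply: ler_sum => i _.
  under eq_Rintegral do rewrite /g exprMn.
  rewrite RintegralZl//; apply: ler_wpM2r => //.
  by rewrite exprMn ler_piMr ?sqr_ge0//; case: (kept _ _ _); rewrite ?expr1n ?expr0n.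
rewrite sumr_const card_ord -mulrnAl ler_piMl// /b exprVn sqr_sqrtr// -[leLHS]mulr_natr.
by case: (n) => [|m]; rewrite ?mulr0// mulVf.
Qed.

Lemma tight_process (x : R) (f : X -> R) : 0 <= x <= 1 -> square_integrable P f ->
  forall e : R, 0 < e -> exists M, forall n, fine (Pr [set w | M < `|Y n (x, f) w|]) <= e.
Proof.
move=> x01 sf e e0.
pose c := \int[P]_y (centered P f y ^+ 2).
have c0 : 0 <= c by apply: Rintegral_ge0 => y _; exact: sqr_ge0.
have M0 : 0 < c / e + 1 by rewrite ltr_wpDl// divr_ge0// ltW.
(* Chebyshev leaves [c / M ^+ 2], and the square of [c / e + 1] is at least [c / e]; the 1 also
   keeps the level positive when [c = 0]. *)
exists (c / e + 1) => n.
have [sY le_c] := second_moment_process_le n x01 sf.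
apply: le_trans (chebyshev_second_moment sY M0) _.
rewrite ler_pdivrMr ?exprn_gt0//; apply: le_trans le_c _; rewrite -/c.
have ec : c = e * (c / e) by field; rewrite gt_eqF.
rewrite [leLHS]ec ler_pM2l//.
have : 0 <= c / e by rewrite divr_ge0// ltW.
by nra.
Qed.

End process_tightness.

Lemma covariance_mean0 d (T : measurableType d) (R : realType) (Q : probability T R)
    (V W : T -> R) : square_integrable Q V -> square_integrable Q W ->
  \int[Q]_w V w = 0 -> \int[Q]_w W w = 0 ->
  covariance Q V W = (\int[Q]_w (V w * W w))%:E.
Proof.
move=> sV sW V0 W0.
have iV : Q.-integrable setT (EFin \o V) by case: sV => m i; exact: square_integrable_integrable.
have iW : Q.-integrable setT (EFin \o W) by case: sW => m i; exact: square_integrable_integrable.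
have eV : ('E_Q[V] = 0)%E by rewrite expectationE// V0.
have eW : ('E_Q[W] = 0)%E by rewrite expectationE// W0.
rewrite unlock eV eW /=.
rewrite (_ : ((V \- cst 0) * (W \- cst 0))%R = (fun w => V w * W w)); last first.
  by apply/funext => w; change ((V w - 0) * (W w - 0) = V w * W w); rewrite !subr0.
rewrite expectationE//; exact: square_integrable_mul.
Qed.

Section process_of_cf.
Context d (T : measurableType d) (R : realType) (Q : probability T R).
Context (I : Type) (D : set I) (Z : I -> {RV Q >-> R}) (K : I -> I -> R).
Hypothesis cfZ : forall (p : nat) (t : 'I_p -> I) (lam : 'I_p -> R) th, (forall j, D (t j)) ->
  \int[Q]_w cos (th + \sum_(j < p) lam j * Z (t j) w) =
  cos th * expR (- ((\sum_(j < p) \sum_(l < p) lam j * lam l * K (t j) (t l)) / 2)).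

Let v p (t : 'I_p -> I) (lam : 'I_p -> R) :=
  \sum_(j < p) \sum_(l < p) lam j * lam l * K (t j) (t l).

Let comb p (t : 'I_p -> I) (lam : 'I_p -> R) (w : T) := \sum_(j < p) lam j * Z (t j) w.

Let measurable_comb p (t : 'I_p -> I) (lam : 'I_p -> R) : measurable_fun setT (comb t lam).
Proof. by apply: measurable_sum => j; exact: measurable_funM. Qed.

Let cf_comb p (t : 'I_p -> I) (lam : 'I_p -> R) : (forall j, D (t j)) -> forall th s,
  \int[Q]_w cos (th + s * comb t lam w) = cos th * expR (- (v t lam * s ^+ 2 / 2)).
Proof.
move=> Dt th s; under eq_Rintegral do rewrite /comb mulr_sumr; rewrite /=.
under eq_Rintegral do under eq_bigr do rewrite mulrA.
rewrite (cfZ (fun j => s * lam j))//; congr (_ * expR (- (_ / 2))).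
rewrite /v mulr_suml; apply: eq_bigr => j _; rewrite mulr_suml; apply: eq_bigr => l _.
by ring.
Qed.

(** The mean of a cosine is at most 1, and here it equals [expR (- (v t lam / 2))]. *)
Let v_ge0 p (t : 'I_p -> I) (lam : 'I_p -> R) : (forall j, D (t j)) -> 0 <= v t lam.
Proof.
move=> Dt; have h := cf_comb lam Dt 0 1.
have : \int[Q]_w cos (0 + 1 * comb t lam w) <= 1.
  have mc : measurable_fun setT (fun w => cos (0 + 1 * comb t lam w)).
    apply: (measurableT_comp (f := fun x : R => cos (0 + 1 * x))) => //.
    by apply: continuous_measurable_fun; exact: continuous_cos_affine.
  have cb w : `|cos (0 + 1 * comb t lam w)| <= 1 by exact: cos_max.
  by apply: le_trans (ler_norm _) _; exact: (Rintegral_bound (bounded_integrable Q mc cb) cb).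
rewrite h cos0 mul1r expr1n mulr1 -[X in _ <= X]expR0 ler_expR oppr_le0.
by rewrite pmulr_lge0.
Qed.

Lemma gaussian_process_of_cf : gaussian_process D Z.
Proof.
move=> p t a Dt; apply: (@gaussian_variable_of_cf _ _ _ _ (comb t a) (v t a)).
- exact: measurable_comb.
- exact: v_ge0.
- exact: cf_comb.
Qed.

Let comb1 i : comb (fun _ : 'I_1 => i) (fun=> 1) = Z i.
Proof. by apply/funext => w; rewrite /comb big_ord1 mul1r. Qed.

Let v1 i : v (fun _ : 'I_1 => i) (fun=> 1) = K i i.
Proof. by rewrite /v !big_ord1 !mul1r. Qed.

Let square_integrable_process i : D i -> square_integrable Q (Z i).
Proof.
move=> Di; rewrite -comb1; apply: (@square_integrable_of_cf _ _ _ _ _ (K i i)).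
- exact: measurable_comb.
- by rewrite -v1; apply: v_ge0.
- by rewrite -v1; exact: cf_comb.
Qed.

Let mean_process i : D i -> \int[Q]_w Z i w = 0.
Proof.
move=> Di; have := @mean_of_cf _ _ _ Q (comb (fun _ : 'I_1 => i) (fun=> 1)) (K i i).
rewrite {3}comb1; apply.
- exact: measurable_comb.
- by rewrite -v1; apply: v_ge0.
- by rewrite -v1; exact: cf_comb.
Qed.

Lemma expectation_process_of_cf i : D i -> ('E_Q[Z i] = 0)%E.
Proof.
move=> Di; have [mZ iZ] := square_integrable_process Di.
by rewrite expectationE ?mean_process//; exact: square_integrable_integrable.
Qed.

Let second_moment_process i : D i -> \int[Q]_w (Z i w ^+ 2) = K i i.
Proof.
move=> Di; have := @second_moment_of_cf _ _ _ Q (comb (fun _ : 'I_1 => i) (fun=> 1)) (K i i).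
rewrite {3}comb1; apply.
- exact: measurable_comb.
- by rewrite -v1; apply: v_ge0.
- by rewrite -v1; exact: cf_comb.
Qed.

(** Polarization: the second moment of [Z i + Z j] is [K i i + K j j + 2 * K i j], and the two
    squares are known from the one-dimensional case. *)
Lemma covariance_process_of_cf i j : (forall i j, K i j = K j i) -> D i -> D j ->
  covariance Q (Z i) (Z j) = (K i j)%:E.
Proof.
move=> KC Di Dj; have si := square_integrable_process Di; have sj := square_integrable_process Dj.
rewrite covariance_mean0 ?mean_process//; congr EFin.
pose t (b : 'I_2) := if b == ord0 then i else j.
have Dt b : D (t b) by rewrite /t; case: ifP.
have := second_moment_of_cf (measurable_comb t (fun=> 1)) (v_ge0 (fun=> 1) Dt) (cf_comb (fun=> 1) Dt).
have -> : v t (fun=> 1) = K i i + K j j + 2 * K i j.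
  by rewrite /v !big_ord_recl !big_ord0 /t /= !mul1r (KC j i); ring.
under eq_Rintegral do rewrite /comb !big_ord_recl big_ord0 /t /= !mul1r addr0 sqrrD.
have iM := square_integrable_mul si sj.
have [mi i2] := si; have [mj j2] := sj.
have -> : \int[Q]_w (Z i w ^+ 2 + Z i w * Z j w *+ 2 + Z j w ^+ 2) =
    \int[Q]_w (Z i w ^+ 2) + 2 * \int[Q]_w (Z i w * Z j w) + \int[Q]_w (Z j w ^+ 2).
  under eq_Rintegral do rewrite -mulr_natl.
  rewrite RintegralD//; last by apply: integrableRD => //; exact: integrableRZ.
  rewrite RintegralD//; last exact: integrableRZ.
  by rewrite RintegralZl.
rewrite !second_moment_process//; lra.
Qed.

End process_of_cf.

(** * Assembling the limit theorem *)

Section process_cf.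
Context d (T : measurableType d) (R : realType) (Pr : probability T R).
Context dX (X : measurableType dX) (P : probability X R).
Context (xi : nat -> {RV Pr >-> X}).
Hypothesis xi_law : forall i, has_law Pr (xi i) P.
Hypothesis xi_indep : mutually_independent Pr (fun i => xi i : T -> X).
Context (k : nat -> nat) (del : forall m : nat, {set 'I_m}).
Hypothesis del_k : deletion_sets k del.
Hypothesis k_small : (k n)%:R / n%:R @[n --> \oo] --> (0 : R).
Context (p : nat) (tt : 'I_p -> R * (X -> R)) (lam : 'I_p -> R).
Hypothesis tt01 : forall j, 0 <= (tt j).1 <= 1.
Hypothesis tt2 : forall j, square_integrable P (tt j).2.
Let Y := deleted_sequential_process P (fun i => xi i : T -> X) del.

(** The addition formula separates the phase from the process; the sine part tends to zero. *)
Lemma cvg_process_cf (th : R) :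
  \int[Pr]_w cos (th + \sum_(j < p) lam j * Y n (tt j) w) @[n --> \oo] -->
  cos th * expR (- ((\sum_(j < p) \sum_(l < p)
    lam j * lam l * kiefer_mueller_cov P (tt j) (tt l)) / 2)).
Proof.
have mS n : measurable_fun setT (fun w => \sum_(j < p) lam j * Y n (tt j) w).
  apply: measurable_sum => j; apply: measurable_funM => //.
  by apply: measurable_process; case: (tt2 j).
have ic n : Pr.-integrable setT (EFin \o (fun w => cos (\sum_(j < p) lam j * Y n (tt j) w))).
  apply: (@bounded_integrable _ _ _ _ _ 1); last by move=> w; exact: cos_max.
  by apply: measurableT_comp (mS n); apply: continuous_measurable_fun; exact: continuous_cos.
have is_ n : Pr.-integrable setT (EFin \o (fun w => sin (\sum_(j < p) lam j * Y n (tt j) w))).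
  apply: (@bounded_integrable _ _ _ _ _ 1); last by move=> w; exact: sin_max.
  by apply: measurableT_comp (mS n); apply: continuous_measurable_fun; exact: continuous_sin.
have -> : (fun n => \int[Pr]_w cos (th + \sum_(j < p) lam j * Y n (tt j) w)) =
    (fun n => cos th * \int[Pr]_w cos (\sum_(j < p) lam j * Y n (tt j) w) -
              sin th * \int[Pr]_w sin (\sum_(j < p) lam j * Y n (tt j) w)).
  apply/funext => n; under eq_Rintegral do rewrite cosD.
  rewrite RintegralB//; [|exact: integrableRZ..].
  by rewrite !RintegralZl.
rewrite -[X in _ --> X]subr0 -[X in _ - X](mulr0 (sin th)).
apply: cvgB; apply: cvgM; try exact: cvg_cst.
- have := cvg_process_cos xi_law xi_indep del_k k_small tt01 tt2; exact.
- have := cvg_process_sin xi_law xi_indep del lam tt01 tt2; exact.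
Qed.

End process_cf.

Lemma kiefer_mueller_covC d (X : measurableType d) (R : realType) (P : probability X R)
    (s t : R * (X -> R)) : kiefer_mueller_cov P s t = kiefer_mueller_cov P t s.
Proof.
rewrite /kiefer_mueller_cov minC mulrC [RHS]mulrC; congr (_ * _).
by congr (_ - _); [under eq_Rintegral do rewrite mulrC|rewrite mulrC].
Qed.

Theorem theorem6 (R : realType)
    (dO : measure_display) (Omega : measurableType dO) (Pr : probability Omega R)
    (dX : measure_display) (X : measurableType dX) (P : probability X R)
    (xi : nat -> {RV Pr >-> X})
    (xi_law : forall i, has_law Pr (xi i) P)
    (xi_indep : mutually_independent Pr (fun i => xi i : Omega -> X))
    (F : set (X -> R))
    (F_L2 : forall f, F f ->
       measurable_fun [set: X] f /\
       P.-integrable [set: X] (fun y => (f y ^+ 2)%:E))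
    (k : nat -> nat) (del : forall m : nat, {set 'I_m})
    (del_k : deletion_sets k del)
    (k_small : (k n)%:R / n%:R @[n --> \oo] --> (0 : R)) :
  exists (dQ : measure_display) (Omega' : measurableType dQ)
    (Q : probability Omega' R) (Z : R * (X -> R) -> {RV Q >-> R}),
    let D : set (R * (X -> R)) := `[0, 1]%classic `*` F in
    [/\ gaussian_process D Z,
        forall s f, D (s, f) -> ('E_Q[Z (s, f)] = 0)%E,
        forall s t f g, D (s, f) -> D (t, g) ->
          covariance Q (Z (s, f)) (Z (t, g)) =
          (Num.min s t * (\int[P]_y (f y * g y) -
                          (\int[P]_y f y) * (\int[P]_y g y)))%:E
      & marginals_cvg Pr Q D
          (deleted_sequential_process P (fun i => xi i : Omega -> X) del)
          (fun i => Z i : Omega' -> R)].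
Proof.
pose D : set (R * (X -> R)) := `[0, 1]%classic `*` F.
have D01 i : D i -> 0 <= i.1 <= 1 by case=> /=; rewrite in_itv.
have D2 i : D i -> square_integrable P i.2 by case=> _ /F_L2.
pose Y0 := deleted_sequential_process P (fun i => xi i : Omega -> X) del.
(* Standard parts are formed for all indices, including those with [f] outside [F]. Setting the
   process to 0 there gives measurability and tightness everywhere. *)
pose Y n i w : R := if `[< D i >] then Y0 n i w else 0.
have YE n i : D i -> Y n i = Y0 n i.
  by move=> Di; apply/funext => w; rewrite /Y asboolT.
have mY n i : measurable_fun [set: Omega] (Y n i).
  have [Di|nDi] := pselect (D i).
    by rewrite YE//; apply: measurable_process; case: (D2 i Di).
  rewrite (_ : Y n i = cst 0); first exact: measurable_cst.
  by apply/funext => w; rewrite /Y asboolF.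
have tY i (e : R) : 0 < e ->
    exists M, forall n, fine (Pr [set w | M < `|Y n i w|]) <= e.
  move=> e0; have [Di|nDi] := pselect (D i).
    have [M hM] := tight_process xi_law xi_indep del (D01 i Di) (D2 i Di) e0.
    by exists M => n; rewrite YE//; case: (i) hM => x f; apply.
  exists 0 => n; rewrite (_ : [set w | _] = set0) ?measure0 ?ltW//.
  by apply/seteqP; split=> w //=; rewrite /Y asboolF// normr0 ltxx.
have [U [UU Uoo]] := ultraFilterLemma (F := \oo) _.
pose Q : probability (loeb_space Omega UU) R := loeb_measure Pr UU Uoo.
pose Z i : {RV Q >-> R} := @standard_part_RV _ _ _ Pr U UU Uoo _ Y mY i.
have cfY p (t : 'I_p -> R * (X -> R)) (lam : 'I_p -> R) (th : R) : (forall j, D (t j)) ->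
    \int[Pr]_w cos (th + \sum_(j < p) lam j * Y n (t j) w) @[n --> \oo] -->
    cos th * expR (- ((\sum_(j < p) \sum_(l < p)
      lam j * lam l * kiefer_mueller_cov P (t j) (t l)) / 2)).
  move=> Dt; have := cvg_process_cf xi_law xi_indep del_k k_small
    (fun j => D01 _ (Dt j)) (fun j => D2 _ (Dt j)) (lam := lam) (th := th).
  by under [in X in _ -> X]eq_fun do under eq_Rintegral do under eq_bigr do rewrite YE//.
have cfZ p (t : 'I_p -> R * (X -> R)) (lam : 'I_p -> R) (th : R) : (forall j, D (t j)) ->
    \int[Q]_w cos (th + \sum_(j < p) lam j * Z (t j) w) =
    cos th * expR (- ((\sum_(j < p) \sum_(l < p)
      lam j * lam l * kiefer_mueller_cov P (t j) (t l)) / 2)).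
  move=> Dt; rewrite (integral_cos_standard_part UU Uoo mY tY).
  (* [U] is finer than [\oo], so a limit along [\oo] is also the limit along [U]. *)
  by apply: (ulimE UU); apply: cvg_trans (cfY _ _ lam th Dt); exact: cvg_app.
exists _, _, Q, Z; split.
- exact: gaussian_process_of_cf cfZ.
- by move=> s f Dsf; exact: (expectation_process_of_cf cfZ Dsf).
- move=> s t f g Dsf Dtg.
  exact: (covariance_process_of_cf cfZ (@kiefer_mueller_covC _ _ _ P) Dsf Dtg).
(* Although [Z] is built along [U], convergence holds along the whole sequence: both characteristic
   functions are compared with the same explicit formula. *)
- move=> p t; rewrite -/D => Dt.
  apply: cvg_in_distribution_of_cf.
  + move=> n j; under eq_fun do rewrite mxE.
    by have := mY n (t j); rewrite (YE _ _ (Dt j)).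
  + by move=> j; under eq_fun do rewrite mxE; exact: measurable_funPT (Z (t j)).
  + move=> j e e0; have [M hM] := tY (t j) e e0; exists M => n.
    by under eq_set do rewrite mxE; have := hM n; rewrite (YE _ _ (Dt j)).
  + move=> lam th.
    have dE d' (T' : measurableType d') (Q' : probability T' R) (V : 'I_p -> T' -> R) :
        \int[Q']_w cos (th + dotf lam (\row_j V j w)) =
        \int[Q']_w cos (th + \sum_(j < p) lam j * V j w).
      apply: eq_Rintegral => w _; congr (cos (th + _)).
      by apply: eq_bigr => j _; rewrite mxE.
    rewrite (dE _ _ Q (fun j w => Z (t j) w)) cfZ//.
    have -> : (fun n => \int[Pr]_w cos (th + dotf lam (\row_j Y0 n (t j) w))) =
        (fun n => \int[Pr]_w cos (th + \sum_(j < p) lam j * Y n (t j) w)).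
      apply/funext => n; rewrite (dE _ _ Pr (fun j w => Y0 n (t j) w)).
      apply: eq_Rintegral => w _; congr (cos (th + _)).
      by apply: eq_bigr => j _; rewrite (YE _ _ (Dt j)).
    exact: cfY.
Qed.
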